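(* For every $(\beta,\mathfrak e)\in(0,1)\times(0,1)$ satisfying $0<\beta^2+\mathfrak e^2<1$, we have $$\mathrm{vol}(\mathfrak M)>\frac{T_{\beta,\mathfrak e}^2}{\sqrt{1+7\beta}}>\frac{T_{\beta,\mathfrak e}^2}{\rho_{\beta,\mathfrak e}-1},\qquad T_{\beta,\mathfrak e}=2\pi\left(\frac{1-\sqrt{1-\mathfrak e^2}}{\sqrt2\,\beta}\right),$$ where $T_{\beta,\mathfrak e}$ is the Reeb period (action) and $\rho_{\beta,\mathfrak e}$ the rotation number of the Euler orbit $\zeta_e\subset\mathfrak M=\mathfrak M_{\beta,\mathfrak e}$, and $\mathrm{vol}(\mathfrak M)$ is the contact volume of $\mathfrak M$.
   Context: For $\alpha,\varpi>0$ let $$H(p_r,p_z,r,z)=\frac{p_r^2+p_z^2}{2}+\frac{\varpi^2}{2r^2}-\frac1r-\frac{4}{\alpha\sqrt{r^2+(1+2\alpha)z^2}},\quad (r,z)\in(0,\infty)\times\mathbb R,\ (p_r,p_z)\in\mathbb R^2.$$ Put $\beta=1/(1+4/\alpha)$, $\mathfrak e=\sqrt{1-2\varpi^2\beta^2}$; thus $(\beta,\mathfrak e)\in(0,1)\times(0,1)$ determines $\alpha=4\beta/(1-\beta)$ and $\varpi=\sqrt{1-\mathfrak e^2}/(\sqrt2\beta)$. Let $\mathfrak M=\mathfrak M_{\beta,\mathfrak e}=H^{-1}(-1)$; for $\beta^2+\mathfrak e^2<1$ it is a regular compact energy surface diffeomorphic to $S^3$. There is a contact form $\lambda$ on $\mathfrak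 M$ with $d\lambda=(dp_r\wedge dr+dp_z\wedge dz)|_{\mathfrak M}$ whose Reeb vector field is parallel to the Hamiltonian vector field. The contact volume is $\mathrm{vol}(\mathfrak M)=\int_{\mathfrak M}\lambda\wedge d\lambda>0$ (equal to $2\int_{H\le -1}dp_r\wedge dr\wedge dp_z\wedge dz$, independent of $\lambda$). The Euler orbit is $\zeta_e=\mathfrak M\cap\{z=p_z=0\}$ and $T_{\beta,\mathfrak e}=\int_{\zeta_e}\lambda$. Its rotation number is $\rho_{\beta,\mathfrak e}=\rho(\gamma_{\beta,\mathfrak e})+1$, where $\gamma_{\beta,\mathfrak e}:\mathbb R\to\mathrm{Sp}(2)$, $\gamma_{\beta,\mathfrak e}(0)=I_2$, is the fundamental solution of $\xi'=\begin{pmatrix}0&-1\\1&0\end{pmatrix}\begin{pmatrix}1&0\\0&1+\frac{7\beta}{1+\mathfrak e\cos\theta}\end{pmatrix}\xi$ and $\rho(\gamma_{\beta,\mathfrak e})=\lim_{k\to\infty}\frac{\eta_v(2\pi k)}{2\pi k}$, with $\eta_v(\theta)$ a continuous argument of $\gamma_{\beta,\mathfrak e}(\theta)v$, $v\ne0$. *)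

(* Defs.v *)
From HB Require Import structures.
From mathcomp Require Import all_boot all_order all_algebra.
From mathcomp Require Import all_classical all_reals all_analysis.

Set Implicit Arguments.
Unset Strict Implicit.
Unset Printing Implicit Defensive.

Import Order.TTheory GRing.Theory Num.Theory.
Import numFieldNormedType.Exports.

Local Open Scope classical_set_scope.
Local Open Scope ring_scope.

(** A point of phase space is the row vector (p_r, p_z, r, z). *)
Definition phase {R : realType} (pr pz r z : R) : 'rV[R]_4 :=
  \row_(i < 4) [:: pr; pz; r; z]`_i.

Definition c_pr {R : realType} (x : 'rV[R]_4) : R := x 0 (@Ordinal 4 0 isT).
Definition c_pz {R : realType} (x : 'rV[R]_4) : R := x 0 (@Ordinal 4 1 isT).
Definition c_r {R : realType} (x : 'rV[R]_4) : R := x 0 (@Ordinal 4 2 isT).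
Definition c_z {R : realType} (x : 'rV[R]_4) : R := x 0 (@Ordinal 4 3 isT).

Definition potential {R : realType} (alpha varpi r z : R) : R :=
  varpi ^+ 2 / (2 * r ^+ 2) - r^-1
  - 4 / (alpha * Num.sqrt (r ^+ 2 + (1 + 2 * alpha) * z ^+ 2)).

Definition hamiltonian {R : realType} (alpha varpi : R) (x : 'rV[R]_4) : R :=
  (c_pr x ^+ 2 + c_pz x ^+ 2) / 2 + potential alpha varpi (c_r x) (c_z x).

(** The inverse of [beta = 1 / (1 + 4 / alpha)] and
    [e = sqrt (1 - 2 varpi^2 beta^2)], for [beta] and [e] in (0, 1). *)
Definition alpha_of {R : realType} (beta : R) : R := 4 * beta / (1 - beta).
Definition varpi_of {R : realType} (beta e : R) : R :=
  Num.sqrt (1 - e ^+ 2) / (Num.sqrt 2 * beta).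

Definition Ham {R : realType} (beta e : R) : 'rV[R]_4 -> R :=
  hamiltonian (alpha_of beta) (varpi_of beta e).
Definition Pot {R : realType} (beta e : R) : R -> R -> R :=
  potential (alpha_of beta) (varpi_of beta e).

(** [0 < c_r x] is the domain of the Hamiltonian. *)
Definition energy_surface {R : realType} (beta e : R) : set 'rV[R]_4 :=
  [set x | 0 < c_r x /\ Ham beta e x = -1].

Definition tangent {R : realType} (beta e : R) (x : 'rV[R]_4) : set 'rV[R]_4 :=
  [set u | 'D_u (Ham beta e) x = 0].

(** dp_r /\ dr + dp_z /\ dz *)
Definition omega {R : realType} (u v : 'rV[R]_4) : R :=
  (c_pr u * c_r v - c_r u * c_pr v) + (c_pz u * c_z v - c_z u * c_pz v).

(** q' = dH/dp, p' = - dH/dq *)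
Definition ham_field {R : realType} (beta e : R) (x : 'rV[R]_4) : 'rV[R]_4 :=
  phase (- 'D_(phase 0 0 1 0) (Ham beta e) x)
        (- 'D_(phase 0 0 0 1) (Ham beta e) x)
        ('D_(phase 1 0 0 0) (Ham beta e) x)
        ('D_(phase 0 1 0 0) (Ham beta e) x).

(** A 1-form is given by its coefficient field [lam] with respect to
    (dp_r, dp_z, dr, dz); [ev (lam x) u] is its value at [x] on [u]. *)
Definition ev {R : realType} (a u : 'rV[R]_4) : R := \sum_(i < 4) a 0 i * u 0 i.

Definition ext_deriv {R : realType} (lam : 'rV[R]_4 -> 'rV[R]_4)
    (x u v : 'rV[R]_4) : R :=
  ev ('D_u lam x) v - ev ('D_v lam x) u.

(** lambda /\ d lambda *)
Definition contact_vol_form {R : realType} (lam : 'rV[R]_4 -> 'rV[R]_4)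
    (x u v w : 'rV[R]_4) : R :=
  ev (lam x) u * ext_deriv lam x v w
  + ev (lam x) v * ext_deriv lam x w u
  + ev (lam x) w * ext_deriv lam x u v.

(** A differential form on the compact embedded hypersurface extends to the
    whole of R^4; hence forms on it are represented by forms on R^4, and every
    condition below only tests tangent vectors of the hypersurface.  Class C^1
    is all that is needed to speak of d lambda, and covers smooth forms. *)
Record is_contact_form {R : realType} (beta e : R)
    (lam : 'rV[R]_4 -> 'rV[R]_4) : Prop := {
  contact_differentiable : forall x : 'rV[R]_4, differentiable lam x ;
  contact_C1 : forall u : 'rV[R]_4, continuous ('D_u lam) ;
  contact_nondegenerate : forall x, energy_surface beta e x ->
    exists u v w, [/\ tangent beta e x u, tangent beta e x v,
      tangent beta e x w & contact_vol_form lam x u v w != 0] ;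
  contact_primitive : forall x u v, energy_surface beta e x ->
    tangent beta e x u -> tangent beta e x v ->
    ext_deriv lam x u v = omega u v ;
  contact_reeb : forall x xi, energy_surface beta e x ->
    tangent beta e x xi -> ev (lam x) xi = 1 ->
    (forall v, tangent beta e x v -> ext_deriv lam x xi v = 0) ->
    exists k : R, xi = k *: ham_field beta e x }.

(** On the energy surface p_r^2 + p_z^2 = 2 (-1 - V(r, z)).  Polar coordinates
    in the momentum plane therefore give a bijective C^1 parametrization of the
    energy surface minus the null set {p_r = p_z = 0} by the set of triples
    ((r, phi), z) with r > 0, V(r, z) < -1 and 0 <= phi < 2 pi.  It is positively
    oriented, for the orientation as boundary of {H <= -1} in
    (R^4, omega /\ omega): on (d/dr, d/dphi, d/dz) the form
    theta /\ d theta, theta = p_r dr + p_z dz, equals p_r^2 + p_z^2. *)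
Definition chart {R : realType} (beta e r phi z : R) : 'rV[R]_4 :=
  let rho := Num.sqrt (2 * (-1 - Pot beta e r z)) in
  phase (rho * cos phi) (rho * sin phi) r z.

Definition chart_dom {R : realType} (beta e : R) : set (R * R * R) :=
  [set q | [/\ 0 < q.1.1, 0 <= q.1.2 < 2 * pi & Pot beta e q.1.1 q.2 < -1]].

Definition surface_integral {R : realType} (beta e : R)
    (Om : 'rV[R]_4 -> 'rV[R]_4 -> 'rV[R]_4 -> 'rV[R]_4 -> R) : R :=
  Rintegral
    ((@lebesgue_measure R \x @lebesgue_measure R) \x @lebesgue_measure R)%E
    (chart_dom beta e)
    (fun q : R * R * R =>
       let: (r, phi, z) := q in
       Om (chart beta e r phi z)
          (derive1 (fun s => chart beta e s phi z) r)
          (derive1 (fun s => chart beta e r s z) phi)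
          (derive1 (fun s => chart beta e r phi s) z)).

Definition contact_volume {R : realType} (beta e : R)
    (lam : 'rV[R]_4 -> 'rV[R]_4) : R :=
  surface_integral beta e (contact_vol_form lam).

Definition euler_orbit {R : realType} (beta e : R) : set 'rV[R]_4 :=
  energy_surface beta e `&` [set x | c_z x = 0 /\ c_pz x = 0].

(** [c], of period [L], runs once along the Euler orbit in the direction of the
    Hamiltonian flow. The trajectories of the Hamiltonian field (k = 1) and of
    the Reeb field (k = 1 / lambda(X_H)) are instances. *)
Record parametrizes_euler_orbit {R : realType} (beta e : R)
    (c : R -> 'rV[R]_4) (L : R) : Prop := {
  param_period_gt0 : 0 < L ;
  param_derivable : forall t : R, derivable c t 1 ;
  param_C1 : continuous (derive1 c) ;
  param_periodic : forall t, c (t + L) = c t ;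
  param_simple : forall s t, 0 <= s < L -> 0 <= t < L -> c s = c t -> s = t ;
  param_image : range c = euler_orbit beta e ;
  param_direction : forall t, exists2 k : R,
    0 < k & derive1 c t = k *: ham_field beta e (c t) }.

Definition line_integral {R : realType} (lam : 'rV[R]_4 -> 'rV[R]_4)
    (c : R -> 'rV[R]_4) (L : R) : R :=
  Rintegral (@lebesgue_measure R) `[0, L] (fun t => ev (lam (c t)) (derive1 c t)).

Definition matJ {R : realType} : 'M[R]_2 :=
  \matrix_(i < 2, j < 2) (nth [::] [:: [:: 0; -1]; [:: 1; 0]] i)`_j.

Definition matS {R : realType} (beta e theta : R) : 'M[R]_2 :=
  \matrix_(i < 2, j < 2)
    (nth [::] [:: [:: 1; 0]; [:: 0; 1 + 7 * beta / (1 + e * cos theta)]] i)`_j.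

Definition fundamental_solution {R : realType} (beta e : R)
    (gam : R -> 'M[R]_2) : Prop :=
  gam 0 = 1%:M /\
  forall theta : R,
    is_derive theta 1 gam (matJ *m matS beta e theta *m gam theta).

Definition continuous_argument {R : realType} (w : R -> 'cV[R]_2)
    (eta : R -> R) : Prop :=
  continuous eta /\
  forall theta, exists2 s : R, 0 < s &
    w theta = s *: \col_(i < 2) [:: cos (eta theta); sin (eta theta)]`_i.

Definition path_rotation_number {R : realType} (gam : R -> 'M[R]_2)
    (rho : R) : Prop :=
  exists (v : 'cV[R]_2) (eta : R -> R),
    [/\ v != 0, continuous_argument (fun theta => gam theta *m v) eta &
        (fun k : nat => eta (2 * pi * k%:R) / (2 * pi * k%:R)) @ \oo --> rho].

Definition euler_rotation_number {R : realType} (beta e rho : R) : Prop :=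
  exists (gam : R -> 'M[R]_2) (rho0 : R),
    [/\ fundamental_solution beta e gam, path_rotation_number gam rho0 &
        rho = rho0 + 1].

(* Main.v *)
(* The argument of a solution of xi'' = - s xi, s = 1 + m / (1 + e cos), m = 7 beta,
   increases, so its growth over [0, 2 pi k] counts the zeros of xi.  If xi had
   too few of them, some trigonometric polynomial u in n theta / k, n <= J, would
   vanish at all of them; then the integral of u'^2 - s u^2 is nonnegative, by
   Jacobi's identity, and negative, by a computation on Fourier coefficients.
   With J close to k sqrt (1 + m (1 + e^2 / 16)) this bounds the rotation number
   from below by more than sqrt (1 + m).

   The Euler orbit bounds a disk in the energy surface; by Stokes' theorem its
   action is the integral of p_r dr, an explicit integral in the eccentric anomaly.

   On the chart the volume form is 2 (-1 - V) plus a divergence, which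
   integrates to zero.  Wherever 1 / (beta n) - 1 - varpi^2 / (2 r^2) is nonnegative,
   n = sqrt (r^2 + (1 + 7 beta) z^2), it is a lower bound of -1 - V, strict for z <> 0;
   and the integral of the positive part of this Kepler-type function is computed
   exactly, first in z, then in r through r = |1 - e exp (i t)| / (2 beta): it yields
   T^2 / sqrt (1 + 7 beta). *)
Require Import Defs.
From HB Require Import structures.
From mathcomp Require Import all_boot all_order all_algebra.
From mathcomp Require Import all_classical all_reals all_analysis.
From mathcomp Require Import measurable_realfun ring lra zify.

Set Implicit Arguments.
Unset Strict Implicit.
Unset Printing Implicit Defensive.

Import Order.TTheory GRing.Theory Num.Theory.
Import numFieldNormedType.Exports.

Local Open Scope classical_set_scope.
Local Open Scope ring_scope.

(** The quotient m / (1 + e cos) has infinitely many harmonics. With a second function g and D = 1 +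
    e cos, the inequality - m u^2 / D <= 2 u g + D g^2 / m trades it for a form in (u, g) in which
    frequency n meets only n - k and n + k. Letting g reach frequencies above J, up to J + k, gains
    a term of order e^2 at each free n > k with n + k > J. Part of this gain pays for admitting n
    with n^2 / k^2 - 1 beyond m, up to m (1 + e^2 / 16); that excess is what makes the bound on the
    rotation number strict.

    The chart degenerates where p_r = p_z = 0: its derivatives carry the inverse of the momentum.
    The divergence is that of - lambda /\ theta, theta = p_r dr + p_z dz, whose radial and axial
    fluxes contain the factor - 2 - 2 V. This factor keeps their derivatives bounded and lets a
    cutoff replace a study of the boundary of {V < -1}.

    The condition beta^2 + e^2 < 1 acts twice: it bounds {V < -1}, and it gives r / n > beta, n as
    above, wherever the Kepler-type function is nonnegative; the comparison with -1 - V rests on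
    that inequality. *)

(** * One-variable differential calculus *)

Section Der.
Context {R : realType}.
Implicit Types (f g : R -> R) (x a b : R).

Lemma der_cst x a : is_derive x 1 (fun _ : R => a) 0.
Proof. exact: is_derive_cst. Qed.
Lemma der_id x : is_derive x 1 (fun t : R => t) 1.
Proof. exact: is_derive_id. Qed.
Lemma der_add x f g a b : is_derive x 1 f a -> is_derive x 1 g b ->
  is_derive x 1 (fun t => f t + g t) (a + b).
Proof. by move=> ? ?; exact: is_deriveD. Qed.
Lemma der_opp x f a : is_derive x 1 f a -> is_derive x 1 (fun t => - f t) (- a).
Proof. by move=> ?; exact: is_deriveN. Qed.
Lemma der_mul x f g a b : is_derive x 1 f a -> is_derive x 1 g b ->
  is_derive x 1 (fun t => f t * g t) (a * g x + f x * b).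
Proof.
move=> df dg; apply: is_derive_eq (is_deriveM df dg) _.
by rewrite /GRing.scale/=; ring.
Qed.
Lemma der_exp x f a n : is_derive x 1 f a ->
  is_derive x 1 (fun t => f t ^+ n) (n%:R * f x ^+ n.-1 * a).
Proof.
move=> df; have -> : (fun t => f t ^+ n) = f ^+ n by rewrite exprfctE.
exact: is_deriveX.
Qed.
Lemma der_inv x f a : f x != 0 -> is_derive x 1 f a ->
  is_derive x 1 (fun t => (f t)^-1) (- a / f x ^+ 2).
Proof.
move=> fx0 df; have [d e] := df.
have D : derivable (fun t => (f t)^-1) x 1 by apply: derivableV.
apply: (is_derive_eq (derivableP D)).
by rewrite deriveV// e /GRing.scale/= mulNr mulNr mulrC.
Qed.
Lemma der_comp x f g a b : is_derive (g x) 1 f a -> is_derive x 1 g b ->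
  is_derive x 1 (fun t => f (g t)) (a * b).
Proof. exact: is_derive1_comp. Qed.
Lemma der_cos x g b : is_derive x 1 g b ->
  is_derive x 1 (fun t => cos (g t)) (- sin (g x) * b).
Proof. by move=> dg; exact: (der_comp (is_derive_cos _) dg). Qed.
Lemma der_sin x g b : is_derive x 1 g b ->
  is_derive x 1 (fun t => sin (g t)) (cos (g x) * b).
Proof. by move=> dg; exact: (der_comp (is_derive_sin _) dg). Qed.
Lemma der_atan x g b : is_derive x 1 g b ->
  is_derive x 1 (fun t => atan (g t)) ((1 + g x ^+ 2)^-1 * b).
Proof. by move=> dg; exact: (der_comp (is_derive1_atan _) dg). Qed.
Lemma der_sqrt x g b : 0 < g x -> is_derive x 1 g b ->
  is_derive x 1 (fun t => Num.sqrt (g t)) ((2 * Num.sqrt (g x))^-1 * b).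
Proof. by move=> gx dg; exact: (der_comp (is_derive1_sqrt gx) dg). Qed.
Lemma der_ln x g b : 0 < g x -> is_derive x 1 g b ->
  is_derive x 1 (fun t => ln (g t)) ((g x)^-1 * b).
Proof. by move=> gx dg; exact: (der_comp (is_derive1_ln gx) dg). Qed.
Lemma der_sum x n (h : 'I_n -> R -> R) (dh : 'I_n -> R) :
  (forall i, is_derive x 1 (h i) (dh i)) ->
  is_derive x 1 (fun t => \sum_(i < n) h i t) (\sum_(i < n) dh i).
Proof.
move=> H; have -> : (fun t => \sum_(i < n) h i t) = \sum_(i < n) h i.
  by apply/funext => t; rewrite fct_sumE.
exact: is_derive_sum.
Qed.
Lemma der_cont x f a : is_derive x 1 f a -> {for x, continuous f}.
Proof. by move=> [d _]; apply: differentiable_continuous; apply/derivable1_diffP. Qed.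
Lemma der_val (V : normedModType R) x (f : R -> V) (a : V) : is_derive x 1 f a -> derive1 f x = a.
Proof. by move=> [_ e]; rewrite derive1E. Qed.

(* Unification leaves eta-reduced goals, to which [der_mul] and [der_add] do not apply. *)
Lemma der_mull x a : is_derive x 1 ( *%R a) a.
Proof. by apply: is_derive_eq (der_mul (der_cst x a) (der_id x)) _; ring. Qed.
Lemma der_addl x a : is_derive x 1 ( +%R a) 1.
Proof. by apply: is_derive_eq (der_add (der_cst x a) (der_id x)) _; ring. Qed.

End Der.

Lemma oneDmulcos_gt0 (R : realType) (e x : R) : 0 < e -> e < 1 -> 0 < 1 + e * cos x.
Proof.
move=> e0 e1; have h1 := cos_geN1 x.
have h : 0 <= e * (cos x + 1) by apply: mulr_ge0; lra.
by rewrite mulrDr mulr1 in h; lra.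
Qed.

(* [der] computes a derivative; it leaves the side conditions of [der_inv] and
   [der_sqrt], and the equation between the computed and the expected values. *)
Ltac der_step :=
  first [ eassumption
  | match goal with
    | |- is_derive _ _ (fun _ => - _) _ => eapply der_opp
    | |- is_derive _ _ (fun _ => (_ : _) + _) _ => eapply der_add
    | |- is_derive _ _ (GRing.mul _) _ => eapply der_mull
    | |- is_derive _ _ (GRing.add _) _ => eapply der_addl
    | |- is_derive _ _ cos _ => eapply is_derive_cos
    | |- is_derive _ _ sin _ => eapply is_derive_sin
    | |- is_derive _ _ (fun t => t) _ => eapply der_id
    | |- is_derive _ _ (fun _ => _ ^+ _) _ => eapply der_exp
    | |- is_derive _ _ (fun _ => _ * _) _ => eapply der_mul
    | |- is_derive _ _ (fun _ => (_)^-1) _ => eapply der_inv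
    | |- is_derive _ _ (fun _ => cos _) _ => eapply der_cos
    | |- is_derive _ _ (fun _ => sin _) _ => eapply der_sin
    | |- is_derive _ _ (fun _ => atan _) _ => eapply der_atan
    | |- is_derive _ _ (fun _ => Num.sqrt _) _ => eapply der_sqrt
    end
  | match goal with H : forall _, is_derive _ _ _ _ |- is_derive _ _ _ _ => eapply H end ].
Ltac der := eapply is_derive_eq;
  [ repeat (match goal with |- is_derive _ _ _ _ => first [ eapply der_cst | der_step ] end) | ]; cbv beta; cbn [Nat.pred].

(** * Coordinates and directional derivatives in phase space *)

Section Phase.
Context {R : realType}.
Implicit Types (x u : 'rV[R]_4).

Lemma c_pr_phase (a b c d : R) : c_pr (phase a b c d) = a. Proof. by rewrite /c_pr mxE. Qed.
Lemma c_pz_phase (a b c d : R) : c_pz (phase a b c d) = b. Proof. by rewrite /c_pz mxE. Qed.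
Lemma c_r_phase (a b c d : R) : c_r (phase a b c d) = c. Proof. by rewrite /c_r mxE. Qed.
Lemma c_z_phase (a b c d : R) : c_z (phase a b c d) = d. Proof. by rewrite /c_z mxE. Qed.
Definition phaseK := (c_pr_phase, c_pz_phase, c_r_phase, c_z_phase).

Lemma phase_coords x : x = phase (c_pr x) (c_pz x) (c_r x) (c_z x).
Proof.
apply/rowP => i; rewrite mxE; case: i => -[|[|[|[|//]]]] hi /=;
  by congr (x _ _); apply/val_inj.
Qed.

Lemma phaseE (a b c d : R) : phase a b c d =
  a *: phase 1 0 0 0 + b *: phase 0 1 0 0 + c *: phase 0 0 1 0 + d *: phase 0 0 0 1.
Proof.
apply/rowP => i; rewrite !mxE; case: i => -[|[|[|[|//]]]] hi /=; ring.
Qed.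

Lemma evE x u : ev x u = c_pr x * c_pr u + c_pz x * c_pz u + c_r x * c_r u + c_z x * c_z u.
Proof.
rewrite /ev !big_ord_recl big_ord0 addr0 !addrA /c_pr /c_pz /c_r /c_z.
by do 3 ?[congr (_ + _)]; congr (x _ _ * u _ _); apply/val_inj.
Qed.

Lemma der_mxP (m n : nat) (M : R -> 'M[R]_(m, n)) (D : 'M[R]_(m, n)) (t : R) :
  is_derive t 1 M D <-> forall i j, is_derive t 1 (fun s => M s i j) (D i j).
Proof.
split=> [[dM <-] i j|H].
  have dMij := (derivable_mxP M t 1).1 dM i j.
  by apply: (is_derive_eq (derivableP dMij)); rewrite derive_mx// mxE.
have dM : derivable M t 1 by apply/derivable_mxP => i j; have [] := H i j.
apply: (is_derive_eq (derivableP dM)); rewrite derive_mx//.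
by apply/matrixP => i j; rewrite mxE; have [_ <-] := H i j.
Qed.

Lemma der_phase (t : R) (a b c d : R -> R) a' b' c' d' :
  is_derive t 1 a a' -> is_derive t 1 b b' -> is_derive t 1 c c' -> is_derive t 1 d d' ->
  is_derive t 1 (fun s => phase (a s) (b s) (c s) (d s)) (phase a' b' c' d').
Proof.
move=> da db dc dd; apply/der_mxP => i [j hj]; rewrite mxE.
under [X in is_derive _ _ X _]eq_fun do rewrite mxE.
by case: j hj => [|[|[|[|//]]]] hj /=; [exact da|exact db|exact dc|exact dd].
Qed.

Lemma der_coord (t : R) (g : R -> 'rV[R]_4) g' : is_derive t 1 g g' ->
  [/\ is_derive t 1 (fun s => c_pr (g s)) (c_pr g'), is_derive t 1 (fun s => c_pz (g s)) (c_pz g'),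
      is_derive t 1 (fun s => c_r (g s)) (c_r g') & is_derive t 1 (fun s => c_z (g s)) (c_z g')].
Proof. by move=> /der_mxP H; split; exact: H. Qed.

Lemma der_chain (V W : normedModType R) (f : V -> W) (g : R -> V) g' (t : R) :
  differentiable f (g t) -> is_derive t 1 g g' ->
  is_derive t 1 (fun s => f (g s)) ('D_g' f (g t)).
Proof.
move=> df [dg eg].
have Dg : differentiable g t by apply/derivable1_diffP.
have Dfg : differentiable (f \o g) t by exact: differentiable_comp.
have D : derivable (f \o g) t 1 by apply/derivable1_diffP.
apply: (is_derive_eq (derivableP D)).
by rewrite -eg !deriveE// diff_comp.
Qed.

Lemma deriveD_lin (W : normedModType R) (f : 'rV[R]_4 -> W) x (a b c d : R) :
  differentiable f x ->
  'D_(phase a b c d) f x = a *: 'D_(phase 1 0 0 0) f x + b *: 'D_(phase 0 1 0 0) f x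
    + c *: 'D_(phase 0 0 1 0) f x + d *: 'D_(phase 0 0 0 1) f x.
Proof. by move=> df; rewrite phaseE !deriveE// !linearD !linearZ. Qed.

(** A directional derivative only sees the restriction to a line; the gradient of the Hamiltonian is
    obtained through it by the rules of one variable. *)
Lemma derive_line (V W : normedModType R) (f : V -> W) (p v : V) a :
  is_derive (0 : R) 1 (fun h : R => f (h *: v + p)) a -> 'D_v f p = a.
Proof.
move=> [d <-]; rewrite /derive; congr (lim (_ @ 0^')).
by apply/funext => h /=; rewrite addr0 scale0r add0r /GRing.scale/= mulr1.
Qed.

End Phase.

(** * Continuity of composite expressions *)

Section Cont.
Context {R : realType} {T : topologicalType}.
Implicit Types (f g : T -> R) (x : T).

Lemma cont_cst x (a : R) : {for x, continuous (fun _ : T => a)}.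
Proof. exact: cvg_cst. Qed.
Lemma cont_add x f g : {for x, continuous f} -> {for x, continuous g} ->
  {for x, continuous (fun t => f t + g t)}.
Proof. by move=> ? ?; exact: cvgD. Qed.
Lemma cont_opp x f : {for x, continuous f} -> {for x, continuous (fun t => - f t)}.
Proof. by move=> ?; exact: cvgN. Qed.
Lemma cont_mul x f g : {for x, continuous f} -> {for x, continuous g} ->
  {for x, continuous (fun t => f t * g t)}.
Proof. by move=> ? ?; exact: cvgM. Qed.
Lemma cont_inv x f : f x != 0 -> {for x, continuous f} ->
  {for x, continuous (fun t => (f t)^-1)}.
Proof. by move=> ? ?; exact: cvgV. Qed.
Lemma cont_div x f g : g x != 0 -> {for x, continuous f} -> {for x, continuous g} ->
  {for x, continuous (fun t => f t / g t)}.
Proof. by move=> g0 cf cg; exact: cont_mul cf (cont_inv g0 cg). Qed.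
Lemma cont_comp (U V : topologicalType) (h : U -> V) (k : T -> U) x :
  {for x, continuous k} -> {for k x, continuous h} ->
  {for x, continuous (fun t => h (k t))}.
Proof. by move=> ck ch; exact: (continuous_comp ck ch). Qed.
Lemma cont_exp x f n : {for x, continuous f} -> {for x, continuous (fun t => f t ^+ n)}.
Proof. by move=> cf; exact: (@cont_comp R R (fun y : R => y ^+ n) f x cf (@exprn_continuous _ n _)). Qed.
Lemma cont_cos x f : {for x, continuous f} -> {for x, continuous (fun t => cos (f t))}.
Proof. by move=> cf; exact: (@cont_comp R R cos f x cf (@continuous_cos R _)). Qed.
Lemma cont_sin x f : {for x, continuous f} -> {for x, continuous (fun t => sin (f t))}.
Proof. by move=> cf; exact: (@cont_comp R R sin f x cf (@continuous_sin R _)). Qed.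
Lemma cont_sqrt x f : {for x, continuous f} -> {for x, continuous (fun t => Num.sqrt (f t))}.
Proof. by move=> cf; exact: (@cont_comp R R Num.sqrt f x cf (@sqrt_continuous R _)). Qed.

Lemma cont_phase x (a b c d : T -> R) :
  {for x, continuous a} -> {for x, continuous b} -> {for x, continuous c} -> {for x, continuous d} ->
  {for x, continuous (fun t => phase (a t) (b t) (c t) (d t))}.
Proof.
move=> ca cb cc cd.
under [X in {for _, continuous X}]eq_fun do rewrite phaseE.
have H f (v : 'rV[R]_4) : {for x, continuous f} -> f t *: v @[t --> x] --> f x *: v.
  by move=> cf; exact: cvgZr_tmp.
exact: (cvgD (cvgD (cvgD (H _ _ ca) (H _ _ cb)) (H _ _ cc)) (H _ _ cd)).
Qed.

End Cont.

Lemma cont_coord (R : realType) (j : 'I_4) : continuous (fun x : 'rV[R]_4 => x 0 j).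
Proof. by move=> x; apply: differentiable_continuous; exact: differentiable_coord. Qed.

Lemma cont_coords (R : realType) (T : topologicalType) (x : T) (g : T -> 'rV[R]_4) :
  {for x, continuous g} ->
  [/\ {for x, continuous (fun t => c_pr (g t))}, {for x, continuous (fun t => c_pz (g t))},
      {for x, continuous (fun t => c_r (g t))} & {for x, continuous (fun t => c_z (g t))}].
Proof. by move=> cg; split; exact: (continuous_comp cg (@cont_coord R _ (g x))). Qed.

Lemma cont_fst (U V : topologicalType) (p : U * V) : {for p, continuous (fun q : U * V => q.1)}.
Proof. exact: cvg_fst. Qed.
Lemma cont_snd (U V : topologicalType) (p : U * V) : {for p, continuous (fun q : U * V => q.2)}.
Proof. exact: cvg_snd. Qed.

Ltac cont_step :=
  lazymatch goal with
  | |- @prop_for _ _ (fun x => continuous_at x (fun _ => ?a)) _ => exact (@cont_cst _ _ _ a)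
  | |- @prop_for _ _ (fun x => continuous_at x (fun q => q.1)) _ => exact (@cont_fst _ _ _)
  | |- @prop_for _ _ (fun x => continuous_at x (fun q => q.2)) _ => exact (@cont_snd _ _ _)
  | |- @prop_for _ _ (fun x => continuous_at x (fun q => q)) _ => exact (@cvg_id _ _)
  | |- @prop_for _ _ (fun x => continuous_at x sin) _ => exact (@continuous_sin _ _)
  | |- @prop_for _ _ (fun x => continuous_at x cos) _ => exact (@continuous_cos _ _)
  | |- @prop_for _ _ (fun x => continuous_at x ( *%R ?a)) _ => exact (cont_mul (@cont_cst _ _ _ a) (@cvg_id _ _))
  | |- @prop_for _ _ (fun x => continuous_at x fst) _ => exact (@cont_fst _ _ _)
  | |- @prop_for _ _ (fun x => continuous_at x snd) _ => exact (@cont_snd _ _ _)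
  | |- @prop_for _ _ (fun x => continuous_at x (fun _ => _ + _)) _ => refine (cont_add _ _)
  | |- @prop_for _ _ (fun x => continuous_at x (fun _ => - _)) _ => refine (cont_opp _)
  | |- @prop_for _ _ (fun x => continuous_at x (fun _ => _ * _)) _ => refine (cont_mul _ _)
  | |- @prop_for _ _ (fun x => continuous_at x (fun _ => _ ^+ _)) _ => refine (cont_exp _)
  | |- @prop_for _ _ (fun x => continuous_at x (fun _ => cos _)) _ => refine (cont_cos _)
  | |- @prop_for _ _ (fun x => continuous_at x (fun _ => sin _)) _ => refine (cont_sin _)
  | |- @prop_for _ _ (fun x => continuous_at x (fun _ => Num.sqrt _)) _ => refine (cont_sqrt _)
  | |- _ => eassumption
  end.
Ltac cont := try (match goal with |- continuous_at ?p ?F => change {for p, continuous F} end);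
  repeat cont_step.

(** * The Hamiltonian and its vector field in closed form *)

Section Hamiltonian.
Context {R : realType}.
Variables (beta e : R).
Hypotheses (b0 : 0 < beta) (b1 : beta < 1) (e0 : 0 < e) (e1 : e < 1).

(* [wcoef], [ccoef] and [kcoef] are varpi^2, 4 / alpha and 1 + 2 alpha. *)
Definition wcoef : R := (1 - e ^+ 2) / (2 * beta ^+ 2).
Definition ccoef : R := (1 - beta) / beta.
Definition kcoef : R := (1 + 7 * beta) / (1 - beta).
Definition dist (r z : R) : R := Num.sqrt (r ^+ 2 + kcoef * z ^+ 2).
Definition Vr (r z : R) : R := - wcoef / r ^+ 3 + 1 / r ^+ 2 + ccoef * r / dist r z ^+ 3.
Definition Vz (r z : R) : R := ccoef * kcoef * z / dist r z ^+ 3.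

Lemma wcoef_gt0 : 0 < wcoef.
Proof.
have [h1 h2] := (e0, e1); have : e ^+ 2 < 1 by rewrite exprn_ilt1// ltW.
by move=> h; rewrite divr_gt0// ?subr_gt0// mulr_gt0// exprn_gt0.
Qed.
Lemma ccoef_gt0 : 0 < ccoef.
Proof. by rewrite divr_gt0// subr_gt0. Qed.
Lemma kcoef_gt0 : 0 < kcoef.
Proof. by rewrite divr_gt0 ?subr_gt0// addr_gt0// mulr_gt0. Qed.

Lemma dist_arg_gt0 r z : 0 < r -> 0 < r ^+ 2 + kcoef * z ^+ 2.
Proof.
by move=> r0; rewrite ltr_pwDl ?exprn_gt0// mulr_ge0 ?sqr_ge0// ltW ?kcoef_gt0.
Qed.

Lemma dist_gt0 r z : 0 < r -> 0 < dist r z.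
Proof. by move=> r0; rewrite sqrtr_gt0 dist_arg_gt0. Qed.

Lemma sqr_dist r z : 0 < r -> dist r z ^+ 2 = r ^+ 2 + kcoef * z ^+ 2.
Proof. by move=> r0; rewrite sqr_sqrtr// ltW// dist_arg_gt0. Qed.

Lemma varpi_sqr : varpi_of beta e ^+ 2 = wcoef.
Proof.
have [h0 [h1 h2]] := (b0, (e0, e1)); have : e ^+ 2 < 1 by rewrite exprn_ilt1// ltW.
move=> h; rewrite /varpi_of /wcoef expr_div_n exprMn !sqr_sqrtr//; lra.
Qed.

Lemma PotE r z : Pot beta e r z = wcoef / (2 * r ^+ 2) - r^-1 - ccoef / dist r z.
Proof.
have b0' : beta != 0 by rewrite gt_eqF.
have b1' : 1 - beta != 0 by rewrite gt_eqF// subr_gt0.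
have kE : 1 + 2 * alpha_of beta = kcoef by rewrite /alpha_of /kcoef; field.
rewrite /Pot /potential varpi_sqr kE -/(dist r z); congr (_ - _).
rewrite invfM mulrA; congr (_ / _).
by rewrite /alpha_of /ccoef; field; rewrite b0' b1' .
Qed.

Lemma der_Pot (t : R) (r z : R -> R) r' z' : 0 < r t ->
  is_derive t 1 r r' -> is_derive t 1 z z' ->
  is_derive t 1 (fun s => Pot beta e (r s) (z s)) (Vr (r t) (z t) * r' + Vz (r t) (z t) * z').
Proof.
move=> r0 dr dz; under [X in is_derive _ _ X _]eq_fun do rewrite PotE.
have d0 := dist_gt0 (z t) r0; have a0 := dist_arg_gt0 (z t) r0.
rewrite /dist; der => //.
- by rewrite mulf_neq0// expf_neq0// gt_eqF.
- by rewrite gt_eqF.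
- by rewrite -/(dist _ _) gt_eqF.
by rewrite -!/(dist _ _) /Vr /Vz; field; rewrite !gt_eqF.
Qed.

Lemma der_Ham (t : R) (g : R -> 'rV[R]_4) g' : 0 < c_r (g t) -> is_derive t 1 g g' ->
  is_derive t 1 (fun s => Ham beta e (g s))
   (c_pr (g t) * c_pr g' + c_pz (g t) * c_pz g'
    + Vr (c_r (g t)) (c_z (g t)) * c_r g' + Vz (c_r (g t)) (c_z (g t)) * c_z g').
Proof.
move=> r0 /der_coord[d1 d2 d3 d4]; have d5 := der_Pot r0 d3 d4.
by rewrite /Ham /hamiltonian; der; field.
Qed.

Lemma derive_Ham x u : 0 < c_r x -> 'D_u (Ham beta e) x =
  c_pr x * c_pr u + c_pz x * c_pz u + Vr (c_r x) (c_z x) * c_r u + Vz (c_r x) (c_z x) * c_z u.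
Proof.
move=> r0; apply: derive_line.
have D : is_derive (0 : R) 1 (fun h : R => h *: u + x) u.
  rewrite (_ : (fun h : R => h *: u + x) = (fun h => phase (h * c_pr u + c_pr x)
    (h * c_pz u + c_pz x) (h * c_r u + c_r x) (h * c_z u + c_z x))).
    rewrite [X in is_derive _ _ _ X]phase_coords.
    by apply: der_phase; der; ring.
  apply/funext => h; rewrite {1}(phase_coords u) {1}(phase_coords x).
  by apply/rowP => -[[|[|[|[|?]]]] hj]; rewrite !mxE.
have E : 0 *: u + x = x by rewrite scale0r add0r.
have r0' : 0 < c_r (0 *: u + x) by rewrite E.
by apply: is_derive_eq (der_Ham r0' D) _; rewrite E.
Qed.

Lemma ham_fieldE x : 0 < c_r x ->
  ham_field beta e x = phase (- Vr (c_r x) (c_z x)) (- Vz (c_r x) (c_z x)) (c_pr x) (c_pz x).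
Proof.
by move=> r0; rewrite /ham_field !derive_Ham// !phaseK !mulr0 !mulr1 !addr0 ?add0r.
Qed.

End Hamiltonian.

(** * Measurability of open sets and continuous functions on products *)

Section CountableBase.

(** [M] plays the sigma-algebra but is only a class of sets, so that the product sigma-algebra can
    be compared with the product topology: a countable base made of measurable boxes forces every
    open set to be measurable. *)
Definition countable_base (T : topologicalType) (M : set (set T)) :=
  exists B : nat -> set T, (forall n, M (B n)) /\
    forall U x, open U -> U x -> exists n, B n x /\ B n `<=` U.

Lemma countable_base_open (T : topologicalType) (M : set (set T)) :
  M set0 -> (forall F : nat -> set T, (forall n, M (F n)) -> M (\bigcup_n F n)) ->
  countable_base M -> forall U, open U -> M U.
Proof.
move=> M0 Mc [B [MB BU]] U oU.
have -> : U = \bigcup_n (if `[< B n `<=` U >] then B n else set0).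
  apply/seteqP; split=> [x Ux|x [n _]]; last by case: asboolP => [h|//]; exact: h.
  have [n [Bx BnU]] := BU U x oU Ux; exists n => //.
  by case: asboolP.
by apply: Mc => n; case: ifP.
Qed.

Lemma countable_base_prod (T1 T2 : topologicalType) (M1 : set (set T1)) (M2 : set (set T2))
    (M : set (set (T1 * T2))) :
  M set0 -> (forall A B, M1 A -> M2 B -> M (A `*` B)) ->
  countable_base M1 -> countable_base M2 -> countable_base M.
Proof.
move=> M0 MX [B1 [MB1 h1]] [B2 [MB2 h2]].
exists (fun n => match unpickle n : option (nat * nat) with
  | Some ij => B1 ij.1 `*` B2 ij.2 | None => set0 end).
split=> [n|U [x1 x2] oU Ux]; first by case: unpickle => [[i j]|//]; exact: MX.
have := open_nbhs_nbhs (conj oU Ux); move=> [[V1 V2] /= [nV1 nV2] V12].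
rewrite nbhsE in nV1; rewrite nbhsE in nV2.
have [W1 [oW1 W1x] W1V] := nV1; have [W2 [oW2 W2x] W2V] := nV2.
have [i [B1x B1W]] := h1 W1 x1 oW1 W1x.
have [j [B2x B2W]] := h2 W2 x2 oW2 W2x.
exists (pickle (i, j)); rewrite pickleK; split=> //= -[y1 y2] [/= y1B y2B].
by apply: V12; split=> /=; [exact/W1V/B1W|exact/W2V/B2W].
Qed.

End CountableBase.

Section OpenMeasurable.
Context {R : realType}.

Lemma countable_base_R : @countable_base R measurable.
Proof.
exists (fun n => match unpickle n : option (rat * rat) with
  | Some ij => `]ratr ij.1, ratr ij.2[%classic | None => set0 end).
split=> [n|U x oU Ux]; first by case: unpickle => [ij|//]; exact: measurable_itv.
have := open_nbhs_nbhs (conj oU Ux); move=> [d /= d0 dU].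
have [p p1] : exists q : rat, ratr q \in `]x - d, x[ by apply: rat_in_itvoo; lra.
have [q q1] : exists q : rat, ratr q \in `]x, x + d[ by apply: rat_in_itvoo; lra.
rewrite !in_itv/= in p1 q1; case/andP: p1 => p1 p2; case/andP: q1 => q1 q2.
exists (pickle (p, q)); rewrite pickleK; split; first by rewrite /= in_itv/= p2 q1.
move=> y /=; rewrite in_itv/= => /andP[y1 y2]; apply: dU.
by rewrite /ball/= ltr_distlC; apply/andP; split; lra.
Qed.

Lemma countable_base_R2 : @countable_base (R * R)%type measurable.
Proof.
apply: (@countable_base_prod R R measurable measurable).
- exact: measurable0.
- by move=> A B mA mB; exact: measurableX.
- exact: countable_base_R.
- exact: countable_base_R.
Qed.

Lemma open_measurable2 (U : set (R * R)) : open U -> measurable U.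
Proof.
apply: (@countable_base_open (R * R)%type measurable); last exact: countable_base_R2.
- exact: measurable0.
- by move=> F mF; exact: bigcupT_measurable.
Qed.

Lemma open_measurable3 (U : set (R * R * R)) : open U -> measurable U.
Proof.
apply: (@countable_base_open (R * R * R)%type measurable); first exact: measurable0.
- by move=> F mF; exact: bigcupT_measurable.
apply: (@countable_base_prod (R * R)%type R measurable measurable).
- exact: measurable0.
- by move=> A B mA mB; exact: measurableX.
- exact: countable_base_R2.
- exact: countable_base_R.
Qed.

Lemma cont_open_preimage (T : topologicalType) (D : set T) (f : T -> R) (a b : R) : open D ->
  (forall x, D x -> {for x, continuous f}) -> open (D `&` f @^-1` `]a, b[%classic).
Proof.
move=> oD cf; rewrite openE => x [Dx fx]; apply: filterI; first exact: open_nbhs_nbhs.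
apply: (cf x Dx); apply: open_nbhs_nbhs; split => //; exact: interval_open.
Qed.

Lemma cont_measurable2 (D : set (R * R)) (f : R * R -> R) : open D ->
  (forall x, D x -> {for x, continuous f}) -> measurable_fun D f.
Proof.
move=> oD cf; apply: (measurability _ (measurable_realfun.RGenOpens.measurableE R)).
move=> _ [_ [a [b ->] <-]]; apply: open_measurable2.
exact: cont_open_preimage.
Qed.

Lemma cont_measurable3 (D : set (R * R * R)) (f : R * R * R -> R) : open D ->
  (forall x, D x -> {for x, continuous f}) -> measurable_fun D f.
Proof.
move=> oD cf; apply: (measurability _ (measurable_realfun.RGenOpens.measurableE R)).
move=> _ [_ [a [b ->] <-]]; apply: open_measurable3.
exact: cont_open_preimage.
Qed.

Lemma cont_compact_bounded (T : topologicalType) (K : set T) (f : T -> R) : compact K ->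
  (forall x, K x -> {for x, continuous f}) -> exists M, forall x, K x -> `|f x| <= M.
Proof.
move=> cK cf.
have cfK : {within K, continuous f} by apply: continuous_in_subspaceT => x; rewrite inE; exact: cf.
have /compact_bounded[M [_ h]] := continuous_compact cfK cK.
exists (M + 1) => x Kx; apply: (h (M + 1)); first by lra.
by exists x.
Qed.

End OpenMeasurable.

(** * Integrals over intervals *)

Section Integration.
Context {R : realType}.
Notation mu := (@lebesgue_measure R).

Lemma FTC_closed (f F : R -> R) (a b : R) : a < b ->
  (forall x, a <= x <= b -> is_derive x 1 F (f x)) ->
  (forall x, a <= x <= b -> {for x, continuous f}) ->
  (\int[mu]_(x in `[a, b]) (f x)%:E = (F b - F a)%:E)%E.
Proof.
move=> ab dF cf; rewrite EFinB.
have aI : a <= a <= b by rewrite lexx ltW.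
have bI : a <= b <= b by rewrite lexx ltW.
apply: continuous_FTC2 => //.
- by apply: continuous_in_subspaceT => x; rewrite inE/= in_itv/=; exact: cf.
- split.
  + move=> x; rewrite in_itv/= => /andP[ax xb].
    by have [] : is_derive x 1 F (f x) by apply: dF; rewrite !ltW.
  + by apply: cvg_at_right_filter; exact: der_cont (dF a aI).
  + by apply: cvg_at_left_filter; exact: der_cont (dF b bI).
- move=> x; rewrite in_itv/= => /andP[ax xb].
  by apply: der_val; apply: dF; rewrite !ltW.
Qed.

Lemma bounded_integrable d (T : measurableType d) (m : {measure set T -> \bar R})
    (K : set T) (f : T -> R) (M : R) : measurable K -> (m K < +oo)%E ->
  measurable_fun K f -> (forall x, K x -> `|f x| <= M) ->
  m.-integrable K (EFin \o f).
Proof.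
move=> mK Kfin mf fM; apply: measurable_bounded_integrable => //.
exists M; split; first exact: num_real.
by move=> M' MM' x Kx /=; rewrite (le_trans (fM x Kx))// ltW.
Qed.

Lemma mu_itv_lty (i : interval R) (a b : R) : [set` i] `<=` `[a, b]%classic ->
  (mu [set` i] < +oo)%E.
Proof.
move=> iab; apply: (@le_lt_trans _ _ (mu `[a, b]%classic)).
  by apply: le_measure; rewrite ?inE//; exact: measurable_itv.
by rewrite lebesgue_measure_itv/=; case: ifP => _; rewrite -?EFinB ?ltry.
Qed.

End Integration.

(* The library's own sigma-finite structure on products is shadowed by the
   one it declares for subprobabilities, hence this copy under another name. *)
Section ProductSigmaFinite.
Local Open Scope ereal_scope.
Context d1 d2 (T1 : measurableType d1) (T2 : measurableType d2) (R : realType).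
Variable m1 : {sigma_finite_measure set T1 -> \bar R}.
Variable m2 : {sigma_finite_measure set T2 -> \bar R}.

Definition sigma_finite_prod : set (T1 * T2) -> \bar R := m1 \x m2.

Lemma sigma_finite_prodT : sigma_finite setT sigma_finite_prod.
Proof.
have /sigma_finiteP[F [TF ndF Foo]] := sigma_finiteT m1.
have /sigma_finiteP[G [TG ndG Goo]] := sigma_finiteT m2.
exists (fun n => F n `*` G n).
  rewrite -setXTT TF TG predeqE => -[x y]; split=> [[/= [n _ Fnx] [k _ Gky]]|[n _ []/= ? ?]].
    exists (maxn n k) => //; split.
    - by move: x Fnx; exact/subsetPset/ndF/leq_maxl.
    - by move: y Gky; exact/subsetPset/ndG/leq_maxr.
  by split; exists n.
move=> k; have [mF fF] := Foo k; have [mG fG] := Goo k.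
split; first exact: measurableX.
rewrite [X in (X < _)%E](product_measure1E m1 m2 mF mG).
by rewrite lte_mul_pinfty// ge0_fin_numE.
Qed.

HB.instance Definition _ := Measure.copy sigma_finite_prod (m1 \x m2).
HB.instance Definition _ := Measure_isSigmaFinite.Build _ _ _ sigma_finite_prod sigma_finite_prodT.
End ProductSigmaFinite.

(** * Fubini's theorem on product sets *)

Section SetFubini.
Local Open Scope ereal_scope.
Context d1 d2 (T1 : measurableType d1) (T2 : measurableType d2) (R : realType).
Variable m1 : {sigma_finite_measure set T1 -> \bar R}.
Variable m2 : {sigma_finite_measure set T2 -> \bar R}.
Variables (A : set T1) (B : set T2) (f : T1 * T2 -> R).
Hypothesis (mA : measurable A) (mB : measurable B).
Hypothesis (fi : (m1 \x m2).-integrable (A `*` B) (EFin \o f)).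

Let patched : (m1 \x m2).-integrable setT ((EFin \o f) \_ (A `*` B)).
Proof.
exact ((@integrable_mkcond _ _ _ (m1 \x m2)%E _ (EFin \o f) (measurableX mA mB)).1 fi).
Qed.

Let in_setX x y : ((x, y) \in A `*` B) = (x \in A) && (y \in B).
Proof. by apply/idP/andP; rewrite !inE. Qed.

Lemma integral_setX1 :
  \int[m1 \x m2]_(p in A `*` B) (f p)%:E = \int[m1]_(x in A) \int[m2]_(y in B) (f (x, y))%:E.
Proof.
rewrite [LHS]integral_mkcond -(integral12_prod_meas1 patched) [RHS]integral_mkcond.
apply: eq_integral => x _; rewrite patchE; case: ifPn => xA.
  by rewrite [RHS]integral_mkcond; apply: eq_integral => y _; rewrite !patchE in_setX xA.
by apply: integral0_eq => y _; rewrite patchE in_setX (negbTE xA).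
Qed.

Lemma integral_setX2 :
  \int[m1 \x m2]_(p in A `*` B) (f p)%:E = \int[m2]_(y in B) \int[m1]_(x in A) (f (x, y))%:E.
Proof.
rewrite [LHS]integral_mkcond -(integral21_prod_meas1 patched) [RHS]integral_mkcond.
apply: eq_integral => y _; rewrite patchE; case: ifPn => yB.
  by rewrite [RHS]integral_mkcond; apply: eq_integral => x _; rewrite !patchE in_setX yB andbT.
by apply: integral0_eq => x _; rewrite patchE in_setX (negbTE yB) andbF.
Qed.

End SetFubini.

Section Slices.
Context d1 d2 (T1 : measurableType d1) (T2 : measurableType d2) (R : realType).
Variables (A : set T1) (B : set T2) (f : T1 * T2 -> R).
Hypothesis (mA : measurable A) (mB : measurable B).
Hypothesis mf : measurable_fun (A `*` B) f.

Lemma measurable_slice2 y : B y -> measurable_fun A (fun x => f (x, y)).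
Proof.
move=> By; apply: (@measurable_comp _ _ _ _ _ _ (A `*` B) f _ (pair^~ y)) => //.
- exact: measurableX.
- by move=> _ [x Ax <-].
- exact/measurable_funTS/pair2_measurable.
Qed.
End Slices.

Lemma measure_setX_lty d1 d2 (T1 : measurableType d1) (T2 : measurableType d2) (R : realType)
    (m1 : {sigma_finite_measure set T1 -> \bar R}) (m2 : {sigma_finite_measure set T2 -> \bar R})
    (A : set T1) (B : set T2) : measurable A -> measurable B ->
  (m1 A < +oo)%E -> (m2 B < +oo)%E -> ((m1 \x m2) (A `*` B) < +oo)%E.
Proof.
move=> mA mB Af Bf.
have E := @product_measure1E _ _ _ _ R m1 m2 A B mA mB.
by rewrite [X in (X < _)%E]E; apply: lte_mul_pinfty => //; rewrite ge0_fin_numE.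
Qed.

(** * Stokes' theorem on a rectangle *)

Section RectangleStokes.
Context {R : realType}.
Notation mu := (@lebesgue_measure R).

(** Closedness of G ds + F dt is expressed by the common value [H] of dF/ds and dG/dt: both sides
    are the double integral of [H], evaluated in the two orders. *)
Lemma rect_stokes (F G H : R -> R -> R) (a b c d : R) : a < b -> c < d ->
  (forall s t : R, is_derive s 1 (F ^~ t) (H s t)) ->
  (forall s t : R, is_derive t 1 (G s) (H s t)) ->
  continuous (fun p : R * R => H p.1 p.2) ->
  (\int[mu]_(t in `[c, d]) (F b t - F a t)%:E =
   \int[mu]_(s in `[a, b]) (G s d - G s c)%:E)%E.
Proof.
move=> ab cd dF dG cH.
pose K : set (R * R) := `[a, b]%classic `*` `[c, d]%classic.
pose h (p : R * R) : R := H p.1 p.2.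
have mK : measurable K by apply: measurableX; exact: measurable_itv.
have cK : compact K by apply: compact_setX; exact: segment_compact.
have [M hM] : exists M, forall x, K x -> `|h x| <= M.
  by apply: (cont_compact_bounded cK) => x _; exact: cH.
have mh : measurable_fun setT h.
  by apply: cont_measurable2 => [|x _]; [exact: openT|exact: cH].
have Hs s t : {for s, continuous (fun x => H x t)}.
  have c1 : {for s, continuous (fun x : R => (x, t))}.
    by apply: (@cvg_pair _ _ _ _ (nbhs s) (nbhs t)); [exact: cvg_id|exact: cvg_cst].
  exact: (continuous_comp c1 (cH (s, t))).
have Ht s t : {for t, continuous (H s)}.
  have c1 : {for t, continuous (fun x : R => (s, x))}.
    by apply: (@cvg_pair _ _ _ _ (nbhs s) (nbhs t)); [exact: cvg_cst|exact: cvg_id].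
  exact: (continuous_comp c1 (cH (s, t))).
have iK : (mu \x mu)%E.-integrable K (EFin \o h).
  apply: (@bounded_integrable _ _ _ (mu \x mu)%E K h M mK) => //; last exact: measurable_funTS.
  by apply: measure_setX_lty; [exact: measurable_itv|exact: measurable_itv|
    exact: (mu_itv_lty (a := a) (b := b))|exact: (mu_itv_lty (a := c) (b := d))].
have E1 := @integral_setX1 _ _ _ _ R mu mu `[a, b]%classic `[c, d]%classic h
  (measurable_itv _) (measurable_itv _) iK.
have E2 := @integral_setX2 _ _ _ _ R mu mu `[a, b]%classic `[c, d]%classic h
  (measurable_itv _) (measurable_itv _) iK.
transitivity (\int[mu \x mu]_(p in K) (h p)%:E)%E; [rewrite [RHS]E2|rewrite [LHS]E1].
  apply: eq_integral => t _.
  by rewrite -(@FTC_closed R (H ^~ t) (F ^~ t) a b).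
by apply: eq_integral => s _; rewrite (@FTC_closed R (H s) (G s) c d).
Qed.

End RectangleStokes.

(** * Monotonicity from local information *)

Section Increasing.
Context {R : realType}.
Implicit Types (f : R -> R).

(** A maximum over [[a, b]] cannot sit at some c < b, because values just to the right of c are
    larger; hence it is attained at b and nowhere else. *)
Lemma locally_increasing f : continuous f ->
  (forall x, \forall t \near x, (x < t -> f x < f t) /\ (t < x -> f t < f x)) ->
  {homo f : a b / a < b}.
Proof.
move=> cf H a b ab.
have cab : {within `[a, b], continuous f} by apply: continuous_subspaceT.
have maxE c : c \in `[a, b] -> (forall t, t \in `[a, b] -> f t <= f c) -> c = b.
  move=> cI cmax; apply/eqP; move: (cI); rewrite in_itv/= => /andP[ac].
  rewrite le_eqVlt => /orP[//|cb]; exfalso.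
  have [d /= d0 Hd] := H c.
  pose t := Num.min b (c + d / 2).
  have ct : c < t by rewrite lt_min cb/=; lra.
  have tb : t <= b by rewrite ge_min lexx.
  have tc : t <= c + d / 2 by rewrite ge_min lexx orbT.
  have [/(_ ct) + _] : (c < t -> f c < f t) /\ (t < c -> f t < f c).
    by apply: Hd; rewrite /ball/= distrC ger0_norm; lra.
  by rewrite ltNge cmax// in_itv/= tb andbT; lra.
have [c cI cmax] := EVT_max (ltW ab) cab.
have cb := maxE _ cI cmax; rewrite {c}cb in cI cmax.
have aI : a \in `[a, b] by rewrite in_itv/= lexx ltW.
rewrite lt_neqAle cmax// andbT; apply/eqP => fab.
have := maxE a aI; rewrite fab => /(_ cmax) /eqP.
by rewrite lt_eqF.
Qed.

Lemma der_pos_local f (x a : R) : is_derive x 1 f a -> 0 < a ->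
  \forall t \near x, (x < t -> f x < f t) /\ (t < x -> f t < f x).
Proof.
move=> /is_derive1_caratheodory[g [fg cg ga]] a0.
have : \forall t \near x, 0 < g t.
  by move: cg; rewrite /prop_for /continuous_at ga => /cvgr_gt; exact.
apply: filterS => t g0; split=> xt; rewrite -subr_gt0.
- by rewrite fg mulr_gt0// subr_gt0.
- by rewrite -opprB fg -mulrN opprB mulr_gt0// subr_gt0.
Qed.

(** Induction on the exceptional points [Z], at which only continuity is known: one that lies inside
    splits the interval. In the application they are the zeros of a solution of the linear
    equation. *)
Lemma ndecr_off_finite f (df : R -> R) (Z : seq R) (a b : R) : a <= b ->
  (forall t, a <= t <= b -> {for t, continuous f}) ->
  (forall t, a < t < b -> t \notin Z -> is_derive t 1 f (df t) /\ 0 <= df t) ->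
  f a <= f b.
Proof.
elim: Z a b => [|z Z IH] a b ab cf H.
  apply: (@ger0_derive1_ndecr _ f a b) => //.
  - by move=> x xI; have [[]] := H x xI isT.
  - by move=> x xI; have [/der_val ->] := H x xI isT.
  - by apply: continuous_in_subspaceT => t; rewrite inE/= in_itv/= => /cf.
have [/andP[az zb]|nz] := boolP (a < z < b).
  apply: (@le_trans _ _ (f z)); apply: IH; rewrite ?ltW// => t /andP[t1 t2].
  - by apply: cf; rewrite t1 (le_trans t2)// ltW.
  - move=> tZ; apply: H; first by rewrite t1 (lt_trans t2).
    by rewrite inE negb_or tZ andbT lt_eqF.
  - by apply: cf; rewrite t2 (le_trans _ t1)// ltW.
  - move=> tZ; apply: H; first by rewrite t2 (lt_trans _ t1).
    by rewrite inE negb_or tZ andbT gt_eqF.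
apply: IH => // t tI tZ; apply: H => //.
by rewrite inE negb_or tZ andbT; apply: contra nz => /eqP <-.
Qed.

End Increasing.

(** * The argument of a solution and the number of its zeros *)

Section Zeros.
Context {R : realType}.

Lemma sin_intpi (l : int) : sin (l%:~R * pi) = 0 :> R.
Proof.
have N (n : nat) : sin (n%:R * pi) = 0 :> R.
  have := alternatingn (@sinDpi R) n 0.
  by rewrite add0r sin0 mulr0 mulr_natl.
case: l => n; first by rewrite -pmulrn N.
by rewrite NegzE mulrNz mulNr sinN -pmulrn N oppr0.
Qed.

Lemma sin_eq0_intpi (x : R) : sin x = 0 -> exists l : int, x = l%:~R * pi.
Proof.
move=> sx; exists (Num.floor (x / pi)); set l := Num.floor _.
have p0 := pi_gt0 R.
have /andP[l1 l2] := floor_itv (x / pi).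
rewrite -/l in l1 l2.
rewrite ler_pdivlMr// in l1; rewrite ltr_pdivrMr// intrD in l2.
apply/eqP; rewrite eq_le l1 andbT leNgt; apply/negP => lx.
have : 0 < sin (x - l%:~R * pi) by apply: sin_gt0_pi; lra.
by rewrite sinB sx sin_intpi; lra.
Qed.

Section Argument.
Variables (s : R -> R) (X Y eta : R -> R).
Hypothesis s_gt0 : forall t, 0 < s t.
Hypothesis dX : forall t : R, is_derive t 1 X (- s t * Y t).
Hypothesis dY : forall t : R, is_derive t 1 Y (X t).
Hypothesis ceta : continuous eta.
Hypothesis argE : forall t, exists2 r : R, 0 < r &
  X t = r * cos (eta t) /\ Y t = r * sin (eta t).

Lemma argument_increasing : {homo eta : a b / a < b}.
Proof.
apply: locally_increasing => // x.
have [r r0 [Xx Yx]] := argE x.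
have dW : is_derive x 1 (fun t => Y t * X x - X t * Y x) (X x ^+ 2 + s x * Y x ^+ 2).
  by der; ring.
have pos : 0 < X x ^+ 2 + s x * Y x ^+ 2.
  have /orP[h|h] : (X x != 0) || (Y x != 0).
  - rewrite -negb_and; apply/negP => /andP[/eqP h1 /eqP h2].
    have := cos2Dsin2 (eta x); move: Xx Yx.
    rewrite h1 h2 => /esym/eqP; rewrite mulf_eq0 gt_eqF//= => /eqP ->.
    by move=> /esym/eqP; rewrite mulf_eq0 gt_eqF//= => /eqP ->; lra.
  - by rewrite ltr_wpDr ?exprn_even_gt0// mulr_ge0 ?sqr_ge0 ?ltW.
  - by rewrite ltr_wpDl ?sqr_ge0// mulr_gt0 ?exprn_even_gt0.
have near_pi : \forall t \near x, `|eta x - eta t| < pi.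
  by move: (@ceta x) => /cvgrPdist_lt; apply; exact: pi_gt0.
move: near_pi (der_pos_local dW pos); apply: filterS2 => t.
rewrite ltr_norml => /andP[h1 h2].
have [r' r'0 [Xt Yt]] := argE t.
have -> : Y t * X x - X t * Y x = r * r' * sin (eta t - eta x).
  by rewrite Xx Yx Xt Yt sinB; ring.
have -> : Y x * X x - X x * Y x = 0 by ring.
have rr : 0 < r * r' by apply: mulr_gt0.
move=> [p1 p2]; split=> xt.
- have := p1 xt; rewrite pmulr_rgt0// => sp.
  rewrite ltNge; apply/negP; rewrite le_eqVlt => /orP[/eqP h|h].
    by move: sp; rewrite h subrr sin0 ltxx.
  have : 0 < sin (- (eta t - eta x)) by apply: sin_gt0_pi; lra.
  by rewrite sinN; lra.
- have := p2 xt; rewrite pmulr_rlt0// => sp.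
  rewrite ltNge; apply/negP; rewrite le_eqVlt => /orP[/eqP h|h].
    by move: sp; rewrite h subrr sin0 ltxx.
  have : 0 < sin (eta t - eta x) by apply: sin_gt0_pi; lra.
  by lra.
Qed.

(** [Y] vanishes where the increasing [eta] is a multiple of pi, and each multiple is taken at most
    once; an interval of length eta L - eta 0 holds at most (eta L - eta 0) / pi + 1 of them. *)
Lemma argument_zeros (L : R) : 0 < L -> exists Z : seq R,
  [/\ (size Z)%:R * pi <= eta L - eta 0 + pi &
      forall t, 0 <= t <= L -> Y t = 0 -> t \in Z].
Proof.
move=> L0; have p0 := pi_gt0 R.
have inc := argument_increasing.
pose l0 := Num.ceil (eta 0 / pi).
pose n := (Num.truncn ((eta L - eta 0) / pi)).+1.
(* For a multiple of pi that [eta] does not attain, [get] returns an arbitrary point; the list only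
   has to contain all zeros. *)
pose T (i : nat) : R := get [set t | eta t = (l0%:~R + i%:R) * pi].
exists [seq T i | i <- iota 0 n]; split.
  have h : 0 <= (eta L - eta 0) / pi.
    by rewrite divr_ge0 ?ltW// subr_gt0 inc.
  rewrite size_map size_iota /n -natr1 mulrDl mul1r lerD2r -ler_pdivlMr//.
  by have /andP[] := truncn_itv h.
move=> t /andP[t0 tL] Yt.
have [r r0 [_ Yt']] := argE t.
have : sin (eta t) = 0.
  by move: Yt'; rewrite Yt => /esym/eqP; rewrite mulf_eq0 gt_eqF//= => /eqP.
move=> /sin_eq0_intpi[l etat].
have e0 : eta 0 <= eta t by move: t0; rewrite le_eqVlt => /orP[/eqP ->//|/inc/ltW].
have eL : eta t <= eta L by move: tL; rewrite le_eqVlt => /orP[/eqP ->//|/inc/ltW].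
have l0l : l0 <= l by rewrite /l0 ceil_le_int ler_pdivrMr// -etat.
have [i iE] : exists i : nat, l = l0 + i%:Z.
  by exists `|l - l0|%N; rewrite gez0_abs ?subr_ge0//; ring.
have iEr : l%:~R = l0%:~R + i%:R :> R by rewrite iE intrD.
have tT : eta (T i) = (l0%:~R + i%:R) * pi.
  by apply: (@getPex _ [set t | eta t = (l0%:~R + i%:R) * pi]); exists t; rewrite /= -iEr.
have -> : t = T i.
  apply/eqP; rewrite eq_le !leNgt; apply/andP; split; apply/negP => /inc.
  - by rewrite tT etat iEr ltxx.
  - by rewrite tT etat iEr ltxx.
apply: map_f; rewrite mem_iota /= add0n /n ltnS.
rewrite truncn_ge_nat; last by rewrite divr_ge0 ?subr_ge0 ?(le_trans e0)// ltW.
rewrite ler_pdivlMr//.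
have := ceil_ge (eta 0 / pi); rewrite -/l0 ler_pdivrMr//.
move: eL; rewrite etat iEr mulrDl; lra.
Qed.

End Argument.
End Zeros.

(** * Jacobi's identity for the second variation *)

Section Jacobi.
Context {R : realType}.
Variables (s X Y : R -> R).
Hypothesis dX : forall t : R, is_derive t 1 X (- s t * Y t).
Hypothesis dY : forall t : R, is_derive t 1 Y (X t).
Hypothesis XY : forall t, Y t = 0 -> X t != 0.

(* Jacobi's identity: off the zeros of Y,
   u'^2 - s u^2 - (u^2 Y'/Y)' = (u' - u Y'/Y)^2, where Y' = X. *)
Lemma jacobi_form_ge0 (u du P b : R -> R) (L : R) (Z : seq R) : 0 <= L ->
  (forall t : R, is_derive t 1 u (du t)) ->
  (forall t : R, is_derive t 1 P (b t)) ->
  (forall t, du t ^+ 2 - s t * u t ^+ 2 <= b t) ->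
  (forall t, 0 <= t <= L -> Y t = 0 -> t \in Z) ->
  (forall t, 0 <= t <= L -> Y t = 0 -> u t = 0) ->
  u 0 = 0 -> u L = 0 -> P 0 <= P L.
Proof.
move=> L0 du_ dP hb YZ Yu u0 uL.
pose H t := P t - u t ^+ 2 * X t / Y t.
have -> : P 0 = H 0 by rewrite /H u0; ring.
have -> : P L = H L by rewrite /H uL; ring.
have cX t : {for t, continuous X} by exact: der_cont (dX t).
pose dH t := b t - (2 * u t * du t * X t / Y t - s t * u t ^+ 2
  - u t ^+ 2 * X t ^+ 2 / Y t ^+ 2).
have DH t : Y t != 0 -> is_derive t 1 H (dH t).
  by move=> Yt; rewrite /H /dH; der => //; field.
apply: (@ndecr_off_finite _ H dH Z) => // t tI; last first.
  move=> tZ; have Yt : Y t != 0.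
    apply: contra tZ => /eqP Yt; apply: YZ => //.
    by case/andP: tI => *; rewrite !ltW.
  split; first exact: DH.
  have -> : dH t = (b t - (du t ^+ 2 - s t * u t ^+ 2)) + (du t - u t * X t / Y t) ^+ 2.
    by rewrite /dH; field.
  by rewrite addr_ge0 ?sqr_ge0// subr_ge0.
have [Yt0|Yt] := eqVneq (Y t) 0; last exact: der_cont (DH t Yt).
have ut := Yu t tI Yt0.
(* At a zero t of [Y], which is also one of [u], both functions are x - t times a continuous factor,
   g and h, with h t = X t nonzero. So u^2 X / Y extends continuously as g^2 (x - t) X / h; at t
   itself the division by 0 in [H] yields the right value 0. *)
have [g [ug cg gt]] := (is_derive1_caratheodory _ _ _).1 (du_ t).
have [h [Yh ch ht]] := (is_derive1_caratheodory _ _ _).1 (dY t).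
have hn0 : \forall x \near t, h x != 0.
  have : h t != 0 by rewrite ht; exact: XY.
  by move=> ?; move: ch => /cvgr_neq0; exact.
pose K x := P x - g x ^+ 2 * (x - t) * X x / h x.
have HK : \forall x \near t, K x = H x.
  move: hn0; apply: filterS => x hx.
  rewrite /K /H.
  have [->|xt] := eqVneq x t; first by rewrite ut; ring.
  have -> : u x = g x * (x - t) by rewrite -ug ut subr0.
  have -> : Y x = h x * (x - t) by rewrite -Yh Yt0 subr0.
  by field; rewrite hx subr_eq0 xt.
have KHt : K t = H t by exact: (nbhs_singleton HK).
rewrite /prop_for /continuous_at -KHt.
apply: cvg_trans (near_eq_cvg HK) _.
have cK : {for t, continuous K}.
  apply: cvgB; first exact: der_cont (dP t).
  apply: cvgM; last by apply: cvgV => //; rewrite ht; exact: XY.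
  apply: cvgM; last exact: cX.
  apply: cvgM; first by rewrite expr2; under eq_fun do rewrite expr2; exact: cvgM.
  by apply: cvgB; [exact: cvg_id | exact: cvg_cst].
exact: cK.
Qed.

End Jacobi.

(** * Integrals of trigonometric polynomials over k periods *)

Section HasInt.
Context {R : realType}.
Variable L : R.

(** Encoded by a primitive on the whole line: linearity is immediate, and the primitive itself is
    what the monotonicity argument from Jacobi's identity consumes. *)
Definition has_integral (f : R -> R) (I : R) : Prop :=
  exists F : R -> R, (forall x : R, is_derive x 1 F (f x)) /\ F L - F 0 = I.

Lemma eq_has_integral f g I : f =1 g -> has_integral f I -> has_integral g I.
Proof. by move=> fg [F [dF FI]]; exists F; split=> // x; rewrite -fg. Qed.

Lemma has_integral_cst a : has_integral (fun=> a) (a * L).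
Proof. by exists (fun x => a * x); split=> [x|]; [der; ring | ring]. Qed.

Lemma has_integralD f g I J : has_integral f I -> has_integral g J -> has_integral (fun x => f x + g x) (I + J).
Proof.
move=> [F [dF FI]] [G [dG GJ]]; exists (fun x => F x + G x); split=> [x|].
  exact: der_add.
rewrite -FI -GJ; ring.
Qed.

Lemma has_integralZ a f I : has_integral f I -> has_integral (fun x => a * f x) (a * I).
Proof.
move=> [F [dF FI]]; exists (fun x => a * F x); split=> [x|]; last by rewrite -FI; ring.
by apply: is_derive_eq (der_mul (der_cst _ _) (dF x)) _; ring.
Qed.

Lemma has_integral_sum (T : finType) (f : T -> R -> R) (I : T -> R) :
  (forall i, has_integral (f i) (I i)) ->
  has_integral (fun x => \sum_i f i x) (\sum_i I i).
Proof.
move=> H; elim: (index_enum T) => [|i r IH].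
  rewrite big_nil; apply: (@eq_has_integral (fun=> 0)) => [x|]; first by rewrite big_nil.
  by rewrite -[X in has_integral _ X](mul0r L); exact: has_integral_cst.
rewrite big_cons; apply: (@eq_has_integral (fun x => f i x + \sum_(j <- r) f j x)) => [x|].
  by rewrite big_cons.
exact: has_integralD.
Qed.

(** The entries of the Gram matrix are asked for at nonzero coefficients only: the formula with
    weight cos holds for frequencies above 1, which is where the coefficients of g live. *)
Lemma has_integral_bilinear (T : finType) (w : R -> R) (a b : T -> R) (E : T -> R -> R)
    (K : T -> T -> R) :
  (forall i j, a i != 0 -> b j != 0 -> has_integral (fun x => w x * (E i x * E j x)) (K i j)) ->
  has_integral (fun x => w x * ((\sum_i a i * E i x) * (\sum_i b i * E i x)))
    (\sum_i \sum_j a i * b j * K i j).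
Proof.
move=> H; apply: (@eq_has_integral (fun x => \sum_i \sum_j a i * b j * (w x * (E i x * E j x)))).
  move=> x; rewrite big_distrlr/= mulr_sumr; apply: eq_bigr => i _.
  by rewrite mulr_sumr; apply: eq_bigr => j _; ring.
apply: has_integral_sum => i; apply: has_integral_sum => j.
have [->|a0] := eqVneq (a i) 0.
  apply: (@eq_has_integral (fun=> 0)) => [x|]; first by rewrite !mul0r.
  by rewrite !mul0r -[X in has_integral _ X](mul0r L); exact: has_integral_cst.
have [->|b0] := eqVneq (b j) 0.
  apply: (@eq_has_integral (fun=> 0)) => [x|]; first by rewrite mulr0 !mul0r.
  by rewrite mulr0 !mul0r -[X in has_integral _ X](mul0r L); exact: has_integral_cst.
by apply: has_integralZ; exact: H.
Qed.

End HasInt.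

Section Modes.
Context {R : realType}.
Variable k : nat.
Hypothesis k0 : (0 < k)%N.
Let kR : k%:R != 0 :> R. Proof. by rewrite pnatr_eq0 -lt0n. Qed.
Let L : R := 2 * pi * k%:R.

(* cos (n x / k) for [t = false] and sin (n x / k) for [t = true] *)
Definition mode (t : bool) (n : nat) (x : R) : R :=
  cos (n%:R * x / k%:R - t%:R * (pi / 2)).

Lemma sin_shift2pi (i j : nat) (x : R) : sin (2 * pi * (i%:R - j%:R) + x) = sin x.
Proof.
have H n y : sin (y + 2 * pi * n%:R) = sin y :> R.
  by rewrite -(periodicn (@sinD2pi R) n y) -mulrnA mulr_natr mulr_natl mulrnA.
rewrite -[RHS](H i) -[LHS](H j); congr sin; ring.
Qed.

Lemma has_integral_cosn (i j : nat) (c : R) : i != j ->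
  has_integral L (fun x => cos ((i%:R - j%:R) * x / k%:R + c)) 0.
Proof.
move=> ij; have ij0 : i%:R - j%:R != 0 :> R by rewrite subr_eq0 eqr_nat.
exists (fun x => sin ((i%:R - j%:R) * x / k%:R + c) * (k%:R / (i%:R - j%:R))); split.
  by move=> x; der; field; rewrite kR ij0.
have -> : (i%:R - j%:R) * L / k%:R = 2 * pi * (i%:R - j%:R) by rewrite /L; field.
by rewrite sin_shift2pi mulr0 mul0r add0r subrr.
Qed.

(** The sum frequency i + j is written as a difference with 0, so that both terms have the shape
    treated by [has_integral_cosn]. *)
Lemma mode_mul t i t' j x : mode t i x * mode t' j x =
  1 / 2 * cos ((i%:R - j%:R) * x / k%:R + (t'%:R - t%:R) * (pi / 2)) +
  1 / 2 * cos (((i + j)%:R - (0%N)%:R) * x / k%:R + (- t'%:R - t%:R) * (pi / 2)).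
Proof.
rewrite /mode.
pose A : R := i%:R * x / k%:R - t%:R * (pi / 2).
pose B : R := j%:R * x / k%:R - t'%:R * (pi / 2).
rewrite -/A -/B.
have -> : (i%:R - j%:R) * x / k%:R + (t'%:R - t%:R) * (pi / 2) = A - B.
  by rewrite /A /B; field.
have -> : ((i + j)%:R - (0%N)%:R) * x / k%:R + (- t'%:R - t%:R) * (pi / 2) = A + B.
  by rewrite /A /B natrD; field.
by rewrite (cosD A B) (cosB A B); field.
Qed.

Lemma has_integral_mode t i t' j : (0 < i)%N -> (0 < j)%N ->
  has_integral L (fun x => mode t i x * mode t' j x)
    (pi * k%:R * ((t == t') && (i == j))%:R).
Proof.
move=> i0 j0; apply: (eq_has_integral (fun x => esym (mode_mul t i t' j x))).
have -> : pi * k%:R * ((t == t') && (i == j))%:R =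
  1 / 2 * (2 * (pi * k%:R * ((t == t') && (i == j))%:R)) + 1 / 2 * 0 :> R by field.
apply: has_integralD; apply: has_integralZ; last first.
  by apply: has_integral_cosn; rewrite addn_eq0 negb_and -lt0n i0.
have [->|ij] := eqVneq i j; last by rewrite andbF !mulr0; exact: has_integral_cosn.
have -> : 2 * (pi * k%:R * ((t == t') && true)%:R) = cos ((t'%:R - t%:R) * (pi / 2)) * L.
  rewrite /L; case: t t' => -[] /=.
  - by rewrite subrr mul0r cos0; ring.
  - by rewrite sub0r mulN1r cosN cos_pihalf; ring.
  - by rewrite subr0 mul1r cos_pihalf; ring.
  - by rewrite subrr mul0r cos0; ring.
apply: (@eq_has_integral _ _ (fun=> cos ((t'%:R - t%:R) * (pi / 2)))); last exact: has_integral_cst.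
by move=> x; rewrite subrr !mul0r add0r.
Qed.

Lemma cos_mode t n x : (k < n)%N ->
  cos x * mode t n x = 1 / 2 * mode t (n + k) x + 1 / 2 * mode t (n - k) x.
Proof.
move=> kn; rewrite /mode natrB ?(ltnW kn)// natrD; pose A : R := n%:R * x / k%:R - t%:R * (pi / 2).
rewrite -/A.
have -> : (n%:R + k%:R) * x / k%:R - t%:R * (pi / 2) = A + x by rewrite /A; field.
have -> : (n%:R - k%:R) * x / k%:R - t%:R * (pi / 2) = A - x by rewrite /A; field.
by rewrite (cosD A x) (cosB A x); field.
Qed.

(** Multiplication by cos x moves the index by k, half in each direction; k < i keeps i - k a
    positive index, to which orthogonality applies. *)
Lemma has_integral_cos_mode t i t' j : (k < i)%N -> (k < j)%N ->
  has_integral L (fun x => cos x * (mode t i x * mode t' j x))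
    (pi * k%:R * ((t == t')%:R * (1 / 2 * (i + k == j)%:R + 1 / 2 * (i == j + k)%:R))).
Proof.
move=> ki kj.
apply: (@eq_has_integral _ _ (fun x => 1 / 2 * (mode t (i + k) x * mode t' j x)
  + 1 / 2 * (mode t (i - k) x * mode t' j x))).
  by move=> x; rewrite mulrA cos_mode//; ring.
have -> : pi * k%:R * ((t == t')%:R * (1 / 2 * (i + k == j)%:R + 1 / 2 * (i == j + k)%:R)) =
   1 / 2 * (pi * k%:R * ((t == t') && (i + k == j))%:R) +
   1 / 2 * (pi * k%:R * ((t == t') && (i - k == j)%N)%:R) :> R.
  have -> : (i == j + k)%N = (i - k == j)%N by rewrite -(eqn_add2r k (i - k)) subnK ?(ltnW ki).
  by rewrite -!mulnb !natrM; field.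
have j0 : (0 < j)%N by rewrite (leq_ltn_trans _ kj).
by apply: has_integralD; apply: has_integralZ; apply: has_integral_mode; rewrite ?subn_gt0 ?addn_gt0 ?k0 ?orbT.
Qed.

Definition dmode (t : bool) (n : nat) (x : R) : R :=
  - (n%:R / k%:R) * sin (n%:R * x / k%:R - t%:R * (pi / 2)).

Lemma is_derive_mode t n (x : R) : is_derive x 1 (mode t n) (dmode t n x).
Proof. by rewrite /mode /dmode; der; field. Qed.

Lemma is_derive_dmode t n (x : R) :
  is_derive x 1 (dmode t n) (- (n%:R / k%:R) ^+ 2 * mode t n x).
Proof. by rewrite /mode /dmode; der; field. Qed.

Lemma mode_period t n : mode t n L = mode t n 0 /\ dmode t n L = dmode t n 0.
Proof.
have h : n%:R * L / k%:R - t%:R * (pi / 2) = 2 * pi * (n%:R - (0%N)%:R) + - t%:R * (pi / 2).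
  by rewrite /L; field.
have h0 : n%:R * 0 / k%:R - t%:R * (pi / 2) = - t%:R * (pi / 2) :> R by field.
split; last by rewrite /dmode h h0 sin_shift2pi.
by rewrite /mode h h0 -![cos _]sinDpihalf -addrA sin_shift2pi.
Qed.

End Modes.

(** * Negativity of the quadratic form on Fourier coefficients *)

(** Here v = n / k for a frequency n such that n + k is still at most J. Since 7 * 17 / 16 < 8, v
    stays below 2. The factor 5 / 2 barely fits there: at v = 2 the left side is 15 / 2 and the
    hypothesis gives m >= 128 / 17. *)
Lemma lower_mode_bound (R : realType) (m v : R) :
  m < 7 -> 1 < v -> v ^+ 2 + 2 * v <= m * (17 / 16) -> 5 / 2 * (v ^+ 2 - 1) <= m.
Proof.
move=> m7 v1 h3.
have v2 : v < 2.
  rewrite ltNge; apply/negP => v3.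
  have h : 0 <= (v - 2) * (v + 4) by apply: mulr_ge0; lra.
  have E : (v - 2) * (v + 4) = v ^+ 2 + 2 * v - 8 by ring.
  rewrite E in h; lra.
have h : 0 <= (v - 1) * (2 - v) by apply: mulr_ge0; lra.
have E : (v - 1) * (2 - v) = 3 * v - 2 - v ^+ 2 by ring.
rewrite E in h; lra.
Qed.

Section Form.
Context {R : realType}.
Variables (m e : R) (k J : nat) (p : nat -> R).
Hypotheses (m0 : 0 < m) (m7 : m < 7) (e0 : 0 < e) (e1 : e < 1) (k0 : (0 < k)%N).
Hypothesis J3k : (J < 3 * k)%N.

(* The trial function has Fourier coefficients [Ycoef n] at the frequencies n / k,
   and [Gcoef n] are those of an auxiliary function g.  The coefficients at
   frequencies in ]1, J / k] are free parameters, and above J / k the value of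
   [Gcoef n] minimizes x^2 + e x (p (n - k)).  [Tcoef n] is the share of the
   frequency n / k in the integral of u'^2 - u^2 + 2 u g + (1 + e cos) g^2 / m,
   a majorant of u'^2 - s u^2. *)
Definition dcoef (n : nat) : R := (n%:R / k%:R) ^+ 2 - 1.
Definition Gcoef (n : nat) : R :=
  if (n <= k)%N then 0 else if (n <= J)%N then p n
  else if (k < n - k)%N then - (e / 2) * p (n - k) else 0.
Definition Ycoef (n : nat) : R :=
  if (n < k)%N then p n else if n == k then 0 else - Gcoef n / dcoef n.
Definition Tcoef (n : nat) : R :=
  dcoef n * Ycoef n ^+ 2 + 2 * (Ycoef n * Gcoef n) + Gcoef n ^+ 2 / m
  + e / m * (Gcoef n * Gcoef (n + k)).

Hypothesis hJ : forall n, (n <= J)%N -> dcoef n <= m * (1 + e ^+ 2 / 16).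
Hypothesis pJ : forall n, (J < n)%N -> p n = 0.
Hypothesis pk : p k = 0.

Let kR : 0 < k%:R :> R. Proof. by rewrite ltr0n. Qed.

Lemma dcoef_lt0 n : (n < k)%N -> dcoef n < 0.
Proof.
move=> nk; have h : n%:R / k%:R < 1 :> R by rewrite ltr_pdivrMr// mul1r ltr_nat.
have h0 : 0 <= n%:R / k%:R :> R by rewrite divr_ge0.
rewrite /dcoef; nra.
Qed.

Lemma dcoef_gt0 n : (k < n)%N -> 0 < dcoef n.
Proof.
move=> nk; have h : 1 < n%:R / k%:R :> R by rewrite ltr_pdivlMr// mul1r ltr_nat.
rewrite /dcoef; nra.
Qed.

(** Bookkeeping of the estimate. [A n] is what mode n keeps of its own term. [b n] is charged to n
    for the cost of the auxiliary coefficient that n creates at n + k > J; [b'] books the same cost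
    where it occurs. [c n] is charged to n, when n > 2 k, for its coupling with the free mode n -
    k. *)
Let A (n : nat) : R :=
  if (n < k)%N then dcoef n * p n ^+ 2 else
  if (n <= k)%N then 0 else
  if (J < n)%N then 0 else
  if (n + k <= J)%N then - (1 / 10 / m) * p n ^+ 2
  else (e ^+ 2 / 16 / m - e ^+ 2 / 2 / m) * p n ^+ 2.
Let b (n : nat) : R := if (k < n)%N && (J < n + k)%N then e ^+ 2 / 4 / m * p n ^+ 2 else 0.
Let c (n : nat) : R := if (2 * k < n <= J)%N then 5 / 28 * e ^+ 2 / m * p n ^+ 2 else 0.
Let b' (n : nat) : R := if (k < n)%N then b (n - k) else 0.

(** Above frequency 1, [Ycoef] is the minimizer of d Y^2 + 2 Y G, so that only - G^2 / d remains of
    the terms containing it. *)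
Lemma Tcoef_high n : (k < n)%N ->
  Tcoef n = (m^-1 - (dcoef n)^-1) * Gcoef n ^+ 2 + e / m * (Gcoef n * Gcoef (n + k)).
Proof.
move=> kn; rewrite /Tcoef /Ycoef ltnNge ltnW//= gtn_eqF//.
by have := dcoef_gt0 kn => /lt0r_neq0 d0; field; rewrite d0 gt_eqF.
Qed.

Lemma Tcoef_le n : Tcoef n <= A n + b' n + c (n + k).
Proof.
have e2m : 0 <= e ^+ 2 / m by rewrite mulr_ge0 ?sqr_ge0// invr_ge0 ltW.
have b'0 : 0 <= b' n.
  by rewrite /b' /b; do 2 case: ifP => //= _; rewrite mulr_ge0 ?sqr_ge0//; lra.
have c0 i : 0 <= c i.
  by rewrite /c; case: ifP => //= _; rewrite mulr_ge0 ?sqr_ge0//; lra.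
have [nk|kn|nk] := ltngtP n k; last first.
- have -> : Tcoef n = 0.
    rewrite /Tcoef /Ycoef nk ltnn eqxx /Gcoef leqnn; ring.
  have -> : A n = 0 by rewrite /A nk ltnn leqnn.
  by rewrite add0r addr_ge0.
- rewrite Tcoef_high//.
  have dn := dcoef_gt0 kn.
  have [Jn|nJ] := ltnP J n.
    have -> : A n = 0 by rewrite /A ltnNge ltnW//= leqNgt kn/= Jn.
    rewrite add0r.
    have -> : Gcoef (n + k) = 0.
      rewrite /Gcoef leqNgt (ltn_addr _ kn)/= leqNgt (ltn_addr _ Jn)/= addnK kn pJ//.
      by rewrite mulr0.
    rewrite !mulr0 addr0 (le_trans _ (_ : b' n <= _)) ?lerDl//.
    rewrite /Gcoef leqNgt kn/= leqNgt Jn/= /b' kn /b.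
    case: ifP => knk /=; last by rewrite expr0n/= mulr0.
    rewrite subnK ?(ltnW kn)// Jn.
    have : (m^-1 - (dcoef n)^-1) <= m^-1 by rewrite gerBl invr_ge0 ltW.
    have -> : e ^+ 2 / 4 / m * p (n - k) ^+ 2 = m^-1 * (- (e / 2) * p (n - k)) ^+ 2.
      by field; rewrite gt_eqF.
    by move=> h; rewrite ler_wpM2r// sqr_ge0.
  have GE : Gcoef n = p n by rewrite /Gcoef leqNgt kn/= nJ.
  rewrite GE.
  have [nkJ|Jnk] := leqP (n + k) J.
    have -> : A n = - (1 / 10 / m) * p n ^+ 2.
      by rewrite /A ltnNge ltnW//= leqNgt kn/= ltnNge nJ/= nkJ.
    have -> : c (n + k) = 5 / 28 * e ^+ 2 / m * p (n + k) ^+ 2.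
      by rewrite /c nkJ mul2n -addnn ltn_add2r kn.
    have -> : Gcoef (n + k) = p (n + k).
      by rewrite /Gcoef leqNgt (ltn_addr _ kn)/= nkJ.
    have h1 := hJ nkJ; rewrite /dcoef natrD mulrDl divff ?gt_eqF// in h1.
    have v1 : 1 < n%:R / k%:R :> R by rewrite ltr_pdivlMr// mul1r ltr_nat.
    have dd : 5 / 2 * dcoef n <= m.
      rewrite /dcoef; set v := n%:R / k%:R in h1 v1 *.
      have e2 : e ^+ 2 <= 1 by rewrite exprn_ile1 ?ltW.
      have me : m * e ^+ 2 <= m * 1 by rewrite ler_wpM2l// ltW.
      have h2 : (v + 1) ^+ 2 - 1 <= m * (17 / 16).
        by apply: (le_trans h1); lra.
      have h3 : v ^+ 2 + 2 * v <= m * (17 / 16).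
        by apply: le_trans h2; rewrite le_eqVlt; apply/orP; left; apply/eqP; ring.
      exact: lower_mode_bound h3.
    (* Of the amount 3 / 2, the part 7 / 5 absorbs the coupling e p(n) p(n + k) at the price 5 / 28
       e^2 p(n + k)^2, by the square of e p(n + k) - 14 / 5 p(n); 1 / 10 is left over. *)
    have h2 : m^-1 - (dcoef n)^-1 <= - (3 / 2) / m.
      rewrite -subr_ge0.
      have -> : - (3 / 2) / m - (m^-1 - (dcoef n)^-1) = (m - 5 / 2 * dcoef n) / (m * dcoef n).
        by field; rewrite !gt_eqF.
      by rewrite divr_ge0 ?subr_ge0 ?mulr_ge0 ?(ltW m0) ?(ltW dn).
    apply: (@le_trans _ _ (- (3 / 2) / m * p n ^+ 2 + e / m * (p n * p (n + k)))).
      by rewrite lerD2r ler_wpM2r// sqr_ge0.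
    rewrite -subr_ge0.
    have -> : - (1 / 10 / m) * p n ^+ 2 + b' n + 5 / 28 * e ^+ 2 / m * p (n + k) ^+ 2 -
      (- (3 / 2) / m * p n ^+ 2 + e / m * (p n * p (n + k))) =
      b' n + m^-1 * (5 / 28) * (e * p (n + k) - 14 / 5 * p n) ^+ 2.
      by field; rewrite gt_eqF.
    by rewrite addr_ge0// mulr_ge0 ?sqr_ge0// mulr_ge0 ?invr_ge0 ?ltW.
  have -> : A n = (e ^+ 2 / 16 / m - e ^+ 2 / 2 / m) * p n ^+ 2.
    by rewrite /A ltnNge ltnW//= leqNgt kn/= ltnNge nJ/= leqNgt Jnk.
  have -> : Gcoef (n + k) = - (e / 2) * p n.
    by rewrite /Gcoef leqNgt (ltn_addr _ kn)/= leqNgt Jnk/= addnK kn.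
  have h1 := hJ nJ.
  (* With x = e^2 / 16, the bound d <= m (1 + x) implies 1 / d >= (1 - x) / m, because (1 - x) (1 +
     x) <= 1. *)
  have h2 : m^-1 - (dcoef n)^-1 <= e ^+ 2 / 16 / m.
    rewrite -subr_ge0.
    have -> : e ^+ 2 / 16 / m - (m^-1 - (dcoef n)^-1)
       = (m - (1 - e ^+ 2 / 16) * dcoef n) / (m * dcoef n).
      by field; rewrite !gt_eqF.
    rewrite divr_ge0 ?mulr_ge0 ?(ltW m0) ?(ltW dn)// subr_ge0.
    have e2 : 0 <= 1 - e ^+ 2 / 16.
      by have : e ^+ 2 <= 1; [rewrite exprn_ile1 ?ltW|move=> ?; lra].
    apply: (le_trans (ler_wpM2l e2 h1)); rewrite -subr_ge0.
    have -> : m - (1 - e ^+ 2 / 16) * (m * (1 + e ^+ 2 / 16)) = m * (e ^+ 2 / 16) ^+ 2.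
      by field.
    by rewrite mulr_ge0 ?sqr_ge0 ?ltW.
  apply: (@le_trans _ _ (e ^+ 2 / 16 / m * p n ^+ 2 + e / m * (p n * (- (e / 2) * p n)))).
    by rewrite lerD2r ler_wpM2r// sqr_ge0.
  have -> : e ^+ 2 / 16 / m * p n ^+ 2 + e / m * (p n * (- (e / 2) * p n)) =
    (e ^+ 2 / 16 / m - e ^+ 2 / 2 / m) * p n ^+ 2 by field; rewrite gt_eqF.
  by rewrite -addrA lerDl addr_ge0.
- have -> : A n = dcoef n * p n ^+ 2 by rewrite /A nk.
  have -> : Tcoef n = dcoef n * p n ^+ 2.
    rewrite /Tcoef /Ycoef nk /Gcoef (ltnW nk); ring.
  by rewrite -addrA lerDl addr_ge0.
Qed.

(** Once the charges are summed, each mode has a nonpositive balance [S n], negative where p(n) is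
    nonzero. The tightest one is e^2 / m times 1/16 - 1/2 + 1/4 + 5/28 = - 1/112. Since J < 3 k, a
    mode n > 2 k that pays [c] satisfies n + k > J and so has the gain - e^2 / 2 of the high
    coupling to pay from. *)
Lemma form_le0 : \sum_(i < J + k) Tcoef i.+1 <= 0 /\
  ((exists n, (0 < n <= J)%N /\ p n != 0) -> \sum_(i < J + k) Tcoef i.+1 < 0).
Proof.
pose S n := A n + b n + c n.
have S_le n : S n <= 0 /\ (((n <= J)%N && (p n != 0)) -> S n < 0).
  suff: S n <= 0 /\ (S n = 0 -> (n <= J)%N -> p n = 0).
    move=> [h1 h2]; split=> // /andP[nJ pn]; rewrite lt_neqAle h1 andbT.
    by apply: contra pn => /eqP h; rewrite h2.
  have sq (z : R) (B : bool) : z < 0 -> z * p n ^+ 2 <= 0 /\ (z * p n ^+ 2 = 0 -> B -> p n = 0).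
    move=> z0; split; first by rewrite mulr_le0_ge0 ?sqr_ge0 ?ltW.
    by move/eqP; rewrite mulf_eq0 lt_eqF//= sqrf_eq0 => /eqP.
  rewrite /S /A /b /c.
  have [nk|kn|nk] := ltngtP n k; last first.
  - have -> : (2 * k < n)%N = false.
      by apply/negbTE; rewrite -leqNgt nk mul2n -addnn leq_addr.
    by rewrite /= !addr0 nk pk.
  - have [Jn|nJ] := ltnP J n.
      by rewrite /= andbF/= pJ// expr0n/= mulr0 addr0; case: ifP; rewrite !addr0.
    have [nkJ|Jnk] := leqP (n + k) J.
      have -> : (2 * k < n)%N = false.
        apply/negbTE; rewrite -leqNgt -(leq_add2r k) (leq_trans nkJ)//.
        by rewrite -ltnS (leq_trans J3k)// mulSn addnC leqnSn.
      rewrite /= !addr0; apply: sq.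
      by rewrite oppr_lt0 !divr_gt0.
    rewrite /= andbT.
    have e2 : 0 < e ^+ 2 / m by rewrite divr_gt0// exprn_gt0.
    case: ifP => _.
      have -> : (e ^+ 2 / 16 / m - e ^+ 2 / 2 / m) * p n ^+ 2 +
        e ^+ 2 / 4 / m * p n ^+ 2 + 5 / 28 * e ^+ 2 / m * p n ^+ 2 =
        - (e ^+ 2 / m / 112) * p n ^+ 2 by field; rewrite gt_eqF.
      by apply: sq; rewrite oppr_lt0 divr_gt0.
    have -> : (e ^+ 2 / 16 / m - e ^+ 2 / 2 / m) * p n ^+ 2 +
        e ^+ 2 / 4 / m * p n ^+ 2 + 0 =
        - (3 * (e ^+ 2 / m) / 16) * p n ^+ 2 by field; rewrite gt_eqF.
    by apply: sq; rewrite oppr_lt0 divr_gt0// mulr_gt0.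
  - have -> : (2 * k < n)%N = false.
      by apply/negbTE; rewrite -leqNgt (leq_trans (ltnW nk))// mul2n -addnn leq_addr.
    by rewrite /= !addr0; apply: sq; exact: dcoef_lt0.
have sumb : \sum_(i < J + k) b' i.+1 = \sum_(i < J + k) b i.+1.
  transitivity (\sum_(i < k + J) b' i.+1); first by rewrite addnC.
  rewrite !big_split_ord/=.
  rewrite [X in X + _ = _]big1 ?add0r => [|i _]; last first.
    by rewrite /b' ltnNge ltn_ord.
  rewrite [X in _ = _ + X]big1 ?addr0 => [|i _]; last first.
    by rewrite /b; case: ifP => // _; rewrite pJ ?expr0n ?mulr0// ltnS leq_addr.
  by apply: eq_bigr => i _; rewrite /b' ltnS leq_addr -addnS addKn.
have sumc : \sum_(i < J + k) c (i.+1 + k) = \sum_(i < J + k) c i.+1.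
  transitivity (\sum_(i < k + (J + k)) c i.+1).
    rewrite [RHS]big_split_ord/= [X in _ = X + _]big1 ?add0r => [|i _].
      by apply: eq_bigr => i _; rewrite addSn addnC.
    rewrite /c (_ : (2 * k < i.+1)%N = false)//.
    by apply/negbTE; rewrite -leqNgt (leq_trans (ltn_ord i))// mul2n -addnn leq_addr.
  rewrite (addnC k (J + k)) [LHS]big_split_ord/= [X in _ + X]big1 ?addr0 // => i _.
  rewrite /c (_ : ((J + k + i).+1 <= J)%N = false) ?andbF//.
  by apply/negbTE; rewrite -ltnNge ltnS -addnA leq_addr.
have T_le : \sum_(i < J + k) Tcoef i.+1 <= \sum_(i < J + k) S i.+1.
  rewrite /S !big_split/= -sumb -sumc -!big_split/=.
  by apply: ler_sum => i _; exact: Tcoef_le.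
split; first by apply: (le_trans T_le); apply: sumr_le0 => i _; exact: (S_le _).1.
move=> [n0 [n0J pn0]]; apply: (le_lt_trans T_le).
have n0i : (n0.-1 < J + k)%N.
  by case/andP: n0J => a b0; rewrite (leq_trans _ (leq_addr _ _))// prednK.
rewrite (bigD1 (Ordinal n0i))//= -[ltRHS]addr0; apply: ltr_leD.
  by case/andP: n0J => a b0; rewrite prednK//; apply: (S_le _).2; rewrite b0.
by apply: sumr_le0 => i _; exact: (S_le _).1.
Qed.

End Form.

(** * The trial function and the count of zeros *)

(** Fewer linear conditions than unknowns. Unknowns are functions on a finite type and linearity is
    a hypothesis, which suits conditions such as evaluating a trial function at a point. *)
Lemma exists_common_kernel (R : fieldType) (T C : finType) (phi : C -> (T -> R) -> R) :
  (forall c x (a b : T -> R),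
     phi c (fun i => x * a i + b i) = x * phi c a + phi c b) ->
  (#|C| < #|T|)%N ->
  exists a : T -> R, (exists i, a i != 0) /\ forall c, phi c a = 0.
Proof.
move=> lin CT.
pose delta (i : 'I_#|T|) (j : T) : R := (j == enum_val i)%:R.
pose M : 'M[R]_(#|T|, #|C|) := \matrix_(i, c) phi (enum_val c) (delta i).
have : kermx M != 0.
  rewrite -mxrank_eq0 mxrank_ker subn_eq0 -ltnNge.
  exact: leq_ltn_trans (rank_leq_col M) CT.
move=> /rowV0Pn[v /sub_kermxP vM v0].
pose a j := v 0 (enum_rank j).
exists a; split.
  have [i vi] : exists i, v 0 i != 0.
    by apply/existsP; apply: contraNT v0 => /existsPn h; apply/eqP/rowP => i;
      rewrite mxE; apply/eqP; have := h i; rewrite negbK.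
  by exists (enum_val i); rewrite /a enum_valK.
move=> c.
have phi0 : phi c (fun=> 0) = 0.
  have H := lin c 1 (fun=> 0) (fun=> 0).
  have h0 : (fun _ : T => 1 * 0 + 0 : R) = fun=> 0 by apply/funext => i; rewrite mul1r addr0.
  rewrite h0 mul1r in H; apply: (addrI (phi c (fun=> 0))); by rewrite addr0 -H.
have sumE (r : seq 'I_#|T|) :
    phi c (fun j => \sum_(i <- r) v 0 i * delta i j) = \sum_(i <- r) v 0 i * phi c (delta i).
  elim: r => [|i r IH]; first by under eq_fun do rewrite big_nil; rewrite big_nil.
  by under eq_fun do rewrite big_cons; rewrite big_cons lin IH.
have -> : a = fun j => \sum_(i < #|T|) v 0 i * delta i j.
  apply/funext => j; rewrite (bigD1 (enum_rank j))//= /delta enum_rankK eqxx mulr1.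
  rewrite big1 ?addr0// => i ij; case: eqP => [h|_]; last by rewrite mulr0.
  by move: ij; rewrite h enum_valK eqxx.
rewrite sumE.
have /rowP/(_ (enum_rank c)) := vM; rewrite mxE [X in _ = X -> _]mxE => H; rewrite -[RHS]H.
by apply: eq_bigr => i _; rewrite !mxE enum_rankK.
Qed.

Lemma sum_delta (R : pzRingType) (T : finType) (f : T -> R) (i : T) :
  \sum_j f j * (i == j)%:R = f i.
Proof.
rewrite (bigD1 i)//= eqxx mulr1 big1 ?addr0// => j ji.
by rewrite eq_sym (negbTE ji) mulr0.
Qed.

Section TrialCount.
Context {R : realType}.
Variables (m e : R) (k J : nat).
Hypotheses (m0 : 0 < m) (m7 : m < 7) (e0 : 0 < e) (e1 : e < 1) (k0 : (0 < k)%N).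
Hypothesis J3k : (J < 3 * k)%N.
Hypothesis hJ : forall n, (n <= J)%N -> @dcoef R k n <= m * (1 + e ^+ 2 / 16).
Let L : R := 2 * pi * k%:R.
Let s (t : R) : R := 1 + m / (1 + e * cos t).
Variables (X Y : R -> R).
Hypothesis dX : forall t : R, is_derive t 1 X (- s t * Y t).
Hypothesis dY : forall t : R, is_derive t 1 Y (X t).
Hypothesis XY : forall t, Y t = 0 -> X t != 0.

Let pcoef (a : bool * 'I_J -> R) (t : bool) (n : nat) : R :=
  if n is n'.+1 then (if insub n' is Some i then a (t, i) else 0) else 0.
Let I := (bool * 'I_(J + k))%type.
Let E (i : I) := @mode R k i.1 i.2.+1.
Let u (a : bool * 'I_J -> R) (x : R) : R :=
  \sum_(i : I) Ycoef e k J (pcoef a i.1) i.2.+1 * E i x.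

Let oneDe t : 0 < 1 + e * cos t.
Proof. exact: oneDmulcos_gt0. Qed.

(** The free coefficients form a space of dimension 2 J. Vanishing at the points of [Z] and at 0,
    and having no cosine or sine part of frequency 1, where the form degenerates, are size Z + 3
    linear conditions. If these were fewer than 2 J, a nonzero solution would give the form both
    signs. *)
Lemma trial_count (Z : seq R) :
  (forall t, 0 <= t <= L -> Y t = 0 -> t \in Z) -> (2 * J <= size Z + 3)%N.
Proof.
move=> YZ; rewrite leqNgt; apply/negP => sZ.
pose C := option (bool + 'I_(size Z))%type.
pose phi (c : C) (a : bool * 'I_J -> R) : R :=
  match c with
  | None => u a 0
  | Some (inl t) => pcoef a t k
  | Some (inr i) => u a (nth 0 Z i)
  end.
have plin x a b t n : pcoef (fun i => x * a i + b i) t n = x * pcoef a t n + pcoef b t n.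
  by case: n => [|n] /=; [|case: insub => [i|]]; rewrite ?mulr0 ?addr0.
have ulin x a b z : u (fun i => x * a i + b i) z = x * u a z + u b z.
  rewrite /u mulr_sumr -big_split/=; apply: eq_bigr => i _.
  rewrite [in RHS]mulrA -mulrDl; congr (_ * _).
  rewrite /Ycoef /Gcoef !plin.
  by do ![case: ifP => _]; ring.
have [] := @exists_common_kernel R (bool * 'I_J)%type C phi.
- by move=> [[t|i]|] x a b /=; rewrite ?plin ?ulin.
- by rewrite card_option card_sum card_prod card_bool !card_ord; lia.
move=> a [[[t0 i0] a0] aphi].
pose p := pcoef a.
have pJ t n : (J < n)%N -> p t n = 0.
  case: n => [//|n] Jn; rewrite /p /=; case: insubP => [i|//] nJ _.
  by move: Jn; rewrite ltnS leqNgt nJ.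
have pk t : p t k = 0 by exact: (aphi (Some (inl t))).
have p0 : exists n, (0 < n <= J)%N /\ p t0 n != 0.
  by exists i0.+1; split; [rewrite /= ltn_ord | rewrite /p/= valK].
pose M := (J + k)%N.
pose Yc (i : I) := Ycoef e k J (p i.1) i.2.+1.
pose Gc (i : I) := Gcoef e k J (p i.1) i.2.+1.
pose du x := \sum_(i : I) Yc i * @dmode R k i.1 i.2.+1 x.
pose g x := \sum_(i : I) Gc i * E i x.
pose h x := \sum_(i : I) (@dcoef R k i.2.+1 * Yc i) * E i x.
have sum2 (f : bool -> nat -> R) : \sum_(i : I) f i.1 i.2.+1 = \sum_(t : bool) \sum_(n < M) f t n.+1.
  by rewrite pair_bigA.
have K1 (A B : I -> R) : has_integral L (fun x => 1 * ((\sum_i A i * E i x) * (\sum_i B i * E i x)))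
    (pi * k%:R * \sum_i A i * B i).
  rewrite mulr_sumr.
  have -> : \sum_i pi * k%:R * (A i * B i) =
     \sum_i \sum_j A i * B j * (pi * k%:R * (i == j)%:R).
    apply: eq_bigr => i _.
    rewrite -(sum_delta (fun j => pi * k%:R * (A i * B j)) i).
    by apply: eq_bigr => j _; ring.
  apply: has_integral_bilinear => -[t i] [t' j] _ _ /=.
  apply: (@eq_has_integral _ _ (fun x => E (t, i) x * E (t', j) x)) => [x|].
    by rewrite mul1r.
  exact: has_integral_mode.
(* The auxiliary coefficients end at J + k, so the sums over 'I_(J + k) cut off no coupling. *)
have Gout t n : (M < n)%N -> Gcoef e k J (p t) n = 0.
  rewrite /M /Gcoef => nM.
  rewrite ifF; last by lia.
  rewrite ifF; last by lia.
  by case: ifP => // _; rewrite pJ ?mulr0//; lia.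
have K2 : has_integral L (fun x => cos x * (g x * g x))
    (pi * k%:R * \sum_i Gc i * Gcoef e k J (p i.1) (i.2.+1 + k)).
  pose f (i j : I) : R := (i.1 == j.1)%:R * (i.2.+1 + k == j.2.+1)%:R.
  have fE i : \sum_j Gc j * f i j = Gcoef e k J (p i.1) (i.2.+1 + k).
    case: i => t i /=.
    have [iM|Mi] := ltnP (i + k) M; last first.
      rewrite Gout; last by rewrite addSn ltnS.
      rewrite big1// => -[t' j] _; rewrite /f/= -natrM mulnb.
      case: andP => [[_ /eqP h1]|_]; last by rewrite mulr0.
      by have jM := ltn_ord j; rewrite /M in Mi; lia.
    transitivity (Gc (t, Ordinal iM)); last by rewrite /Gc/= addSn.
    rewrite -(sum_delta Gc (t, Ordinal iM)); apply: eq_bigr => -[t' j] _.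
    by rewrite /f -natrM mulnb.
  have -> : pi * k%:R * \sum_i Gc i * Gcoef e k J (p i.1) (i.2.+1 + k) =
    \sum_i \sum_j Gc i * Gc j * (pi * k%:R *
      ((i.1 == j.1)%:R * (1 / 2 * (i.2.+1 + k == j.2.+1)%:R +
        1 / 2 * (i.2.+1 == j.2.+1 + k)%:R))).
    have -> : \sum_i \sum_j Gc i * Gc j * (pi * k%:R *
      ((i.1 == j.1)%:R * (1 / 2 * (i.2.+1 + k == j.2.+1)%:R +
        1 / 2 * (i.2.+1 == j.2.+1 + k)%:R))) =
      \sum_i \sum_j 1 / 2 * (pi * k%:R) * (Gc i * (Gc j * f i j))
      + \sum_i \sum_j 1 / 2 * (pi * k%:R) * (Gc j * (Gc i * f j i)).
      rewrite -big_split/=; apply: eq_bigr => i _; rewrite -big_split/=.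
      apply: eq_bigr => j _; rewrite /f (eq_sym j.1) (eq_sym (j.2.+1 + k)%N).
      by field.
    (* The couplings n to n + k and n + k to n contribute equally; their factors 1 / 2 add up to
       1. *)
    rewrite [X in _ = _ + X]exchange_big/=.
    have -> : \sum_i \sum_j 1 / 2 * (pi * k%:R) * (Gc i * (Gc j * f i j)) =
       1 / 2 * (pi * k%:R) * \sum_i Gc i * Gcoef e k J (p i.1) (i.2.+1 + k) :> R.
      rewrite mulr_sumr; apply: eq_bigr => i _; rewrite -fE !mulr_sumr.
      by apply: eq_bigr.
    by field.
  apply: has_integral_bilinear => -[t i] [t' j] Gi Gj /=; apply: has_integral_cos_mode => //.
  - by rewrite ltnNge; apply: contra Gi => ik; rewrite /Gc /Gcoef/= ik.
  - by rewrite ltnNge; apply: contra Gj => ik; rewrite /Gc /Gcoef/= ik.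
have [P1 [dP1 P1I]] := has_integralD (K1 Yc (fun i => @dcoef R k i.2.+1 * Yc i))
  (has_integralD (has_integralZ 2 (K1 Yc Gc)) (has_integralD (has_integralZ m^-1 (K1 Gc Gc)) (has_integralZ (e / m) K2))).
have neg : P1 L - P1 0 < 0.
  rewrite P1I.
  have -> : pi * k%:R * (\sum_i Yc i * (@dcoef R k i.2.+1 * Yc i)) +
    (2 * (pi * k%:R * (\sum_i Yc i * Gc i)) +
     (m^-1 * (pi * k%:R * (\sum_i Gc i * Gc i)) +
      e / m * (pi * k%:R * (\sum_i Gc i * Gcoef e k J (p i.1) (i.2.+1 + k))))) =
    pi * k%:R * \sum_(i : I) Tcoef m e k J (p i.1) i.2.+1.
    rewrite !mulr_sumr -!big_split/=; apply: eq_bigr => i _; rewrite /Tcoef -/(Yc i) -/(Gc i); ring.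
  rewrite pmulr_rlt0; last by rewrite mulr_gt0 ?pi_gt0 ?ltr0n.
  rewrite (sum2 (fun t n => Tcoef m e k J (p t) n)) (bigD1 t0)//= -[ltRHS]addr0.
  apply: ltr_leD.
    by apply: (form_le0 m0 m7 e0 e1 k0 J3k hJ (@pJ t0) (pk t0)).2.
  by apply: sumr_le0 => t _; apply: (form_le0 m0 m7 e0 e1 k0 J3k hJ (@pJ t) (pk t)).1.
have dsum (F dF : I -> R -> R) (A : I -> R) :
    (forall i (x : R), is_derive x 1 (F i) (dF i x)) -> forall x : R,
    is_derive x 1 (fun x => \sum_i A i * F i x) (\sum_i A i * dF i x).
  move=> H x; elim: (index_enum _) => [|i r IH].
    by rewrite big_nil; under eq_fun do rewrite big_nil; exact: der_cst.
  rewrite big_cons; under eq_fun do rewrite big_cons.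
  apply: der_add => //; apply: is_derive_eq (der_mul (der_cst _ _) (H i x)) _; ring.
have du_ (x : R) : is_derive x 1 (u a) (du x).
  exact: (dsum E (fun i => @dmode R k i.1 i.2.+1) Yc (fun i y => is_derive_mode k0 i.1 i.2.+1 y)).
pose ddu x := \sum_(i : I) Yc i * (- (i.2.+1%:R / k%:R) ^+ 2 * E i x).
have ddu_ (x : R) : is_derive x 1 du (ddu x).
  exact: (dsum (fun i => @dmode R k i.1 i.2.+1) _ Yc (fun i y => is_derive_dmode k0 i.1 i.2.+1 y)).
have hE x : h x = - ddu x - u a x.
  rewrite /h /ddu /u -!sumrN -big_split/=; apply: eq_bigr => i _.
  by rewrite /dcoef -/p -/(Yc i); ring.
pose b1 x := 1 * (u a x * h x) + (2 * (1 * (u a x * g x)) +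
  (m^-1 * (1 * (g x * g x)) + e / m * (cos x * (g x * g x)))).
have {}dP1 (x : R) : is_derive x 1 P1 (b1 x) by exact: dP1.
(* [P1] integrates u (- u'' - u) instead of u'^2 - u^2. The two differ by the derivative of u u',
   which vanishes at both ends because u does. *)
pose b x := du x * du x + u a x * ddu x + b1 x.
pose P x := u a x * du x + P1 x.
have u0 : u a 0 = 0 by exact: (aphi None).
have per : u a L = u a 0.
  by apply: eq_bigr => i _; rewrite /E (mode_period k0 _ _).1.
have : P 0 <= P L.
  apply: (@jacobi_form_ge0 _ s X Y dX dY XY (u a) du P b L Z _ du_) => //.
  - by rewrite /L !mulr_ge0 ?pi_ge0.
  - move=> x; rewrite /P; exact: (der_add (der_mul (du_ x) (ddu_ x)) (dP1 x)).
  - move=> x; rewrite /b /b1.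
    rewrite -subr_ge0 hE /s.
    (* With D = 1 + e cos x, the majorant exceeds u'^2 - s u^2 by exactly m u^2 / D + 2 u g + D g^2
       / m, a complete square. *)
    match goal with |- is_true (0 <= ?r) => have -> : r =
      (m * u a x + (1 + e * cos x) * g x) ^+ 2 / (m * (1 + e * cos x)) end.
      by field; rewrite !gt_eqF.
    by rewrite divr_ge0 ?sqr_ge0// mulr_ge0 ?ltW.
  - move=> t tL Yt; have := YZ t tL Yt; move=> /(nthP 0)[j jZ <-].
    exact: (aphi (Some (inr (Ordinal jZ)))).
  - by rewrite per.
rewrite /P per u0 !mul0r !add0r -subr_ge0 leNgt neg.
by [].
Qed.

End TrialCount.

(** * The bound for the rotation number *)

Lemma rotation_number_gt (R : realType) (beta e rho : R) :
  0 < beta < 1 -> 0 < e < 1 -> euler_rotation_number beta e rho ->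
  Num.sqrt (1 + 7 * beta) < rho - 1.
Proof.
move=> /andP[b0 b1] /andP[e0 e1] [gam [rho0 [[gam0 dgam] [v [eta [v0 [ceta etaE] etalim]]] ->]]].
rewrite addrK.
pose m := 7 * beta.
have m0 : 0 < m by rewrite mulr_gt0.
have m7 : m < 7 by rewrite /m; lra.
pose s (t : R) : R := 1 + m / (1 + e * cos t).
have s0 t : 0 < s t by rewrite /s addr_gt0// divr_gt0// oneDmulcos_gt0.
pose i1 : 'I_2 := lift ord0 ord0.
pose X (t : R) := (gam t *m v) ord0 ord0.
pose Y (t : R) := (gam t *m v) i1 ord0.
have dw (t : R) i : is_derive t 1 (fun t => (gam t *m v) i ord0)
    ((matJ *m matS beta e t *m gam t *m v) i ord0).
  have -> : (fun t => (gam t *m v) i ord0) = fun t => \sum_(j < 2) gam t i j * v j ord0.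
    by apply/funext => y; rewrite mxE.
  rewrite mxE; apply: der_sum => j.
  apply: is_derive_eq (der_mul ((der_mxP _ _ _).1 (dgam t) i j) (der_cst _ _)) _; ring.
have JS t : matJ *m matS beta e t = \matrix_(i < 2, j < 2)
     (nth [::] [:: [:: 0; - s t]; [:: 1; 0]] i)`_j.
  apply/matrixP => i j; rewrite !mxE !big_ord_recl big_ord0 !mxE /=.
  by case: i => -[|[|//]] hi; case: j => -[|[|//]] hj /=; rewrite /s /m; ring.
have dX (t : R) : is_derive t 1 X (- s t * Y t).
  apply: is_derive_eq (dw t ord0) _.
  rewrite -mulmxA JS mxE !big_ord_recl big_ord0 !mxE /=.
  by rewrite /Y/i1 mul0r add0r addr0 !mxE.
have dY (t : R) : is_derive t 1 Y (X t).
  apply: is_derive_eq (dw t i1) _.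
  rewrite -mulmxA JS mxE !big_ord_recl big_ord0 !mxE /=.
  by rewrite /X mul1r mul0r !addr0 mxE.
have argE t : exists2 r : R, 0 < r & X t = r * cos (eta t) /\ Y t = r * sin (eta t).
  have [r r0 E] := etaE t; exists r => //.
  by rewrite /X /Y E !mxE.
have XY t : Y t = 0 -> X t != 0.
  have [r r0 [-> ->]] := argE t.
  move=> /eqP; rewrite mulf_eq0 gt_eqF//= => /eqP s_0.
  apply: mulf_neq0; [by rewrite gt_eqF|apply/eqP => c_0].
  by have := cos2Dsin2 (eta t); rewrite s_0 c_0; lra.
(* The square of the limiting frequency J / k. It is below 1 + 7 * 17 / 16 < 9, whence J < 3 k. *)
pose q := 1 + m * (1 + e ^+ 2 / 16).
pose a := Num.sqrt q.
have /andP[e2 e2'] : 0 < e ^+ 2 <= 1 by rewrite exprn_gt0// exprn_ile1 ?ltW.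
have q0 : 0 < q by rewrite /q ltr_pwDl// mulr_ge0 ?(ltW m0)//; lra.
have aq : a ^+ 2 = q by rewrite sqr_sqrtr ?ltW.
have a0 : 0 <= a by exact: sqrtr_ge0.
have q9 : q < 9.
  have : m * (1 + e ^+ 2 / 16) <= m * (17 / 16) by apply: ler_wpM2l; [exact: ltW|lra].
  by rewrite /q => h; lra.
have a3 : a < 3.
  have -> : 3 = Num.sqrt (3 ^+ 2) :> R by rewrite sqrtr_sqr ger0_norm.
  by rewrite ltr_sqrt// (lt_le_trans q9)//; lra.
apply: (@lt_le_trans _ _ a).
  rewrite ltr_sqrt//.
  have : 0 < m * (e ^+ 2 / 16) by rewrite mulr_gt0//; lra.
  by rewrite /q /m => h; lra.
(* The loss 6 pi is independent of k: 3 pi from the linear conditions besides the zeros, 2 pi from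
   truncating a k to the integer J, and pi from [argument_zeros]. *)
have key k : (0 < k)%N -> 2 * a * pi * k%:R - 6 * pi + eta 0 <= eta (2 * pi * k%:R).
  move=> k0; have kR : 0 < k%:R :> R by rewrite ltr0n.
  have L0 : 0 < 2 * pi * k%:R :> R by rewrite !mulr_gt0 ?pi_gt0.
  have [Z [sZ YZ]] := argument_zeros s0 dX dY ceta argE L0.
  pose J := Num.truncn (a * k%:R).
  have ak0 : 0 <= a * k%:R by rewrite mulr_ge0// ltW.
  have /andP[J1 J2] := truncn_itv ak0.
  have J3k : (J < 3 * k)%N.
    by rewrite -(ltr_nat R) natrM (le_lt_trans J1)// ltr_pM2r.
  have hJ n : (n <= J)%N -> dcoef k n <= m * (1 + e ^+ 2 / 16).
    move=> nJ; rewrite /dcoef lerBlDr addrC -/q -aq.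
    rewrite ler_pXn2r ?nnegrE ?divr_ge0// ler_pdivrMr//.
    by rewrite (le_trans _ J1)// ler_nat.
  have := trial_count m0 m7 e0 e1 k0 J3k hJ dX dY XY YZ.
  rewrite -(ler_nat R) natrM natrD => h.
  have p0 := pi_gt0 R.
  rewrite -/J -natr1 in J2.
  have h2 : 2 * (a * k%:R - 1) * pi <= ((size Z)%:R + 3) * pi.
    by rewrite ler_wpM2r ?(ltW p0)//; lra.
  by lra.
rewrite leNgt; apply/negP => ra.
pose d := (a - rho0) / 2.
have d0 : 0 < d by rewrite divr_gt0 ?subr_gt0.
have : \forall k \near \oo, eta (2 * pi * k%:R) / (2 * pi * k%:R) < rho0 + d.
  by move: etalim => /cvgr_lt; apply; rewrite ltrDl.
move=> [N _ HN].
(* For k > C the bounded loss, divided by 2 pi k, is less than d, half the supposed gap between rho0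
   and a. *)
pose C := (6 * pi - eta 0) / (2 * pi * d).
pose k := (maxn N (Num.truncn C).+1).
have k0 : (0 < k)%N by rewrite leq_max orbT.
have kR : 0 < k%:R :> R by rewrite ltr0n.
have kC : C < k%:R.
  by rewrite (lt_le_trans (truncnS_gt C))// ler_nat leq_max leqnn orbT.
have := HN k; rewrite /= leq_max leqnn => /(_ isT).
have p0 := pi_gt0 R.
rewrite ltr_pdivrMr; last by rewrite !mulr_gt0.
have := key k k0.
move: kC; rewrite /C ltr_pdivrMr; last by rewrite mulr_gt0// mulr_gt0.
have -> : k%:R * (2 * pi * d) = pi * k%:R * (a - rho0) by rewrite /d; field.
have -> : (rho0 + d) * (2 * pi * k%:R) = pi * k%:R * (rho0 + a) by rewrite /d; field.
have -> : 2 * a * pi * k%:R = 2 * (pi * k%:R * a) by ring.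
rewrite mulrBr mulrDr => h1 h2 h3; lra.
Qed.

(** * A primitive in the eccentric anomaly *)

Section KeplerPrimitive.
Context {R : realType}.

Definition ecc (b : R) := 2 * b / (1 + b ^+ 2).

(* For the eccentricity [ecc b] the true anomaly at the eccentric anomaly [t] is
   [t + 2 atan (b sin t / (1 - b cos t))]. *)
Definition kprim (b t : R) : R := t + ecc b * sin t
  - (1 - b ^+ 2) / (1 + b ^+ 2) * (t + 2 * atan (b * sin t / (1 - b * cos t))).

Lemma oneBmulcos_gt0 (b t : R) : 0 <= b -> b < 1 -> 0 < 1 - b * cos t.
Proof.
move=> b0 b1; have h1 := cos_le1 t.
have h : 0 <= b * (1 - cos t) by apply: mulr_ge0; lra.
by rewrite mulrBr mulr1 in h; lra.
Qed.

Lemma der_kprim (b t : R) : 0 <= b -> b < 1 ->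
  is_derive t 1 (kprim b) (ecc b ^+ 2 * sin t ^+ 2 / (1 - ecc b * cos t)).
Proof.
move=> b0 b1; have h := oneBmulcos_gt0 t b0 b1.
have b2 : 0 < 1 + b ^+ 2 by rewrite ltr_pwDl// sqr_ge0.
have h3 : 0 < (1 - b * cos t) ^+ 2 + (b * sin t) ^+ 2.
  by rewrite ltr_pwDl ?sqr_ge0// exprn_gt0.
(* This is |1 - b exp (i t)|^2, equal to (1 + b^2) (1 - ecc b cos t); the arctangent is minus the
   argument of 1 - b exp (i t). *)
have E3 : (1 - b * cos t) ^+ 2 + (b * sin t) ^+ 2 = 1 + b ^+ 2 - 2 * b * cos t.
  by rewrite exprMn sin2cos2; ring.
have h4 : 1 + b ^+ 2 - 2 * b * cos t != 0 by rewrite -E3 gt_eqF.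
have D : is_derive t 1 (kprim b) (1 + ecc b * cos t - (1 - b ^+ 2) / (1 + b ^+ 2) *
   (1 + 2 * ((b * cos t - b ^+ 2) / (1 + b ^+ 2 - 2 * b * cos t)))).
  rewrite /kprim; der; first by rewrite gt_eqF.
  have -> : (1 + (b * sin t / (1 - b * cos t)) ^+ 2)^-1 =
    (1 - b * cos t) ^+ 2 / (1 + b ^+ 2 - 2 * b * cos t).
    rewrite -E3; field; rewrite ?gt_eqF//.
  have -> : b * cos t - b ^+ 2 = b * cos t - b ^+ 2 * (cos t ^+ 2 + sin t ^+ 2).
    by rewrite cos2Dsin2; ring.
  by field; rewrite h4 !gt_eqF.
apply: is_derive_eq D _; rewrite sin2cos2 /ecc; field.
by rewrite ?h4 !gt_eqF//=.
Qed.

Lemma kprim_period (b t : R) :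
  kprim b (t + 2 * pi) - kprim b t = 2 * pi * (1 - (1 - b ^+ 2) / (1 + b ^+ 2)).
Proof.
have h : 2 * pi = pi *+ 2 :> R by rewrite mulr_natl.
by rewrite /kprim h sinD2pi cosD2pi; ring.
Qed.

Lemma kprim_half (b : R) :
  kprim b pi - kprim b 0 = pi * (1 - (1 - b ^+ 2) / (1 + b ^+ 2)).
Proof. by rewrite /kprim sinpi sin0 !mulr0 !mul0r atan0; ring. Qed.

End KeplerPrimitive.

(** * Stokes' theorem for a contact form along a parametrized surface *)

Section C2.
Context {R : realType}.
Implicit Types (f g : R -> R -> R).

Definition ucont f := continuous (fun p : R * R => f p.1 p.2).

(** One function [fst] serves as mixed derivative in both orders. Only it occurs when the two
    components of a pulled-back 1-form are differentiated crosswise. *)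
Record c2 f fs ft fst : Prop := C2 {
  c2_s : forall s t : R, is_derive s 1 (f ^~ t) (fs s t) ;
  c2_t : forall s t : R, is_derive t 1 (f s) (ft s t) ;
  c2_ts : forall s t : R, is_derive s 1 (ft ^~ t) (fst s t) ;
  c2_st : forall s t : R, is_derive t 1 (fs s) (fst s t) ;
  c2_cont : [/\ ucont f, ucont fs, ucont ft & ucont fst] }.

Lemma c2_quot f fs ft fst g gs gt gst : c2 f fs ft fst -> c2 g gs gt gst ->
  (forall s t, g s t != 0) ->
  c2 (fun s t => f s t / g s t) (fun s t => fs s t / g s t - f s t * gs s t / g s t ^+ 2)
   (fun s t => ft s t / g s t - f s t * gt s t / g s t ^+ 2)
   (fun s t => fst s t / g s t - fs s t * gt s t / g s t ^+ 2 - ft s t * gs s t / g s t ^+ 2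
     - f s t * gst s t / g s t ^+ 2 + 2 * f s t * gs s t * gt s t / g s t ^+ 3).
Proof.
move=> [f1 f2 f3 f4 [cf cfs cft cfst]] [g1 g2 g3 g4 [cg cgs cgt cgst]] g0.
split.
- move=> s t; have [a1 a2] := (f1 s t, g1 s t); der => //; field; exact: g0.
- move=> s t; have [a1 a2] := (f2 s t, g2 s t); der => //; field; exact: g0.
- move=> s t; have [[a1 a2] [a3 a4]] := ((f1 s t, g1 s t), (f3 s t, g3 s t)).
  der; rewrite ?expf_neq0//; field; exact: g0.
- move=> s t; have [[a1 a2] [a3 a4]] := ((f2 s t, g2 s t), (f4 s t, g4 s t)).
  der; rewrite ?expf_neq0//; field; exact: g0.
have ci : ucont (fun s t => (g s t)^-1) by move=> p; exact: cont_inv (g0 _ _) (cg p).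
have ci2 : ucont (fun s t => (g s t ^+ 2)^-1).
  by move=> p; apply: cont_inv (cont_exp (n:=2) (cg p)); rewrite expf_neq0.
have ci3 : ucont (fun s t => (g s t ^+ 3)^-1).
  by move=> p; apply: cont_inv (cont_exp (n:=3) (cg p)); rewrite expf_neq0.
have cM h k : ucont h -> ucont k -> ucont (fun s t => h s t * k s t).
  by move=> ch ck p; exact: cont_mul (ch p) (ck p).
have cB h k : ucont h -> ucont k -> ucont (fun s t => h s t - k s t).
  by move=> ch ck p; exact: cont_add (ch p) (cont_opp (ck p)).
have cA h k : ucont h -> ucont k -> ucont (fun s t => h s t + k s t).
  by move=> ch ck p; exact: cont_add (ch p) (ck p).
have cC (a : R) : ucont (fun _ _ => a) by move=> p; exact: cont_cst.
split.
- exact: cM.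
- by apply: cB; [exact: cM|exact: (cM _ _ (cM _ _ cf cgs) ci2)].
- by apply: cB; [exact: cM|exact: (cM _ _ (cM _ _ cf cgt) ci2)].
- apply: cA; last exact: (cM _ _ (cM _ _ (cM _ _ (cM _ _ (cC 2) cf) cgs) cgt) ci3).
  apply: (cB); last exact: (cM _ _ (cM _ _ cf cgst) ci2).
  apply: (cB); last exact: (cM _ _ (cM _ _ cft cgs) ci2).
  apply: (cB); last exact: (cM _ _ (cM _ _ cfs cgt) ci2).
  exact: cM.
Qed.

End C2.

Section Pullback.
Context {R : realType}.
Notation mu := (@lebesgue_measure R).

Lemma der_ev (t : R) (a b : R -> 'rV[R]_4) a' b' :
  is_derive t 1 a a' -> is_derive t 1 b b' ->
  is_derive t 1 (fun s => ev (a s) (b s)) (ev a' (b t) + ev (a t) b').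
Proof.
move=> /der_coord[a1 a2 a3 a4] /der_coord[b1' b2 b3 b4].
under [X in is_derive _ _ X _]eq_fun do rewrite evE.
by rewrite !evE; der; ring.
Qed.

Lemma cont_ev (T : topologicalType) (x : T) (a b : T -> 'rV[R]_4) :
  {for x, continuous a} -> {for x, continuous b} ->
  {for x, continuous (fun s => ev (a s) (b s))}.
Proof.
move=> ca cb; under [X in {for _, continuous X}]eq_fun do rewrite evE.
have [a1 a2 a3 a4] := cont_coords ca; have [b1 b2 b3 b4] := cont_coords cb.
exact (cont_add (cont_add (cont_add (cont_mul a1 b1) (cont_mul a2 b2)) (cont_mul a3 b3))
  (cont_mul a4 b4)).
Qed.

Section Stokes.
Variable lam : 'rV[R]_4 -> 'rV[R]_4.
Hypothesis dlam : forall x, differentiable lam x.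
Hypothesis clam : forall u, continuous ('D_u lam).

Lemma cont_derive (T : topologicalType) (x : T) (g : T -> 'rV[R]_4) (a b c d : T -> R) :
  {for x, continuous g} -> {for x, continuous a} -> {for x, continuous b} ->
  {for x, continuous c} -> {for x, continuous d} ->
  {for x, continuous (fun s => 'D_(phase (a s) (b s) (c s) (d s)) lam (g s))}.
Proof.
move=> cg ca cb cc cd.
rewrite (_ : (fun s => _) = (fun s => a s *: 'D_(phase 1 0 0 0) lam (g s)
   + b s *: 'D_(phase 0 1 0 0) lam (g s)
   + c s *: 'D_(phase 0 0 1 0) lam (g s) + d s *: 'D_(phase 0 0 0 1) lam (g s))); last first.
  by apply/funext => s; rewrite deriveD_lin.
have H (f : T -> R) (u : 'rV[R]_4) : {for x, continuous f} -> f s *: 'D_u lam (g s) @[s --> x] --> f x *: 'D_u lam (g x).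
  move=> cf; apply: cvgZ => //.
  exact: (continuous_comp cg (@clam u (g x))).
exact: (cvgD (cvgD (cvgD (H _ _ ca) (H _ _ cb)) (H _ _ cc)) (H _ _ cd)).
Qed.

(** [A] and [B] are the components of the pullback of lambda - theta, theta = p_r dr + p_z dz. Their
    cross derivatives share the terms with the mixed derivative of the map, so they agree as soon as
    d lambda = [omega] on the two velocities; one derivative of [lam] suffices. *)
Lemma pullback_stokes (p ps pt pst y ys yt yst r rs rt rst z zs zt zst : R -> R -> R)
    (a b c d : R) : a < b -> c < d ->
  c2 p ps pt pst -> c2 y ys yt yst -> c2 r rs rt rst -> c2 z zs zt zst ->
  let G s t := phase (p s t) (y s t) (r s t) (z s t) in
  let Gs s t := phase (ps s t) (ys s t) (rs s t) (zs s t) in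
  let Gt s t := phase (pt s t) (yt s t) (rt s t) (zt s t) in
  (forall s t, ext_deriv lam (G s t) (Gs s t) (Gt s t) = omega (Gs s t) (Gt s t)) ->
  let A s t := ev (lam (G s t)) (Gt s t) - (p s t * rt s t + y s t * zt s t) in
  let B s t := ev (lam (G s t)) (Gs s t) - (p s t * rs s t + y s t * zs s t) in
  (\int[mu]_(t in `[c, d]) (A b t - A a t)%:E =
   \int[mu]_(s in `[a, b]) (B s d - B s c)%:E)%E.
Proof.
move=> ab cd [p1 p2 p3 p4 [cp cps cpt cpst]] [y1 y2 y3 y4 [cy cys cyt cyst]]
  [r1 r2 r3 r4 [cr crs crt crst]] [z1 z2 z3 z4 [cz czs czt czst]] G Gs Gt closed A B.
pose Gst s t := phase (pst s t) (yst s t) (rst s t) (zst s t).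
pose H s t := ev ('D_(Gs s t) lam (G s t)) (Gt s t) + ev (lam (G s t)) (Gst s t)
  - ((ps s t * rt s t + p s t * rst s t) + (ys s t * zt s t + y s t * zst s t)).
apply: (@rect_stokes _ A B H a b c d) => //.
- move=> s t; have e1 : is_derive s 1 (G ^~ t) (Gs s t) by exact: der_phase.
  have e2 : is_derive s 1 (Gt ^~ t) (Gst s t) by exact: der_phase.
  have e3 := der_ev (der_chain (dlam _) e1) e2.
  have [[d1 d2] [d3 d4]] := ((p1 s t, r3 s t), (y1 s t, z3 s t)).
  by rewrite /A; der; rewrite /H; ring.
- move=> s t; have e1 : is_derive t 1 (G s) (Gt s t) by exact: der_phase.
  have e2 : is_derive t 1 (Gs s) (Gst s t) by exact: der_phase.
  have e3 := der_ev (der_chain (dlam _) e1) e2.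
  have [[d1 d2] [d3 d4]] := ((p2 s t, r4 s t), (y2 s t, z4 s t)).
  rewrite /B; der; rewrite /H.
  have := closed s t; rewrite /ext_deriv /omega !phaseK => /eqP.
  by rewrite subr_eq => /eqP ->; ring.
- move=> q.
  have cG : {for q, continuous (fun q : R * R => G q.1 q.2)}.
    by apply: cont_phase; [exact: cp|exact: cy|exact: cr|exact: cz].
  have cGt : {for q, continuous (fun q : R * R => Gt q.1 q.2)}.
    by apply: cont_phase; [exact: cpt|exact: cyt|exact: crt|exact: czt].
  have cGst : {for q, continuous (fun q : R * R => Gst q.1 q.2)}.
    by apply: cont_phase; [exact: cpst|exact: cyst|exact: crst|exact: czst].
  have clG : {for q, continuous (fun q : R * R => lam (G q.1 q.2))}.
    exact: (continuous_comp cG (differentiable_continuous (dlam _))).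
  have cDl : {for q, continuous (fun q : R * R => 'D_(Gs q.1 q.2) lam (G q.1 q.2))}.
    exact: (cont_derive cG (cps q) (cys q) (crs q) (czs q)).
  exact: (cont_add (cont_add (cont_ev cDl cGt) (cont_ev clG cGst))
    (cont_opp (cont_add (cont_add (cont_mul (cps q) (crt q)) (cont_mul (cp q) (crst q)))
                        (cont_add (cont_mul (cys q) (czt q)) (cont_mul (cy q) (czst q)))))).
Qed.

End Stokes.
End Pullback.

(** * A disk in the energy surface spanning the Euler orbit *)

Section Disk.
Context {R : realType}.
Notation mu := (@lebesgue_measure R).
Variables (beta e : R).
Hypotheses (b0 : 0 < beta) (b1 : beta < 1) (e0 : 0 < e) (e1 : e < 1).

Definition euler_curve (t : R) : 'rV[R]_4 :=
  phase (Num.sqrt 2 * e * sin t / (1 - e * cos t)) 0 ((1 - e * cos t) / (2 * beta)) 0.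

Definition deuler_curve (t : R) : 'rV[R]_4 :=
  phase (Num.sqrt 2 * e * cos t / (1 - e * cos t)
    - Num.sqrt 2 * e * sin t * (e * sin t) / (1 - e * cos t) ^+ 2) 0 (e * sin t / (2 * beta)) 0.

(** x stands for 2 beta r. In the slice z = 0 the energy equation is the sphere (1 - x)^2 + (p_r
    x)^2 / 2 + (p_z x)^2 / 2 = e^2, with spherical coordinates s and t. Its pole s = 0 lies on the
    p_z axis, its equator s = pi / 2 is the Euler orbit, and the disk is the hemisphere p_z >= 0. *)
Let x (s t : R) : R := 1 - e * cos t * sin s.

Let x_gt0 s t : 0 < x s t.
Proof.
have [h0 h1] := (e0, e1).
have h : `|cos t * sin s| <= 1.
  by rewrite normrM mulr_ile1// ?cos_max ?sin_max.
move: h; rewrite ler_norml => /andP[_ h].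
have : 0 <= e * (1 - cos t * sin s) by apply: mulr_ge0; lra.
by rewrite /x mulrBr mulr1 mulrA => ?; lra.
Qed.

Let c2x : c2 x (fun s t => - (e * cos t * cos s)) (fun s t => e * sin t * sin s)
  (fun s t => e * sin t * cos s).
Proof.
split; [move=> s t; rewrite /x; der; ring..|].
by split=> p; rewrite /x; cont.
Qed.

Let c2r : c2 (fun s t => x s t / (2 * beta)) (fun s t => - (e * cos t * cos s) / (2 * beta))
  (fun s t => e * sin t * sin s / (2 * beta)) (fun s t => e * sin t * cos s / (2 * beta)).
Proof.
split; [move=> s t; rewrite /x; der; ring..|].
by split=> p; rewrite /x; cont.
Qed.

Let c2P : c2 (fun s t => Num.sqrt 2 * e * sin t * sin s) (fun s t => Num.sqrt 2 * e * sin t * cos s)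
  (fun s t => Num.sqrt 2 * e * cos t * sin s) (fun s t => Num.sqrt 2 * e * cos t * cos s).
Proof.
split; [move=> s t; der; ring..|].
by split=> p; cont.
Qed.

Let c2Z : c2 (fun s t : R => Num.sqrt 2 * e * cos s) (fun s t => - (Num.sqrt 2 * e * sin s))
  (fun s t => 0) (fun s t => 0).
Proof.
split; [move=> s t; der; ring..|].
by split=> p; cont.
Qed.

Let c20 : c2 (fun s t : R => 0 : R) (fun s t => 0) (fun s t => 0) (fun s t => 0).
Proof.
split; [move=> s t; der; ring..|].
by split=> p; cont.
Qed.

Lemma disk_energy s t : energy_surface beta e
  (phase (Num.sqrt 2 * e * sin t * sin s / x s t) (Num.sqrt 2 * e * cos s / x s t)
     (x s t / (2 * beta)) 0).
Proof.
have b2 : 0 < 2 * beta by rewrite mulr_gt0.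
have r0 : 0 < x s t / (2 * beta) by rewrite divr_gt0 ?x_gt0.
split; rewrite /= ?phaseK//.
rewrite /Ham /hamiltonian !phaseK -/(Pot beta e _ _) PotE//.
have -> : dist beta (x s t / (2 * beta)) 0 = x s t / (2 * beta).
  by rewrite /dist expr0n mulr0 addr0 sqrtr_sqr ger0_norm// ltW.
rewrite /wcoef /ccoef.
have s2 : Num.sqrt 2 ^+ 2 = 2 :> R by rewrite sqr_sqrtr.
have E : (Num.sqrt 2 * e * sin t * sin s / x s t) ^+ 2 + (Num.sqrt 2 * e * cos s / x s t) ^+ 2 =
  2 * e ^+ 2 * (sin t ^+ 2 * sin s ^+ 2 + cos s ^+ 2) / x s t ^+ 2.
  have x0 : x s t != 0 by rewrite gt_eqF.
  rewrite -{3}s2; field; exact: x0.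
rewrite E.
have F : e ^+ 2 * (sin t ^+ 2 * sin s ^+ 2 + cos s ^+ 2) = e ^+ 2 - (1 - x s t) ^+ 2.
  by rewrite /x sin2cos2 (cos2sin2 s); ring.
rewrite -(mulrA 2) F; field.
by rewrite !gt_eqF.
Qed.

Let disk s t := phase (Num.sqrt 2 * e * sin t * sin s / x s t) (Num.sqrt 2 * e * cos s / x s t)
     (x s t / (2 * beta)) 0.

Lemma tangent_curve (g : R -> 'rV[R]_4) g' (t : R) :
  (forall s, energy_surface beta e (g s)) -> is_derive t 1 g g' -> tangent beta e (g t) g'.
Proof.
move=> gE dg; have [r0 _] := gE t.
have [_ D] := der_Ham b0 b1 e0 e1 r0 dg.
rewrite /tangent/= derive_Ham// -D.
have -> : (fun s => Ham beta e (g s)) = fun=> -1 by apply/funext => s; have [_ ->] := gE s.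
exact: derive_cst.
Qed.

(** lambda - theta is closed on the disk, so its integral over the boundary vanishes; the subtracted
    term is theta on the velocity, p_r dr/dt. The free starting angle [t0] accommodates
    parametrizations that begin anywhere on the orbit. *)
Lemma euler_stokes (lam : 'rV[R]_4 -> 'rV[R]_4) (t0 : R) : is_contact_form beta e lam ->
  (\int[mu]_(t in `[t0, (t0 + 2 * pi)%R]) (ev (lam (euler_curve t)) (deuler_curve t)
     - e ^+ 2 * sin t ^+ 2 / (1 - e * cos t) / (Num.sqrt 2 * beta))%:E = 0)%E.
Proof.
move=> [dlam clam _ prim _].
have x0 s t : x s t != 0 by rewrite gt_eqF.
have s2 : Num.sqrt 2 ^+ 2 = 2 :> R by rewrite sqr_sqrtr.
have s20 : Num.sqrt 2 != 0 :> R by rewrite gt_eqF// sqrtr_gt0.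
have p0 := pi_gt0 R.
have ab : 0 < pi / 2 :> R by rewrite divr_gt0.
have cd : t0 < t0 + 2 * pi by rewrite ltrDl mulr_gt0.
have cP := c2_quot c2P c2x x0.
have cZ := c2_quot c2Z c2x x0.
have := @pullback_stokes R lam dlam clam _ _ _ _ _ _ _ _ _ _ _ _ _ _ _ _ 0 (pi / 2) t0 (t0 + 2 * pi)
  ab cd cP cZ c2r c20.
move=> /= H.
have {}H := H _; have E2 s t : energy_surface beta e (disk s t) by exact: disk_energy.
have {}H := H (fun s t => prim _ _ _ (E2 s t)
  (tangent_curve (fun s => E2 s t) (der_phase (c2_s cP s t) (c2_s cZ s t) (c2_s c2r s t) (c2_s c20 s t)))
  (tangent_curve (E2 s) (der_phase (c2_t cP s t) (c2_t cZ s t) (c2_t c2r s t) (c2_t c20 s t)))).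
move: H.
have sc t : sin (t + 2 * pi) = sin t /\ cos (t + 2 * pi) = cos t :> R.
  have -> : 2 * pi = pi *+ 2 :> R by rewrite mulr_natl.
  by rewrite sinD2pi cosD2pi.
have [st ct] := sc t0.
(* The sides t = t0 and t = t0 + 2 pi of the rectangle have the same image and cancel. *)
under [X in _ = X -> _]eq_integral do rewrite /x st ct subrr.
rewrite integral0 => <-; apply: eq_integral => t _; congr EFin.
(* The side s = 0 collapses to the pole: its velocity is zero. *)
have -> : phase (Num.sqrt 2 * e * cos t * sin 0 / x 0 t -
   Num.sqrt 2 * e * sin t * sin 0 * (e * sin t * sin 0) / x 0 t ^+ 2)
   (0 / x 0 t - Num.sqrt 2 * e * cos 0 * (e * sin t * sin 0) / x 0 t ^+ 2)
   (e * sin t * sin 0 / (2 * beta)) 0 = phase 0 0 0 0 :> 'rV[R]_4.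
  by rewrite sin0; congr phase; ring.
have pe : sin (pi / 2) = 1 :> R by exact: sin_pihalf.
have ce : cos (pi / 2) = 0 :> R by exact: cos_pihalf.
rewrite sin0 pe ce.
have xe : x (pi / 2) t = 1 - e * cos t by rewrite /x pe mulr1.
have xn : 1 - e * cos t != 0 by rewrite -xe.
rewrite !xe.
have -> : phase (Num.sqrt 2 * e * sin t * 1 / (1 - e * cos t)) (Num.sqrt 2 * e * 0 / (1 - e * cos t))
  ((1 - e * cos t) / (2 * beta)) 0 = euler_curve t.
  by rewrite /euler_curve mulr1 mulr0 mul0r.
set D := phase (_ - _) _ _ _.
have -> : D = deuler_curve t.
  by rewrite /D /deuler_curve; congr phase; ring.
have ev0 y : ev (lam y) (phase 0 0 0 0) = 0 by rewrite evE !phaseK !mulr0 !addr0.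
have i2 : (Num.sqrt 2)^-1 = Num.sqrt 2 / 2 :> R.
  by rewrite -[X in _ / X]s2; field.
rewrite ev0 (invfM (Num.sqrt 2) beta) i2; field.
by rewrite xn x0 gt_eqF.
Qed.

End Disk.

(** * Angular lifts of curves on the unit circle *)

Section Lift.
Context {R : realType}.
Notation mu := (@lebesgue_measure R).

(** The primitive is the integral from [a], hence the restriction to t > a. Choosing [a] left of the
    interval of interest makes the derivative two-sided at its left end. *)
Lemma primitive_right (f : R -> R) (a : R) : continuous f ->
  exists F : R -> R, forall t : R, a < t -> is_derive t 1 F (f t).
Proof.
move=> cf; exists (fun x => (\int[mu]_(t in [set` `[a, x]]) (f t))) => t at_.
have tu : t < t + 1 by rewrite ltrDl.
have int : mu.-integrable `[a, t + 1] (EFin \o f).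
  apply: continuous_compact_integrable; first exact: segment_compact.
  by apply: continuous_subspaceT.
have [d e] := continuous_FTC1_closed tu int at_ (cf t).
by rewrite -e derive1E; exact: derivableP.
Qed.

Lemma unit_circle_angle (C S : R) : C ^+ 2 + S ^+ 2 = 1 ->
  exists phi, C = cos phi /\ S = sin phi.
Proof.
move=> CS; have C1 : -1 <= C <= 1.
  have h : C ^+ 2 <= 1 by rewrite -CS lerDl sqr_ge0.
  by rewrite -ler_norml -(ler_pXn2r (n:=2)) ?nnegrE// -normrX ger0_norm ?sqr_ge0// expr1n.
have cC : cos (acos C) = C by apply: acosK; rewrite in_itv.
have sC : sin (acos C) = Num.sqrt (S ^+ 2) by rewrite sin_acos// -CS addrC addKr.
have [S0|S0] := leP 0 S.
  by exists (acos C); rewrite cC sC sqrtr_sqr ger0_norm.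
by exists (- acos C); rewrite cosN sinN cC sC sqrtr_sqr ltr0_norm// opprK.
Qed.

Lemma der0_const (f : R -> R) (a b : R) : a <= b ->
  (forall t : R, a <= t <= b -> is_derive t 1 f 0) -> f a = f b.
Proof.
rewrite le_eqVlt => /orP[/eqP -> //|ab] df.
have [t _ E] : exists2 c, c \in `]a, b[ & f b - f a = 0 * (b - a).
  apply: (@MVT _ f (fun=> 0) a b ab).
  - by move=> x; rewrite in_itv/= => /andP[ax xb]; apply: df; rewrite !ltW.
  - apply: continuous_in_subspaceT => x; rewrite inE/= in_itv/= => xab.
    exact: der_cont (df x xab).
by apply/esym/eqP; rewrite -subr_eq0 E mul0r.
Qed.

(** [tau] integrates the angular speed, starting from an argument of (C 0, S 0). The scalar product
    and the determinant of (C, S) and (cos tau, sin tau) have derivative zero, so they keep their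
    initial values 1 and 0. *)
Lemma circle_lift (C S theta : R -> R) :
  continuous theta ->
  (forall t : R, is_derive t 1 C (- theta t * S t)) ->
  (forall t : R, is_derive t 1 S (theta t * C t)) ->
  (forall t, C t ^+ 2 + S t ^+ 2 = 1) ->
  exists tau : R -> R, (forall t : R, -1 < t -> is_derive t 1 tau (theta t)) /\
    forall t, 0 <= t -> C t = cos (tau t) /\ S t = sin (tau t).
Proof.
move=> ct dC dS CS; have [Th dTh] := primitive_right (-1) ct.
have [phi [c0 s0]] := unit_circle_angle (CS 0).
pose tau t := Th t - Th 0 + phi.
have dtau (t : R) : -1 < t -> is_derive t 1 tau (theta t).
  by move=> t1; have d1 := dTh t t1; rewrite /tau; der; ring.
exists tau; split=> // t t0.
have tau0 : tau 0 = phi by rewrite /tau; ring.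
have E1 : C 0 * cos (tau 0) + S 0 * sin (tau 0) = C t * cos (tau t) + S t * sin (tau t).
  apply: (@der0_const (fun t => C t * cos (tau t) + S t * sin (tau t))) => // s /andP[s0' st].
  have d1 : is_derive s 1 tau (theta s) by apply: dtau; rewrite (lt_le_trans _ s0')// ltrN10.
  by der; ring.
have E2 : S 0 * cos (tau 0) - C 0 * sin (tau 0) = S t * cos (tau t) - C t * sin (tau t).
  apply: (@der0_const (fun t => S t * cos (tau t) - C t * sin (tau t))) => // s /andP[s0' st].
  have d1 : is_derive s 1 tau (theta s) by apply: dtau; rewrite (lt_le_trans _ s0')// ltrN10.
  by der; ring.
rewrite tau0 c0 s0 -!expr2 cos2Dsin2 in E1.
rewrite tau0 c0 s0 (mulrC (cos phi)) subrr in E2.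
have cs := cos2Dsin2 (tau t).
split.
- transitivity (C t * (cos (tau t) ^+ 2 + sin (tau t) ^+ 2)); first by rewrite cs mulr1.
  transitivity (cos (tau t) * (C t * cos (tau t) + S t * sin (tau t)) -
    sin (tau t) * (S t * cos (tau t) - C t * sin (tau t))); first by ring.
  by rewrite -E1 -E2; ring.
- transitivity (S t * (cos (tau t) ^+ 2 + sin (tau t) ^+ 2)); first by rewrite cs mulr1.
  transitivity (sin (tau t) * (C t * cos (tau t) + S t * sin (tau t)) +
    cos (tau t) * (S t * cos (tau t) - C t * sin (tau t))); first by ring.
  by rewrite -E1 -E2; ring.
Qed.

(* The winding number is 1 since the curve is simple. *)
Lemma circle_lift_turn (C S theta tau : R -> R) (L : R) : 0 < L ->
  (forall t, 0 < theta t) ->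
  (forall t : R, -1 < t -> is_derive t 1 tau (theta t)) ->
  (forall t, 0 <= t -> C t = cos (tau t) /\ S t = sin (tau t)) ->
  C L = C 0 -> S L = S 0 ->
  (forall t, 0 <= t < L -> C t = C 0 -> S t = S 0 -> t = 0) ->
  tau L = tau 0 + 2 * pi.
Proof.
move=> L0 th0 dtau CS CL SL simple; have p0 := pi_gt0 R.
have N1 (t : R) : 0 <= t -> -1 < t by move=> ?; lra.
have inc a b : 0 <= a -> a < b -> tau a < tau b.
  move=> a0 ab.
  have [t tI E] : exists2 c, c \in `]a, b[ & tau b - tau a = theta c * (b - a).
    apply: (@MVT _ tau theta a b ab).
    - by move=> x; rewrite in_itv/= => /andP[ax xb]; apply: dtau; apply: N1; lra.
    - apply: continuous_in_subspaceT => x; rewrite inE/= in_itv/= => /andP[ax xb].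
      by apply: der_cont (dtau x _); apply: N1; lra.
  by rewrite -subr_gt0 E mulr_gt0// subr_gt0.
have [cL sL] := CS L (ltW L0); have [c0 s0] := CS 0 (lexx 0).
have sd : sin (tau L - tau 0) = 0.
  by rewrite sinB -cL -sL -c0 -s0 CL SL; ring.
have cd : cos (tau L - tau 0) = 1.
  by rewrite cosB -cL -sL CL SL c0 s0 -!expr2 cos2Dsin2.
have [l lE] := sin_eq0_intpi sd.
have tL : tau 0 < tau L by exact: inc.
have l0 : 0 < l.
  have : 0 < l%:~R * pi :> R by rewrite -lE subr_gt0.
  by rewrite pmulr_lgt0// ltr0z.
have l2 : 2 <= l.
  rewrite leNgt; apply/negP => l2.
  have l1 : l = 1 by lia.
  by move: cd; rewrite lE l1 mul1r cospi; lra.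
have tau2 : tau 0 + 2 * pi <= tau L.
  rewrite -lerBrDl lE ler_wpM2r ?(ltW p0)//.
  by rewrite -(ler_int R) in l2.
apply/eqP; rewrite eq_le tau2 andbT leNgt; apply/negP => tau3.
have ctau : {within `[0, L], continuous tau}.
  apply: continuous_in_subspaceT => x; rewrite inE/= in_itv/= => /andP[ax xb].
  by apply: der_cont (dtau x _); exact: N1.
(* Turning by more than 2 pi would bring the curve back to its starting point strictly before
   [L]. *)
have [t tI tE] : exists2 c, c \in `[0, L] & tau c = tau 0 + 2 * pi.
  apply: IVT => //; first exact: ltW.
  by rewrite min_l ?(ltW tL)// max_r ?(ltW tL)// tau2 lerDl mulr_ge0// ltW.
rewrite in_itv/= in tI; case/andP: tI => t0 tL'.
have [ct st] := CS t t0.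
have h2 : 2 * pi = pi *+ 2 :> R by rewrite mulr_natl.
rewrite tE h2 cosD2pi -c0 in ct; rewrite tE h2 sinD2pi -s0 in st.
have t_0 : t = 0.
  apply: simple => //; rewrite t0 lt_neqAle tL' andbT.
  by apply/eqP => tLE; rewrite tLE in tE; rewrite tE ltxx in tau3.
by move: tE; rewrite t_0; lra.
Qed.

End Lift.

(** * The action of the Euler orbit *)

Section Action.
Context {R : realType}.
Notation mu := (@lebesgue_measure R).
Variables (beta e : R).
Hypotheses (b0 : 0 < beta) (b1 : beta < 1) (e0 : 0 < e) (e1 : e < 1).

(** The half-angle formulas: if e = sin x and q = cos x, then b = tan (x / 2). *)
Lemma ecc_of (q := Num.sqrt (1 - e ^+ 2)) (b := (1 - q) / e) :
  [/\ 0 <= b, b < 1, ecc b = e & (1 - b ^+ 2) / (1 + b ^+ 2) = q].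
Proof.
have [h0 h1] := (e0, e1).
have e2 : 0 < e ^+ 2 < 1 by rewrite exprn_gt0//= exprn_ilt1// ltW.
have q0 : 0 < q by rewrite sqrtr_gt0 subr_gt0; case/andP: e2.
have q2 : q ^+ 2 = 1 - e ^+ 2 by rewrite sqr_sqrtr// subr_ge0 ltW//; case/andP: e2.
have q1 : q < 1.
  by rewrite -(ltr_pXn2r (n:=2)) ?nnegrE ?ltW// q2 expr1n; case/andP: e2 => *; lra.
have eN : e != 0 by rewrite gt_eqF.
have b2 : 1 + b ^+ 2 = 2 * (1 - q) / e ^+ 2.
  by rewrite /b expr_div_n sqrrB q2; field.
have q1' : 1 - q != 0 by rewrite gt_eqF// subr_gt0.
split.
- by rewrite /b divr_ge0 ?ltW// subr_gt0.
- rewrite /b ltr_pdivrMr// mul1r.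
  have h : (1 - e) ^+ 2 < q ^+ 2.
    rewrite q2 -subr_gt0.
    have -> : 1 - e ^+ 2 - (1 - e) ^+ 2 = 2 * (e * (1 - e)) by ring.
    by rewrite !mulr_gt0// subr_gt0.
  by rewrite ltr_pXn2r ?nnegrE ?subr_ge0 ?(ltW q0) ?(ltW e1)// in h; lra.
- by rewrite /ecc b2 /b; field; rewrite eN q1'.
- rewrite b2; have -> : 1 - b ^+ 2 = 2 - (1 + b ^+ 2) by ring.
  rewrite b2.
  have -> : 2 - 2 * (1 - q) / e ^+ 2 = 2 * (e ^+ 2 - (1 - q)) / e ^+ 2 by field.
  have -> : e ^+ 2 - (1 - q) = q * (1 - q).
    by have -> : e ^+ 2 = 1 - q ^+ 2; [rewrite q2; ring|ring].
  by field; rewrite eN q1'.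
Qed.

(** The given parametrization is [euler_curve] composed with an angle [tau] that gains exactly 2 pi.
    A change of variable then moves the line integral to the boundary of the disk, where
    [euler_stokes] replaces lambda by p_r dr. *)
Lemma action_value (lam : 'rV[R]_4 -> 'rV[R]_4) (c : R -> 'rV[R]_4) (L : R) :
  is_contact_form beta e lam -> parametrizes_euler_orbit beta e c L ->
  line_integral lam c L = 2 * pi * ((1 - Num.sqrt (1 - e ^+ 2)) / (Num.sqrt 2 * beta)).
Proof.
move=> hlam [L0 dc cc per simple img dir].
have s2 : Num.sqrt 2 ^+ 2 = 2 :> R by rewrite sqr_sqrtr.
have s20 : Num.sqrt 2 != 0 :> R by rewrite gt_eqF// sqrtr_gt0.
have eN : e != 0 by rewrite gt_eqF.
have bN : beta != 0 by rewrite gt_eqF.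
have dc' (t : R) : is_derive t 1 c (derive1 c t) by rewrite derive1E; exact: derivableP.
have orb t : euler_orbit beta e (c t) by rewrite -img; exists t.
have r0 t : 0 < c_r (c t) by have [[]] := orb t.
have z0 t : c_z (c t) = 0 by have [_ []] := orb t.
have pz0 t : c_pz (c t) = 0 by have [_ []] := orb t.
pose x t := 2 * beta * c_r (c t).
have x0 t : 0 < x t by rewrite !mulr_gt0.
have xN t : x t != 0 by rewrite gt_eqF.
have rE t : c_r (c t) = x t / (2 * beta) by rewrite /x; field.
have dist0 t : dist beta (c_r (c t)) 0 = c_r (c t).
  by rewrite /dist expr0n mulr0 addr0 sqrtr_sqr ger0_norm// ltW.
have pr2 t : c_pr (c t) ^+ 2 * x t ^+ 2 = 2 * (e ^+ 2 - (1 - x t) ^+ 2).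
  have [[_ H] _] := orb t; move: H.
  rewrite /Ham /hamiltonian -/(Pot beta e _ _) PotE// z0 dist0 pz0 /wcoef /ccoef expr0n/= addr0.
  have rN : c_r (c t) != 0 by rewrite gt_eqF.
  move=> H; have {H} : c_pr (c t) ^+ 2 = 2 * (-1 - ((1 - e ^+ 2) / (2 * beta ^+ 2) / (2 * c_r (c t) ^+ 2)
     - (c_r (c t))^-1 - (1 - beta) / beta / c_r (c t))).
    by rewrite -H; field; rewrite rN bN.
  move=> ->; rewrite rE; field.
  by rewrite xN bN.
(* In these coordinates the Euler orbit is the unit circle, and along the flow (C, S) turns with the
   positive speed [th]. *)
pose C t := (1 - x t) / e.
pose S t := c_pr (c t) * x t / (Num.sqrt 2 * e).
have CS t : C t ^+ 2 + S t ^+ 2 = 1.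
  have -> : S t ^+ 2 = c_pr (c t) ^+ 2 * x t ^+ 2 / (2 * e ^+ 2).
    by rewrite -[X in _ / (X * _)]s2 /S; field; rewrite eN s20.
  by rewrite pr2 /C; field; exact: eN.
pose dcr t := c_r (derive1 c t).
pose dcp t := c_pr (derive1 c t).
have Dr (t : R) : is_derive t 1 (fun s => c_r (c s)) (dcr t) by case: (der_coord (dc' t)).
have Dp (t : R) : is_derive t 1 (fun s => c_pr (c s)) (dcp t) by case: (der_coord (dc' t)).
pose dC t := - (2 * beta * dcr t) / e.
pose dS t := (dcp t * x t + c_pr (c t) * (2 * beta * dcr t)) / (Num.sqrt 2 * e).
have DC (t : R) : is_derive t 1 C (dC t).
  by rewrite /C /x /dC; der; field.
have DS (t : R) : is_derive t 1 S (dS t).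
  by rewrite /S /x /dS; der; rewrite /x; field; rewrite eN s20.
pose th t := C t * dS t - S t * dC t.
have thE t : exists k, [/\ 0 < k, dC t = - (2 * Num.sqrt 2 * beta * k / x t) * S t,
    dS t = 2 * Num.sqrt 2 * beta * k / x t * C t, c_pz (derive1 c t) = 0 & c_z (derive1 c t) = 0].
  have [k k0 E] := dir t; exists k.
  have pzE : c_pz (derive1 c t) = 0.
    by rewrite E ham_fieldE// /c_pz !mxE/= /Vz z0 mulr0 mul0r oppr0 mulr0.
  have zE : c_z (derive1 c t) = 0.
    by rewrite E ham_fieldE// /c_z !mxE/= -/(c_pz (c t)) pz0 mulr0.
  have drE : dcr t = k * c_pr (c t) by rewrite /dcr E ham_fieldE// /c_r !mxE.
  have dpE : dcp t = - k * (4 * beta * (x t - (1 - e ^+ 2)) / x t ^+ 3).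
    rewrite /dcp E ham_fieldE// /c_pr !mxE/= /Vr z0 dist0 /wcoef /ccoef rE.
    by field; rewrite xN bN.
  split => //.
  - rewrite /dC drE /S; field; by rewrite xN eN s20.
  - rewrite /dS drE dpE /C.
    have -> : c_pr (c t) * (2 * beta * (k * c_pr (c t))) =
      2 * beta * k * (c_pr (c t) ^+ 2 * x t ^+ 2) / x t ^+ 2 by field; exact: xN.
    have i2 : (Num.sqrt 2)^-1 = Num.sqrt 2 / 2 :> R.
      by rewrite -[X in _ / X]s2; field.
    rewrite pr2 (invfM (Num.sqrt 2) e) i2; field; by rewrite xN eN.
have thK t : 0 < th t /\ dC t = - th t * S t /\ dS t = th t * C t /\
    c_pz (derive1 c t) = 0 /\ c_z (derive1 c t) = 0.
  have [k [k0 E1 E2 E3 E4]] := thE t.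
  have T : th t = 2 * Num.sqrt 2 * beta * k / x t.
    rewrite /th E1 E2.
    have -> : C t * (2 * Num.sqrt 2 * beta * k / x t * C t) -
      S t * (- (2 * Num.sqrt 2 * beta * k / x t) * S t) =
      2 * Num.sqrt 2 * beta * k / x t * (C t ^+ 2 + S t ^+ 2) by ring.
    by rewrite CS mulr1.
  rewrite T; do !split => //.
  by rewrite divr_gt0 ?mulr_gt0 ?sqrtr_gt0.
have cc_coord j : continuous (fun t => derive1 c t 0 j).
  by move=> t; exact: (continuous_comp (@cc t) (@cont_coord R j (derive1 c t))).
have cdcr : continuous dcr by exact: cc_coord.
have cdcp : continuous dcp by exact: cc_coord.
have cth : continuous th.
  move=> t; have h1 := der_cont (Dr t); have h2 := der_cont (Dp t).
  have k1 : {for t, continuous dcr} by exact: cdcr.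
  have k2 : {for t, continuous dcp} by exact: cdcp.
  have cx : {for t, continuous x} by rewrite /x; apply: cont_mul h1; exact: cont_cst.
  have cC := der_cont (DC t); have cS := der_cont (DS t).
  have cdC : {for t, continuous dC}.
    apply: cont_mul; last exact: cont_cst.
    apply: cont_opp; apply: cont_mul k1; exact: cont_cst.
  have cdS : {for t, continuous dS}.
    apply: cont_mul; last exact: cont_cst.
    apply: cont_add; first exact: cont_mul.
    apply: cont_mul h2 _; apply: cont_mul k1; exact: cont_cst.
  exact: (cont_add (cont_mul cC cdS) (cont_opp (cont_mul cS cdC))).
have DC' (t : R) : is_derive t 1 C (- th t * S t).
  by have [_ [<- _]] := thK t; exact: DC.
have DS' (t : R) : is_derive t 1 S (th t * C t).
  by have [_ [_ [<- _]]] := thK t; exact: DS.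
have [tau [dtau tauE]] := circle_lift cth DC' DS' CS.
have cL : c L = c 0 by have := per 0; rewrite add0r.
have cE t : 0 <= t -> c t = euler_curve beta e (tau t).
  move=> t0; have [c_ s_] := tauE t t0.
  have xE : 1 - e * cos (tau t) = x t by rewrite -c_ /C; field.
  rewrite (phase_coords (c t)) pz0 z0 /euler_curve xE -s_ rE; congr phase.
  by rewrite /S; field; rewrite eN s20 xN.
have turn : tau L = tau 0 + 2 * pi.
  apply: (@circle_lift_turn _ C S th tau L L0) => //.
  - by move=> t; have [] := thK t.
  - by rewrite /C /x cL.
  - by rewrite /S /x cL.
  - move=> t /andP[t0 tL] Ct St; apply: simple; rewrite ?t0 ?lexx//.
    have xE : x t = x 0.
      have : 1 - e * C t = 1 - e * C 0 by rewrite Ct.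
      by rewrite /C => H; have h (y : R) : 1 - e * ((1 - y) / e) = y;
        [field|rewrite !h in H].
    rewrite (phase_coords (c t)) (phase_coords (c 0)) !pz0 !z0 !rE xE; congr phase.
    have : S t * (Num.sqrt 2 * e) / x t = S 0 * (Num.sqrt 2 * e) / x 0 by rewrite St xE.
    by rewrite /S => H; have h (p y : R) : y != 0 ->
        p * y / (Num.sqrt 2 * e) * (Num.sqrt 2 * e) / y = p;
      [move=> y0; field; rewrite y0 eN s20|rewrite !h in H].
have dcE t : 0 <= t -> derive1 c t = th t *: deuler_curve beta e (tau t).
  move=> t0; have [c_ s_] := tauE t t0.
  have [th0 [_ [_ [pzE zE]]]] := thK t.
  have xE : 1 - e * cos (tau t) = x t by rewrite -c_ /C; field.
  have sE : e * sin (tau t) = c_pr (c t) * x t / Num.sqrt 2.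
    by rewrite -s_ /S; field; rewrite eN s20.
  have dr : dcr t = th t * (e * S t) / (2 * beta).
    have [_ [E _]] := thK t.
    have : - (dC t * e) / (2 * beta) = dcr t by rewrite /dC; field; rewrite eN bN.
    by rewrite E => <-; field.
  have dp : dcp t = th t * (Num.sqrt 2 * e * C t / x t - Num.sqrt 2 * e * S t * (e * S t) / x t ^+ 2).
    have [_ [_ [E _]]] := thK t.
    have : (dS t * (Num.sqrt 2 * e) - c_pr (c t) * (2 * beta * dcr t)) / x t = dcp t.
      by rewrite /dS; field; rewrite eN s20 xN.
    rewrite E dr => <-.
    have -> : c_pr (c t) = Num.sqrt 2 * e * S t / x t.
      by rewrite /S; field; rewrite eN s20 xN.
    by field; rewrite bN xN.
  rewrite (phase_coords (derive1 c t)) pzE zE -/(dcr t) -/(dcp t) dr dp /deuler_curve xE -c_ -s_.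
  by apply/rowP => -[[|[|[|[|?]]]] hj]; rewrite !mxE//=; ring.
have [dlam _ _ _ _] := hlam.
pose A u := ev (lam (euler_curve beta e u)) (deuler_curve beta e u).
have ecN u : 1 - e * cos u != 0 by rewrite gt_eqF// oneBmulcos_gt0// ltW.
have cx u : {for u, continuous (fun u : R => 1 - e * cos u)}.
  by apply: der_cont; der; reflexivity.
have cA : continuous A.
  move=> u.
  have cE1 : {for u, continuous (euler_curve beta e)}.
    apply: cont_phase; [|exact: cont_cst| |exact: cont_cst].
    - by apply: cont_div; [exact: ecN|cont|cont].
    - by cont.
  have cE2 : {for u, continuous (deuler_curve beta e)}.
    apply: cont_phase; [|exact: cont_cst| |exact: cont_cst].
    - apply: cont_add; first by apply: cont_div; [exact: ecN|cont|cont].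
      apply: cont_opp; apply: cont_div; first by rewrite expf_neq0.
        by cont.
      by cont.
    - by cont.
  apply: cont_ev => //.
  exact: (continuous_comp cE1 (differentiable_continuous (dlam _))).
have [La dLa] := primitive_right (tau 0 - 1) cA.
have p0 := pi_gt0 R.
have tau_ge t : 0 <= t -> tau 0 <= tau t.
  rewrite le_eqVlt => /orP[/eqP <-//|t0].
  apply: (@ger0_derive1_ndecr _ tau 0 t) => //; rewrite ?ltW//.
  - move=> y; rewrite in_itv/= => /andP[y0 _].
    by have [] := dtau y (lt_trans (ltrN10 _) y0).
  - move=> y; rewrite in_itv/= => /andP[y0 _].
    rewrite (der_val (dtau y (lt_trans (ltrN10 _) y0))).
    by have [/ltW] := thK y.
  - apply: continuous_in_subspaceT => y; rewrite inE/= in_itv/= => /andP[y0 _].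
    by apply: der_cont (dtau y _); rewrite (lt_le_trans _ y0)// ltrN10.
have T1 : line_integral lam c L = La (tau 0 + 2 * pi) - La (tau 0).
  rewrite /line_integral /Rintegral.
  have -> : (\int[mu]_(t in `[0%R, L]) (ev (lam (c t)) (derive1 c t))%:E =
     \int[mu]_(t in `[0%R, L]) (A (tau t) * th t)%:E)%E.
    apply: eq_integral => t; rewrite inE/= in_itv/= => /andP[t0 _].
    rewrite (cE t t0) (dcE t t0) /A; congr EFin; rewrite !evE.
    by rewrite /c_pr /c_pz /c_r /c_z !mxE; ring.
  have D1 (t : R) : 0 <= t <= L -> is_derive t 1 (fun t => La (tau t)) (A (tau t) * th t).
    move=> /andP[t0 _]; apply: der_comp; last by apply: dtau; rewrite (lt_le_trans _ t0)// ltrN10.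
    by apply: dLa; rewrite ltrBlDr (le_lt_trans (tau_ge t t0))// ltrDl.
  have D2 (t : R) : 0 <= t <= L -> {for t, continuous (fun t => A (tau t) * th t)}.
    move=> /andP[t0 _]; apply: cont_mul; last exact: cth.
    have ct : {for t, continuous tau}.
      by apply: der_cont (dtau t _); rewrite (lt_le_trans _ t0)// ltrN10.
    exact: (continuous_comp ct (@cA (tau t))).
  by rewrite (FTC_closed L0 D1 D2) /= turn.
have [bb0 bb1 eccE qE] := ecc_of.
set b := (1 - Num.sqrt (1 - e ^+ 2)) / e in bb0 bb1 eccE qE.
have := euler_stokes b0 b1 e0 e1 (tau 0) hlam.
(* A primitive of lambda - p_r dr along the orbit; by Stokes its increment over one turn is zero,
   which leaves the increment of [kprim]. *)
pose K u := La u - kprim b u / (Num.sqrt 2 * beta).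
have D1 (u : R) : tau 0 <= u <= tau 0 + 2 * pi -> is_derive u 1 K
    (A u - e ^+ 2 * sin u ^+ 2 / (1 - e * cos u) / (Num.sqrt 2 * beta)).
  move=> /andP[u0 _].
  have d1 : is_derive u 1 La (A u) by apply: dLa; rewrite ltrBlDr (le_lt_trans u0)// ltrDl.
  have d2 := der_kprim u bb0 bb1; rewrite eccE in d2.
  by rewrite /K; der; ring.
have D2 (u : R) : tau 0 <= u <= tau 0 + 2 * pi -> {for u, continuous (fun u =>
    A u - e ^+ 2 * sin u ^+ 2 / (1 - e * cos u) / (Num.sqrt 2 * beta))}.
  move=> _; apply: cont_add; first exact: cA.
  apply: cont_opp; apply: cont_mul; last exact: cont_cst.
  by apply: cont_div; [exact: ecN|cont|cont].
rewrite (FTC_closed _ D1 D2); last by rewrite ltrDl mulr_gt0.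
move=> [] H; rewrite T1.
have -> : La (tau 0 + 2 * pi) - La (tau 0) =
   (K (tau 0 + 2 * pi) - K (tau 0)) + (kprim b (tau 0 + 2 * pi) - kprim b (tau 0)) / (Num.sqrt 2 * beta).
  by rewrite /K; ring.
by rewrite H kprim_period qE add0r mulrA.
Qed.

End Action.

(** * The contact volume form on the chart *)

Lemma c_prZ (R : realType) (a : R) u : c_pr (a *: u) = a * c_pr u. Proof. by rewrite /c_pr mxE. Qed.
Lemma c_pzZ (R : realType) (a : R) u : c_pz (a *: u) = a * c_pz u. Proof. by rewrite /c_pz mxE. Qed.
Lemma c_rZ (R : realType) (a : R) u : c_r (a *: u) = a * c_r u. Proof. by rewrite /c_r mxE. Qed.
Lemma c_zZ (R : realType) (a : R) u : c_z (a *: u) = a * c_z u. Proof. by rewrite /c_z mxE. Qed.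
Definition coordZ := (c_prZ, c_pzZ, c_rZ, c_zZ).

Section Chart.
Context {R : realType}.
Variables (beta e : R).
Hypotheses (b0 : 0 < beta) (b1 : beta < 1) (e0 : 0 < e) (e1 : e < 1).
Variable lam : 'rV[R]_4 -> 'rV[R]_4.
Hypothesis hlam : is_contact_form beta e lam.

Definition ypot (r z : R) : R := 2 * (-1 - Pot beta e r z).
Definition momentum (r z : R) : R := Num.sqrt (ypot r z).

Let G r f z := chart beta e r f z.
Let V1 := Vr beta e.
Let V2 := Vz beta.

(* [momentum] times the radial and axial derivatives of the chart *)
Definition Ur r f z : 'rV[R]_4 := phase (- V1 r z * cos f) (- V1 r z * sin f) (momentum r z) 0.
Definition Uz r f z : 'rV[R]_4 := phase (- V2 r z * cos f) (- V2 r z * sin f) 0 (momentum r z).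
Definition Uf r f z : 'rV[R]_4 := phase (- (momentum r z * sin f)) (momentum r z * cos f) 0 0.

Definition radial_coef r f z : R :=
  c_pr (lam (G r f z)) * sin f ^+ 2 - c_pz (lam (G r f z)) * (sin f * cos f).
Definition axial_coef r f z : R :=
  c_pz (lam (G r f z)) * cos f ^+ 2 - c_pr (lam (G r f z)) * (sin f * cos f).

(* On the chart the contact volume form is [ypot] plus the divergence of
   [(flux_r, flux_phi, flux_z)]. *)
Definition flux_r r f z : R := ypot r z * radial_coef r f z.
Definition dflux_r r f z : R :=
  - 2 * V1 r z * radial_coef r f z
  + momentum r z * (c_pr ('D_(Ur r f z) lam (G r f z)) * sin f ^+ 2
               - c_pz ('D_(Ur r f z) lam (G r f z)) * (sin f * cos f)).
Definition flux_z r f z : R := ypot r z * axial_coef r f z.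
Definition dflux_z r f z : R :=
  - 2 * V2 r z * axial_coef r f z
  + momentum r z * (c_pz ('D_(Uz r f z) lam (G r f z)) * cos f ^+ 2
               - c_pr ('D_(Uz r f z) lam (G r f z)) * (sin f * cos f)).
Definition flux_phi r f z : R :=
  sin f * (- V1 r z * (c_pr (lam (G r f z)) * cos f + c_pz (lam (G r f z)) * sin f)
           + momentum r z * c_r (lam (G r f z)))
  - cos f * (- V2 r z * (c_pr (lam (G r f z)) * cos f + c_pz (lam (G r f z)) * sin f)
           + momentum r z * c_z (lam (G r f z))).
Definition dflux_phi r f z : R :=
  let l := lam (G r f z) in let d := 'D_(Uf r f z) lam (G r f z) in
  cos f * (- V1 r z * (c_pr l * cos f + c_pz l * sin f) + momentum r z * c_r l)
  + sin f * (- V1 r z * (c_pr d * cos f - c_pr l * sin f + c_pz d * sin f + c_pz l * cos f)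
             + momentum r z * c_r d)
  + sin f * (- V2 r z * (c_pr l * cos f + c_pz l * sin f) + momentum r z * c_z l)
  - cos f * (- V2 r z * (c_pr d * cos f - c_pr l * sin f + c_pz d * sin f + c_pz l * cos f)
             + momentum r z * c_z d).

Lemma der_ypot_r (r z : R) : 0 < r -> is_derive r 1 (ypot ^~ z) (- 2 * V1 r z).
Proof.
move=> r0; have d := @der_Pot _ beta e b0 b1 e0 e1 r id (fun=> z) _ _ r0 (der_id r) (der_cst r z).
by rewrite /ypot; apply: is_derive_eq (der_mul (der_cst _ _) (der_add (der_cst _ _) (der_opp d))) _;
  rewrite /V1; ring.
Qed.

Lemma der_ypot_z (r z : R) : 0 < r -> is_derive z 1 (ypot r) (- 2 * V2 r z).
Proof.
move=> r0; have d := @der_Pot _ beta e b0 b1 e0 e1 z (fun=> r) id _ _ r0 (der_cst z r) (der_id z).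
by rewrite /ypot; apply: is_derive_eq (der_mul (der_cst _ _) (der_add (der_cst _ _) (der_opp d))) _;
  rewrite /V2; ring.
Qed.

Section Point.
Variables (r f z : R).
Hypotheses (r0 : 0 < r) (y0 : 0 < ypot r z).

Lemma momentum_gt0 : 0 < momentum r z. Proof. by rewrite sqrtr_gt0. Qed.
Lemma sqr_momentum : momentum r z ^+ 2 = ypot r z. Proof. by rewrite sqr_sqrtr// ltW. Qed.

Lemma der_momentum_r : is_derive r 1 (momentum ^~ z) (- V1 r z / momentum r z).
Proof.
have d := der_ypot_r z r0.
have D := @der_sqrt R r (ypot ^~ z) _ y0 d.
have h := momentum_gt0; apply: (is_derive_eq D); rewrite -/(momentum r z).
by field; rewrite gt_eqF.
Qed.

Lemma der_momentum_z : is_derive z 1 (momentum r) (- V2 r z / momentum r z).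
Proof.
have d := der_ypot_z z r0.
have D := @der_sqrt R z (ypot r) _ y0 d.
have h := momentum_gt0; apply: (is_derive_eq D); rewrite -/(momentum r z).
by field; rewrite gt_eqF.
Qed.

Lemma chart_momentum s g t : chart beta e s g t = phase (momentum s t * cos g) (momentum s t * sin g) s t.
Proof. by []. Qed.

Lemma UrE : (momentum r z)^-1 *: Ur r f z =
    phase (- V1 r z / momentum r z * cos f) (- V1 r z / momentum r z * sin f) 1 0.
Proof.
have h := momentum_gt0.
by apply/rowP => -[[|[|[|[|?]]]] hj]; rewrite !mxE//=; field; rewrite gt_eqF.
Qed.

Lemma UzE : (momentum r z)^-1 *: Uz r f z =
    phase (- V2 r z / momentum r z * cos f) (- V2 r z / momentum r z * sin f) 0 1.
Proof.
have h := momentum_gt0.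
by apply/rowP => -[[|[|[|[|?]]]] hj]; rewrite !mxE//=; field; rewrite gt_eqF.
Qed.

Lemma der_chart_r : is_derive r 1 (fun s => G s f z) ((momentum r z)^-1 *: Ur r f z).
Proof.
have d := der_momentum_r; rewrite UrE.
rewrite /G; under [X in is_derive _ _ X _]eq_fun do rewrite chart_momentum.
by apply: der_phase; der; ring.
Qed.

Lemma der_chart_z : is_derive z 1 (fun s => G r f s) ((momentum r z)^-1 *: Uz r f z).
Proof.
have d := der_momentum_z; rewrite UzE.
rewrite /G; under [X in is_derive _ _ X _]eq_fun do rewrite chart_momentum.
by apply: der_phase; der; ring.
Qed.

Lemma der_chart_f : is_derive f 1 (fun s => G r s z) (Uf r f z).
Proof.
rewrite /G; under [X in is_derive _ _ X _]eq_fun do rewrite chart_momentum.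
by apply: der_phase; der; ring.
Qed.

Lemma chart_energy : energy_surface beta e (G r f z).
Proof.
split; first by rewrite /= /G /chart phaseK.
rewrite /Ham /hamiltonian /G chart_momentum !phaseK -/(Pot beta e _ _) !exprMn -mulrDr cos2Dsin2 mulr1.
by rewrite sqr_momentum /ypot; field.
Qed.

Lemma tangentE u : tangent beta e (G r f z) u =
  (momentum r z * cos f * c_pr u + momentum r z * sin f * c_pz u + V1 r z * c_r u + V2 r z * c_z u = 0).
Proof.
by rewrite /tangent/= derive_Ham// /G chart_momentum !phaseK.
Qed.

Let dlam := contact_differentiable hlam.

Lemma derive_scale (a : R) u : 'D_(a *: u) lam (G r f z) = a *: 'D_u lam (G r f z).
Proof. by rewrite !deriveE// linearZ. Qed.

Lemma der_flux_r : is_derive r 1 (fun s => flux_r s f z) (dflux_r r f z).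
Proof.
have d := der_ypot_r z r0.
have [d1 d2 _ _] := der_coord (der_chain (dlam _) der_chart_r).
have h := momentum_gt0; rewrite derive_scale in d1 d2.
rewrite /flux_r /radial_coef; der; rewrite /dflux_r /radial_coef !coordZ -sqr_momentum.
by field; rewrite gt_eqF.
Qed.

Lemma der_flux_z : is_derive z 1 (fun s => flux_z r f s) (dflux_z r f z).
Proof.
have d := der_ypot_z z r0.
have [d1 d2 _ _] := der_coord (der_chain (dlam _) der_chart_z).
have h := momentum_gt0; rewrite derive_scale in d1 d2.
rewrite /flux_z /axial_coef; der; rewrite /dflux_z /axial_coef !coordZ -sqr_momentum.
by field; rewrite gt_eqF.
Qed.

Lemma der_flux_phi : is_derive f 1 (fun s => flux_phi r s z) (dflux_phi r f z).
Proof.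
have [d1 d2 d3 d4] := der_coord (der_chain (dlam _) der_chart_f).
by rewrite /flux_phi; der; rewrite /dflux_phi; ring.
Qed.

(** The flux consists of the components of - lambda /\ theta, theta = p_r dr + p_z dz. As d lambda =
    d theta on the surface, - d (lambda /\ theta) = lambda /\ d lambda - theta /\ d theta, and theta
    /\ d theta has the coefficient p_r^2 + p_z^2 = [ypot] on the chart. *)
Lemma chart_vol_form :
  contact_vol_form lam (G r f z) (derive1 (fun s : R => G s f z) r) (derive1 (fun s : R => G r s z) f)
    (derive1 (fun s : R => G r f s) z) =
  ypot r z + (dflux_r r f z + (dflux_z r f z + dflux_phi r f z)).
Proof.
rewrite (der_val der_chart_r) (der_val der_chart_f) (der_val der_chart_z).
have h := momentum_gt0; have hN : momentum r z != 0 by rewrite gt_eqF.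
have E := chart_energy; have prim := contact_primitive hlam.
have tr : tangent beta e (G r f z) ((momentum r z)^-1 *: Ur r f z).
  rewrite UrE tangentE !phaseK.
  transitivity (- V1 r z * (cos f ^+ 2 + sin f ^+ 2 - 1)); first by field.
  by rewrite cos2Dsin2; ring.
have tz : tangent beta e (G r f z) ((momentum r z)^-1 *: Uz r f z).
  rewrite UzE tangentE !phaseK.
  transitivity (- V2 r z * (cos f ^+ 2 + sin f ^+ 2 - 1)); first by field.
  by rewrite cos2Dsin2; ring.
have tf : tangent beta e (G r f z) (Uf r f z).
  by rewrite tangentE !phaseK; ring.
rewrite /contact_vol_form !prim//.
have I1 := prim _ _ _ E tr tf; have I2 := prim _ _ _ E tz tf.
rewrite /ext_deriv !derive_scale in I1 I2.
rewrite /dflux_r /dflux_z /dflux_phi /radial_coef /axial_coef -sqr_momentum.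
set l := lam (G r f z) in I1 I2 *.
set dr := 'D_(Ur r f z) lam (G r f z) in I1 *; set dz := 'D_(Uz r f z) lam (G r f z) in I2 *.
set df := 'D_(Uf r f z) lam (G r f z) in I1 I2 *.
clearbody l dr dz df.
rewrite UrE /Uf in I1 *; rewrite UzE /Uf in I2 *.
rewrite !evE /omega !coordZ !phaseK in I1 I2 *.
set c := cos f in I1 I2 *; set s := sin f in I1 I2 *; set w := momentum r z in hN I1 I2 *.
have cs : c ^+ 2 = 1 - s ^+ 2 by exact: cos2sin2.
set v1 := V1 r z in I1 I2 *; set v2 := V2 r z in I1 I2 *.
(* d lambda = omega on the radial and angular directions, cleared of the denominator w; [J2] is its
   axial counterpart. The derivatives of [lam] enter the divergence only in these two
   combinations. *)
have J1 : w * (- s * c_pr dr + c * c_pz dr) + v1 * (c * c_pr df + s * c_pz df) - w * c_r df = w ^+ 2 * s.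
  transitivity (w * ((w^-1 * c_pr dr * - (w * s) + w^-1 * c_pz dr * (w * c) +
    w^-1 * c_r dr * 0 + w^-1 * c_z dr * 0) -
   (c_pr df * (- v1 / w * c) + c_pz df * (- v1 / w * s) + c_r df * 1 +
    c_z df * 0))); first by field.
  by rewrite I1; field.
have J2 : w * (- s * c_pr dz + c * c_pz dz) + v2 * (c * c_pr df + s * c_pz df) - w * c_z df = - w ^+ 2 * c.
  transitivity (w * ((w^-1 * c_pr dz * - (w * s) + w^-1 * c_pz dz * (w * c) +
    w^-1 * c_r dz * 0 + w^-1 * c_z dz * 0) -
   (c_pr df * (- v2 / w * c) + c_pz df * (- v2 / w * s) + c_r df * 0 +
    c_z df * 1))); first by field.
  by rewrite I2; field.
have cs1 : 1 - c ^+ 2 - s ^+ 2 = 0 by rewrite cs; ring.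
transitivity (w * c * c_r l + w * s * c_z l - (c ^+ 2 + s ^+ 2) * (v1 * c_pr l + v2 * c_pz l)
  + (1 - c ^+ 2 - s ^+ 2) * w ^+ 2); first by rewrite cs1; field.
apply/eqP; rewrite -subr_eq0; apply/eqP.
transitivity (s * (w * (- s * c_pr dr + c * c_pz dr) + v1 * (c * c_pr df + s * c_pz df)
    - w * c_r df - w ^+ 2 * s)
  - c * (w * (- s * c_pr dz + c * c_pz dz) + v2 * (c * c_pr df + s * c_pz df)
    - w * c_z df + w ^+ 2 * c)); first by ring.
by rewrite J1 J2; ring.
Qed.
End Point.

End Chart.

(** * Integrating a derivative over a set where a function is positive *)

Section Slice.
Context {R : realType}.
Notation mu := (@lebesgue_measure R).

Lemma is_derive_near (f g : R -> R) (x a : R) : (\forall t \near x, f t = g t) ->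
  is_derive x 1 f a -> is_derive x 1 g a.
Proof. exact: near_eq_is_derive. Qed.

Definition pos_part (x : R) : R := Num.max x 0.

Lemma pos_part_ge0 x : 0 <= pos_part x. Proof. by rewrite le_max lexx orbT. Qed.
Lemma pos_partE x : 0 <= x -> pos_part x = x. Proof. by move=> ?; exact: max_l. Qed.
Lemma pos_part0 x : x <= 0 -> pos_part x = 0. Proof. by move=> ?; exact: max_r. Qed.

Lemma pos_part_cont (x : R) : {for x, continuous pos_part}.
Proof.
have -> : pos_part = fun x => (x + `|x|) / 2.
  apply/funext => y; have [y0|y0] := leP 0 y.
    by rewrite pos_partE// ger0_norm//; field.
  by rewrite pos_part0 ?ltW// ltr0_norm//; field.
apply: cont_mul; last exact: cont_cst.
by apply: cont_add; [exact: cvg_id|exact: norm_continuous].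
Qed.

(** Squaring removes the kink at 0: there the difference quotient is [pos_part] itself. *)
Lemma der_sqr_pos_part (x : R) : is_derive x 1 (fun u => pos_part u ^+ 2) (2 * pos_part x).
Proof.
have [x0|x0|->] := ltgtP x 0.
- have N : \forall u \near x, 0 = pos_part u ^+ 2.
    by near=> u; rewrite pos_part0 ?expr0n// ltW//; near: u; exact: lt_nbhsl.
  have D : is_derive x 1 (fun u => pos_part u ^+ 2) 0.
    exact: (is_derive_near N (der_cst _ _)).
  by apply: (is_derive_eq D); rewrite pos_part0 ?ltW// mulr0.
- have N : \forall u \near x, u ^+ 2 = pos_part u ^+ 2.
    by near=> u; rewrite pos_partE// ltW//; near: u; exact: lt_nbhsr.
  have D : is_derive x 1 (fun u => pos_part u ^+ 2) (2 * x).
    by apply: (is_derive_near N); der; ring.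
  by apply: (is_derive_eq D); rewrite pos_partE// ltW.
- apply/is_derive1_caratheodory; exists pos_part; split; last by rewrite pos_part0//; ring.
    move=> u; rewrite [in X in _ - X]pos_part0// expr0n/= !subr0 expr2.
    by have [u0|u0] := leP 0 u; [rewrite pos_partE|rewrite pos_part0 ?ltW// !mul0r].
  exact: pos_part_cont.
Unshelve. all: by end_near. Qed.

Variables (y dy h dh : R -> R) (a b M : R).
Hypothesis ab : a < b.
Hypothesis Dy : forall x : R, a <= x <= b -> is_derive x 1 y (dy x).
Hypothesis cdy : forall x, a <= x <= b -> {for x, continuous dy}.
Hypothesis Dh : forall x : R, a <= x <= b -> 0 < y x -> is_derive x 1 h (dh x).
Hypothesis cdh : forall x, a <= x <= b -> 0 < y x -> {for x, continuous dh}.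
Hypothesis hM : forall x, a <= x <= b -> 0 < y x -> `|h x| <= M * y x.
Hypothesis dyM : forall x, a <= x <= b -> `|dy x| <= M.
Hypothesis dhM : forall x, a <= x <= b -> 0 < y x -> `|dh x| <= M.
Hypothesis ya : y a <= 0.
Hypothesis yb : y b <= 0.

(* The cutoff (y - ep)_+^2 / y^2 makes [h] a C^1 function on the whole interval,
   although [h] and [dh] are controlled only where [y] is positive. *)
Let H (ep x : R) : R := pos_part (y x - ep) ^+ 2 * (h x / y x ^+ 2).
Let g (ep x : R) : R := 2 * pos_part (y x - ep) * dy x * (h x / y x ^+ 2)
  + pos_part (y x - ep) ^+ 2 * (dh x / y x ^+ 2 - 2 * h x * dy x / y x ^+ 3).

Let cy x : a <= x <= b -> {for x, continuous y}.
Proof. by move=> xab; exact: der_cont (Dy xab). Qed.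

Let near_lt x ep : a <= x <= b -> y x < ep -> \forall t \near x, y t < ep.
Proof. by move=> xab yx; move: (cy xab) => /cvgr_lt; apply. Qed.

Let DH ep x : 0 < ep -> a <= x <= b -> is_derive x 1 (H ep) (g ep x).
Proof.
move=> ep0 xab; have [y0|y0] := ltP 0 (y x); last first.
  have N : \forall t \near x, 0 = H ep t.
    have := near_lt xab (le_lt_trans y0 ep0); apply: filterS => t yt.
    by rewrite /H pos_part0 ?expr0n/= ?mul0r// subr_le0 ltW.
  have D : is_derive x 1 (H ep) 0.
    exact: (is_derive_near N (der_cst _ _)).
  apply: (is_derive_eq D); rewrite /g pos_part0 ?expr0n/= ?mulr0 ?mul0r ?addr0//.
  by rewrite subr_le0 (le_trans y0)// ltW.
have d1 := Dy xab; have d2 := Dh xab y0; have yN : y x != 0 by rewrite gt_eqF.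
have d3 : is_derive x 1 (fun t => pos_part (y t - ep) ^+ 2) (2 * pos_part (y x - ep) * dy x).
  have D : is_derive x 1 (fun t => y t - ep) (dy x) by der; ring.
  exact (@der_comp R x (fun u => pos_part u ^+ 2) (fun t => y t - ep) _ _ (der_sqr_pos_part (y x - ep)) D).
by rewrite /H; der; [rewrite expf_neq0|rewrite /g; field].
Qed.

Let cg ep x : 0 < ep -> a <= x <= b -> {for x, continuous (g ep)}.
Proof.
move=> ep0 xab; have [y0|y0] := ltP 0 (y x); last first.
  have N : \forall t \near x, 0 = g ep t.
    have := near_lt xab (le_lt_trans y0 ep0); apply: filterS => t yt.
    by rewrite /g pos_part0 ?expr0n/= ?mulr0 ?mul0r ?addr0// subr_le0 ltW.
  have gx : g ep x = 0 by rewrite -(nbhs_singleton N).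
  rewrite /prop_for /continuous_at gx.
  by apply: cvg_trans (near_eq_cvg N) _; exact: cvg_cst.
have k1 := cy xab; have k2 := cdy xab; have k3 := cdh xab y0.
have k4 : {for x, continuous h} by exact: der_cont (Dh xab y0).
have k5 : {for x, continuous (fun t => pos_part (y t - ep))}.
  have k : {for x, continuous (fun t => y t - ep)} by cont.
  exact: (continuous_comp k (@pos_part_cont _)).
have i2 : {for x, continuous (fun t => (y t ^+ 2)^-1)}.
  by apply: cont_inv (cont_exp k1); rewrite expf_neq0// gt_eqF.
have i3 : {for x, continuous (fun t => (y t ^+ 3)^-1)}.
  by apply: cont_inv (cont_exp k1); rewrite expf_neq0// gt_eqF.
rewrite /g; cont.
Qed.

Let int_g ep : 0 < ep -> (\int[mu]_(x in `[a, b]) (g ep x)%:E = 0)%E.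
Proof.
move=> ep0; rewrite (FTC_closed ab (fun x xab => DH ep0 xab) (fun x xab => cg ep0 xab)).
rewrite /H !pos_part0 ?expr0n/= ?mul0r ?subrr//.
- by rewrite subr_le0 (le_trans ya)// ltW.
- by rewrite subr_le0 (le_trans yb)// ltW.
Qed.

Let g_le ep x : 0 < ep -> a <= x <= b -> `|g ep x| <= 2 * M * M + M.
Proof.
move=> ep0 xab; have M0 : 0 <= M by apply: le_trans (dyM xab).
have [y0|y0] := ltP 0 (y x); last first.
  rewrite /g pos_part0 ?expr0n/= ?mulr0 ?mul0r ?addr0 ?normr0; last first.
    by rewrite subr_le0 (le_trans y0)// ltW.
  by rewrite addr_ge0// !mulr_ge0.
have yN : y x != 0 by rewrite gt_eqF.
set p := pos_part (y x - ep).
have p0 : 0 <= p by exact: pos_part_ge0.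
have py : p <= y x.
  rewrite /p; have [h1|h1] := leP 0 (y x - ep).
    by rewrite pos_partE// gerBl ltW.
  by rewrite pos_part0 ltW.
pose t := p / y x.
have t0 : 0 <= t by rewrite divr_ge0// ltW.
have t1 : t <= 1 by rewrite ler_pdivrMr// mul1r.
pose k := h x / y x.
have kM : `|k| <= M.
  by rewrite /k normrM normfV (gtr0_norm y0) ler_pdivrMr// hM.
(* In terms of the ratios t = p / y in [0, 1] and k = h / y, bounded by [M], no denominator is left:
   the bound is uniform in ep. *)
have -> : g ep x = 2 * (t * (1 - t)) * (dy x * k) + t ^+ 2 * dh x.
  by rewrite /g -/p /t /k; field.
apply: (le_trans (ler_normD _ _)); apply: lerD.
  rewrite normrM -mulrA; apply: (@le_trans _ _ (2 * `|dy x * k|)).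
    rewrite ler_wpM2r// ger0_norm; last by rewrite mulr_ge0// mulr_ge0// subr_ge0.
    rewrite -[leRHS]mulr1 ler_wpM2l// -[leRHS]mul1r ler_pM// ?subr_ge0//.
    by rewrite gerBl.
  by rewrite ler_wpM2l// normrM ler_pM// dyM.
rewrite normrM -[leRHS]mul1r ler_pM// ?dhM//.
by rewrite ger0_norm ?sqr_ge0// exprn_ile1.
Qed.

(** The set y > 0 may have any number of components. The cut-off functions vanish at [a] and [b], so
    their derivatives have integral exactly 0, and these derivatives converge boundedly to the
    integrand as ep tends to 0. *)
Lemma slice_integral0 : (\int[mu]_(x in `[a, b]) (if 0 < y x then dh x else 0)%:E = 0)%E.
Proof.
pose ep (n : nat) : R := n.+1%:R^-1.
have ep0 n : 0 < ep n by rewrite invr_gt0.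
have C : (\int[mu]_(x in `[a, b]) (g (ep n) x)%:E)%E @[n --> \oo] -->
   (\int[mu]_(x in `[a, b]) (if 0 < y x then dh x else 0)%:E)%E.
  apply: (@dominated_cvg _ _ _ mu `[a, b]%classic (measurable_itv _)
    (fun n x => (g (ep n) x)%:E) _ (fun=> (2 * M * M + M)%:E)).
  - move=> n; apply/measurable_EFinP; apply: subspace_continuous_measurable_fun.
      exact: measurable_itv.
    by apply: continuous_in_subspaceT => x; rewrite inE/= in_itv/=; exact: cg.
  - move=> x; rewrite /= in_itv/= => xab; apply: cvg_EFin; first by exact: nearW.
    have epc : ep n @[n --> \oo] --> (0 : R) by exact: cvg_harmonic.
    have [y0|y0] := ltP 0 (y x); last first.
      have Z n : g (ep n) x = 0.
        rewrite /g pos_part0 ?expr0n/= ?mulr0 ?mul0r ?addr0//.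
        by rewrite subr_le0 (le_trans y0)// ltW.
      by rewrite /comp/=; under eq_fun do rewrite Z; exact: cvg_cst.
    have yN : y x != 0 by rewrite gt_eqF.
    have pc : pos_part (y x - ep n) @[n --> \oo] --> y x.
      rewrite -[X in _ --> X](pos_partE (ltW y0)).
      have k : y x - ep n @[n --> \oo] --> y x.
        by rewrite -[X in _ --> X]subr0; apply: cvgB; [exact: cvg_cst|exact: epc].
      exact: (continuous_cvg _ (@pos_part_cont (y x)) k).
    have -> : dh x = 2 * y x * dy x * (h x / y x ^+ 2)
        + y x ^+ 2 * (dh x / y x ^+ 2 - 2 * h x * dy x / y x ^+ 3) by field.
    rewrite /comp/= /g; apply: cvgD; apply: cvgM; try exact: cvg_cst.
    + apply: cvgM; last exact: cvg_cst.
      by apply: cvgM; [exact: cvg_cst|exact: pc].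
    + by rewrite expr2; under eq_fun do rewrite expr2; exact: cvgM.
  - by [].
  - apply: (@bounded_integrable _ _ _ mu `[a, b]%classic (fun=> 2 * M * M + M) `|2 * M * M + M|).
    + exact: measurable_itv.
    + exact: (mu_itv_lty (a := a) (b := b)).
    + exact: measurable_cst.
    + by [].
  - by move=> n x; rewrite /= in_itv/= => xab; rewrite lee_fin g_le.
have Z : (\int[mu]_(x in `[a, b]) (g (ep n) x)%:E)%E @[n --> \oo] --> (0 : \bar R)%E.
  by under eq_fun do rewrite int_g//; exact: cvg_cst.
exact: (cvg_unique _ C Z).
Qed.

End Slice.

(** * Vanishing triple integrals, one variable at a time *)

Section Box.
Context {R : realType}.
Notation mu := (@lebesgue_measure R).
Notation mu3 := ((mu \x mu) \x mu)%E.
Variables (I J K : set R) (f : R * R * R -> R) (M : R).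
Hypotheses (mI : measurable I) (mJ : measurable J) (mK : measurable K).
Hypotheses (fI : (mu I < +oo)%E) (fJ : (mu J < +oo)%E) (fK : (mu K < +oo)%E).
Hypothesis mf : measurable_fun ((I `*` J) `*` K) f.
Hypothesis fM : forall q, ((I `*` J) `*` K) q -> `|f q| <= M.

Let mIJ : measurable (I `*` J). Proof. exact: measurableX. Qed.
Let fIJ : ((mu \x mu)%E (I `*` J) < +oo)%E. Proof. exact: measure_setX_lty. Qed.

Lemma box_integrable : mu3.-integrable ((I `*` J) `*` K) (EFin \o f).
Proof.
apply: (@bounded_integrable _ _ _ mu3 ((I `*` J) `*` K) f M) => //.
- exact: measurableX.
- exact (@measure_setX_lty _ _ _ _ R (sigma_finite_prod mu mu) mu _ _ mIJ mK fIJ fK).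
Qed.

Let slice_integrable z : K z -> (mu \x mu)%E.-integrable (I `*` J) (EFin \o (fun p => f (p, z))).
Proof.
move=> Kz; apply: (@bounded_integrable _ _ _ (mu \x mu)%E (I `*` J) (fun p => f (p, z)) M) => //.
- exact: (measurable_slice2 mIJ mK mf Kz).
- by move=> p pIJ; exact: fM.
Qed.

Lemma box_integral0_3 : (forall x y, I x -> J y -> \int[mu]_(z in K) (f ((x, y), z))%:E = 0)%E ->
  (\int[mu3]_(q in (I `*` J) `*` K) (f q)%:E = 0)%E.
Proof.
move=> h; have E := @integral_setX1 _ _ _ _ R (sigma_finite_prod mu mu) mu _ _ f mIJ mK box_integrable.
by apply: (etrans E); apply: integral0_eq => -[x y] [] /=; exact: h.
Qed.

Lemma box_integral0_2 : (forall x z, I x -> K z -> \int[mu]_(y in J) (f ((x, y), z))%:E = 0)%E ->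
  (\int[mu3]_(q in (I `*` J) `*` K) (f q)%:E = 0)%E.
Proof.
move=> h; have E := @integral_setX2 _ _ _ _ R (sigma_finite_prod mu mu) mu _ _ f mIJ mK box_integrable.
apply: (etrans E); apply: integral0_eq => z Kz.
have E1 := @integral_setX1 _ _ _ _ R mu mu _ _ (fun p => f (p, z)) mI mJ (slice_integrable Kz).
by apply: (etrans E1); apply: integral0_eq => x Ix; exact: h.
Qed.

Lemma box_integral0_1 : (forall y z, J y -> K z -> \int[mu]_(x in I) (f ((x, y), z))%:E = 0)%E ->
  (\int[mu3]_(q in (I `*` J) `*` K) (f q)%:E = 0)%E.
Proof.
move=> h; have E := @integral_setX2 _ _ _ _ R (sigma_finite_prod mu mu) mu _ _ f mIJ mK box_integrable.
apply: (etrans E); apply: integral0_eq => z Kz.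
have E1 := @integral_setX2 _ _ _ _ R mu mu _ _ (fun p => f (p, z)) mI mJ (slice_integrable Kz).
by apply: (etrans E1); apply: integral0_eq => x Ix; exact: h.
Qed.

End Box.

(** Continuity on r > 0 in composed form: the same fact then serves functions of all three variables
    and their one-variable slices. *)
Definition chart_cont (R : realType) (F : R -> R -> R -> R) : Prop :=
  forall (T : topologicalType) (x : T) (r f z : T -> R), 0 < r x ->
  {for x, continuous r} -> {for x, continuous f} -> {for x, continuous z} ->
  {for x, continuous (fun t => F (r t) (f t) (z t))}.

Lemma chart_cont3 (R : realType) (F : R -> R -> R -> R) (q : R * R * R) :
  chart_cont F -> 0 < q.1.1 -> {for q, continuous (fun q => F q.1.1 q.1.2 q.2)}.
Proof.
move=> cF q0; apply: (cF _ q (fun q => q.1.1) (fun q => q.1.2) (fun q => q.2) q0).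
- exact: (continuous_comp (@cont_fst _ _ q) (@cont_fst _ _ q.1)).
- exact: (continuous_comp (@cont_fst _ _ q) (@cont_snd _ _ q.1)).
- exact: cont_snd.
Qed.

(** * Bounds for the region V < -1 *)

Section HillRegion.
Context {R : realType}.
Variables (beta e : R).
Hypotheses (b0 : 0 < beta) (b1 : beta < 1) (e0 : 0 < e) (e1 : e < 1).
Hypothesis hbe : beta ^+ 2 + e ^+ 2 < 1.

Local Notation w := (wcoef beta e).
Local Notation cc := (ccoef beta).
Local Notation kc := (kcoef beta).
Local Notation d := (dist beta).
Local Notation y := (ypot beta e).

Definition rmin : R := beta * w / 2.
Definition rmax : R := beta^-1.
Definition zmax : R := cc / (1 - beta ^+ 2 / (1 - e ^+ 2)).

Lemma ecc_gap : 0 < 1 - beta ^+ 2 / (1 - e ^+ 2).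
Proof.
have h := hbe; have q0 : 0 < 1 - e ^+ 2 by have := sqr_ge0 beta; move=> ?; lra.
by rewrite subr_gt0 ltr_pdivrMr//; lra.
Qed.

Lemma kcoef_ge1 : 1 <= kc.
Proof. by have [h1 h2] := (b0, b1); rewrite /kcoef ler_pdivlMr; lra. Qed.

Lemma dist_ge_r (r z : R) : 0 < r -> r <= d r z.
Proof.
move=> r0; have h := dist_arg_gt0 b0 b1 z r0.
have E : r = Num.sqrt (r ^+ 2) by rewrite sqrtr_sqr gtr0_norm.
rewrite {1}E /dist ler_sqrt ?(ltW h)//.
by rewrite lerDl mulr_ge0 ?sqr_ge0// (ltW (kcoef_gt0 b0 b1)).
Qed.

Lemma dist_ge_z (r z : R) : 0 < r -> `|z| <= d r z.
Proof.
move=> r0; have h := dist_arg_gt0 b0 b1 z r0.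
rewrite /dist -sqrtr_sqr ler_sqrt ?(ltW h)//.
have := kcoef_ge1; have := sqr_ge0 z; have := sqr_ge0 r => h1 h2 h3.
have : 0 <= (kc - 1) * z ^+ 2 by rewrite mulr_ge0// subr_ge0.
by move=> ?; lra.
Qed.

(** With u = 1 / r >= v = 1 / dist, V < -1 reads w u^2 / 2 - u - cc v < -1. Replacing v by u bounds
    r on both sides. Completing the square instead, w u^2 / 2 - u >= - beta^2 / (1 - e^2), so v is
    bounded below by a number that is positive because beta^2 + e^2 < 1. *)
Lemma ypot_gt0_bounds (r z : R) : 0 < r -> 0 < y r z -> [/\ rmin < r, r < rmax & `|z| < zmax].
Proof.
move=> r0; rewrite /ypot PotE// => y0.
have h := dist_gt0 b0 b1 z r0; have hr := dist_ge_r z r0; have hz := dist_ge_z z r0.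
have w0 : 0 < w by exact: wcoef_gt0.
have c0 : 0 < cc by exact: ccoef_gt0.
have gap := ecc_gap.
pose u := r^-1; pose v := (d r z)^-1.
have u0 : 0 < u by rewrite invr_gt0.
have v0 : 0 < v by rewrite invr_gt0.
have vu : v <= u by rewrite lef_pV2 ?posrE.
have c1 : cc + 1 = beta^-1 by rewrite /ccoef; field; rewrite gt_eqF.
have E : w * u ^+ 2 / 2 - u - cc * v < - 1.
  suff -> : w * u ^+ 2 / 2 - u - cc * v = w / (2 * r ^+ 2) - r^-1 - cc / d r z by lra.
  by rewrite /u /v; field; rewrite !gt_eqF.
have E1 : w * u ^+ 2 / 2 + 1 < beta^-1 * u.
  have : cc * v <= cc * u by rewrite ler_pM2l.
  by rewrite -c1 => ?; lra.
have i0 : 0 < beta^-1 by rewrite invr_gt0.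
have ru : r * u = 1 by rewrite /u divff// gt_eqF.
split.
- have k : w * u / 2 < beta^-1.
    rewrite -(ltr_pM2r u0); apply: le_lt_trans E1.
    by rewrite -subr_ge0 (_ : _ - _ = 1 :> R)//; ring.
  rewrite /rmin; have k2 : w * u / 2 * (beta * r) < beta^-1 * (beta * r) by rewrite ltr_pM2r// mulr_gt0.
  have k3 : beta^-1 * (beta * r) = r by field; rewrite gt_eqF.
  have k4 : w * u / 2 * (beta * r) = beta * w / 2 * (r * u) by ring.
  by rewrite k3 k4 ru mulr1 in k2.
- rewrite /rmax; have k1 : 1 < beta^-1 * u.
    apply: le_lt_trans E1; rewrite lerDr divr_ge0// mulr_ge0 ?sqr_ge0//; exact: ltW.
  have k2 : 1 * r < beta^-1 * u * r by rewrite ltr_pM2r.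
  by rewrite mul1r -mulrA (mulrC u) ru mulr1 in k2.
- apply: (le_lt_trans hz); rewrite /zmax ltr_pdivlMr//.
  have E2 : 1 - beta ^+ 2 / (1 - e ^+ 2) < cc * v.
    have q0 : 0 < 1 - e ^+ 2 by have := sqr_ge0 beta; have := hbe; move=> ? ?; lra.
    have k : beta ^+ 2 / (1 - e ^+ 2) = (2 * w)^-1.
      by rewrite /wcoef; field; rewrite !gt_eqF//=.
    have k1 : - (2 * w)^-1 <= w * u ^+ 2 / 2 - u.
      rewrite -subr_ge0 (_ : _ - _ = w / 2 * (u - w^-1) ^+ 2); last by field; rewrite gt_eqF.
      by rewrite mulr_ge0 ?sqr_ge0// divr_ge0// ltW.
    by rewrite k; lra.
  have k2 : d r z * (1 - beta ^+ 2 / (1 - e ^+ 2)) < d r z * (cc * v) by rewrite ltr_pM2l.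
  by rewrite mulrCA divff ?mulr1 ?gt_eqF// in k2.
Qed.

Lemma rmin_gt0 : 0 < rmin.
Proof. by rewrite divr_gt0// mulr_gt0// wcoef_gt0. Qed.

Lemma rmin_lt_max : rmin < rmax.
Proof.
have h := (b0, e0, e1); have q1 : (1 - e ^+ 2) / 4 < 1 by have := sqr_ge0 e; move=> ?; lra.
rewrite /rmin /rmax /wcoef (_ : _ / 2 = (1 - e ^+ 2) / 4 * beta^-1); last by field; rewrite gt_eqF.
by rewrite gtr_pMl// invr_gt0.
Qed.

Lemma zmax_gt0 : 0 < zmax.
Proof. by rewrite divr_gt0 ?ecc_gap// ccoef_gt0. Qed.

Section Continuity.
Variable lam : 'rV[R]_4 -> 'rV[R]_4.
Hypothesis hlam : is_contact_form beta e lam.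
Context (T : topologicalType) (x : T) (r f z : T -> R).
Hypotheses (r0 : 0 < r x) (cr : {for x, continuous r}) (cf : {for x, continuous f})
  (cz : {for x, continuous z}).

Lemma cont_dist : {for x, continuous (fun t => d (r t) (z t))}.
Proof. by rewrite /dist; cont. Qed.

Lemma cont_ypot : {for x, continuous (fun t => y (r t) (z t))}.
Proof.
under [X in {for _, continuous X}]eq_fun do rewrite /ypot PotE//.
have h := dist_gt0 b0 b1 (z x) r0; have k := cont_dist.
have k1 : {for x, continuous (fun t => w / (2 * r t ^+ 2))}.
  apply: cont_div; [by rewrite mulf_neq0// expf_neq0// gt_eqF|cont|cont].
have k2 : {for x, continuous (fun t => (r t)^-1)}.
  by apply: cont_inv => //; rewrite gt_eqF.
have k3 : {for x, continuous (fun t => cc / d (r t) (z t))}.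
  by apply: cont_div; [rewrite gt_eqF|cont|exact: k].
exact (cont_mul (@cont_cst _ _ _ _) (cont_add (@cont_cst _ _ _ _)
  (cont_opp (cont_add (cont_add k1 (cont_opp k2)) (cont_opp k3))))).
Qed.

Lemma cont_momentum : {for x, continuous (fun t => momentum beta e (r t) (z t))}.
Proof. exact: cont_sqrt cont_ypot. Qed.

Lemma cont_Vr : {for x, continuous (fun t => Vr beta e (r t) (z t))}.
Proof.
have h := dist_gt0 b0 b1 (z x) r0; have k := cont_dist.
have k1 : {for x, continuous (fun t => - w / r t ^+ 3)}.
  apply: cont_div; [by rewrite expf_neq0// gt_eqF|cont|cont].
have k2 : {for x, continuous (fun t => 1 / r t ^+ 2)}.
  apply: cont_div; [by rewrite expf_neq0// gt_eqF|cont|cont].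
have k3 : {for x, continuous (fun t => cc * r t / d (r t) (z t) ^+ 3)}.
  apply: cont_div; [by rewrite expf_neq0// gt_eqF|cont|cont].
exact (cont_add (cont_add k1 k2) k3).
Qed.

Lemma cont_Vz : {for x, continuous (fun t => Vz beta (r t) (z t))}.
Proof.
have h := dist_gt0 b0 b1 (z x) r0; have k := cont_dist.
apply: cont_div; [by rewrite expf_neq0// gt_eqF|cont|cont].
Qed.

Lemma cont_chart : {for x, continuous (fun t => chart beta e (r t) (f t) (z t))}.
Proof.
have k := cont_momentum.
change {for x, continuous (fun t => phase (momentum beta e (r t) (z t) * cos (f t))
  (momentum beta e (r t) (z t) * sin (f t)) (r t) (z t))}.
apply: cont_phase; cont.
Qed.

Let cl : {for x, continuous (fun t => lam (chart beta e (r t) (f t) (z t)))}.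
Proof.
exact: (continuous_comp cont_chart (differentiable_continuous (contact_differentiable hlam _))).
Qed.

Lemma cont_radial_coef : {for x, continuous (fun t => radial_coef beta e lam (r t) (f t) (z t))}.
Proof.
by have [k1 k2 _ _] := cont_coords cl; rewrite /radial_coef; cont.
Qed.

Lemma cont_axial_coef : {for x, continuous (fun t => axial_coef beta e lam (r t) (f t) (z t))}.
Proof.
by have [k1 k2 _ _] := cont_coords cl; rewrite /axial_coef; cont.
Qed.

Lemma cont_dflux_r : {for x, continuous (fun t => dflux_r beta e lam (r t) (f t) (z t))}.
Proof.
have k1 := cont_Vr; have k2 := cont_momentum; have k3 := cont_radial_coef.
have kd : {for x, continuous (fun t => 'D_(Ur beta e (r t) (f t) (z t)) lam (chart beta e (r t) (f t) (z t)))}.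
  apply: (cont_derive (contact_differentiable hlam) (contact_C1 hlam) cont_chart); cont.
have [k5 k6 _ _] := cont_coords kd.
by rewrite /dflux_r; apply: cont_add; [apply: cont_mul k3; cont|cont].
Qed.

Lemma cont_dflux_z : {for x, continuous (fun t => dflux_z beta e lam (r t) (f t) (z t))}.
Proof.
have k1 := cont_Vz; have k2 := cont_momentum; have k3 := cont_axial_coef.
have kd : {for x, continuous (fun t => 'D_(Uz beta e (r t) (f t) (z t)) lam (chart beta e (r t) (f t) (z t)))}.
  apply: (cont_derive (contact_differentiable hlam) (contact_C1 hlam) cont_chart); cont.
have [k5 k6 _ _] := cont_coords kd.
by rewrite /dflux_z; apply: cont_add; [apply: cont_mul k3; cont|cont].
Qed.

Lemma cont_dflux_phi : {for x, continuous (fun t => dflux_phi beta e lam (r t) (f t) (z t))}.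
Proof.
have k1 := cont_Vz; have k2 := cont_Vr; have k3 := cont_momentum.
have kd : {for x, continuous (fun t => 'D_(Uf beta e (r t) (f t) (z t)) lam (chart beta e (r t) (f t) (z t)))}.
  apply: (cont_derive (contact_differentiable hlam) (contact_C1 hlam) cont_chart); cont.
have [l1 l2 l3 l4] := cont_coords kd; have [l5 l6 l7 l8] := cont_coords cl.
by rewrite /dflux_phi /=; cont.
Qed.

End Continuity.
End HillRegion.

(** * Integrals over the chart domain *)

Section ChartIntegrals.
Context {R : realType}.
Variables (beta e : R).
Hypotheses (b0 : 0 < beta) (b1 : beta < 1) (e0 : 0 < e) (e1 : e < 1).
Hypothesis hbe : beta ^+ 2 + e ^+ 2 < 1.
Notation mu := (@lebesgue_measure R).
Notation mu3 := ((mu \x mu) \x mu)%E.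

Local Notation y := (ypot beta e).
Local Notation rm := (rmin beta e).
Local Notation rM := (rmax beta).
Local Notation zM := (zmax beta e).
Local Notation D := (chart_dom beta e).

Let I : set R := `[rm, rM]%classic.
Let J : set R := `[0, 2 * pi[%classic.
Let Jc : set R := `[0, 2 * pi]%classic.
Let K : set R := `[- zM, zM]%classic.
Let box : set (R * R * R) := (I `*` J) `*` K.

Definition positive_region : set (R * R * R) := [set q | 0 < q.1.1 /\ 0 < y q.1.1 q.2].

Lemma open_positive_region : open positive_region.
Proof.
rewrite openE => q [r0 y0].
have c : {for q, continuous (fun q : R * R * R => q.1.1)}.
  exact: (continuous_comp (@cont_fst _ _ q) (@cont_fst _ _ q.1)).
apply: filterI; first by move: c => /cvgr_gt; apply.
have cy : {for q, continuous (fun q : R * R * R => y q.1.1 q.2)}.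
  exact (@cont_ypot R beta e b0 b1 e0 e1 _ q (fun q => q.1.1) (fun q => q.2) r0 c (@cont_snd _ _ q)).
by move: cy => /cvgr_gt; apply.
Qed.

Lemma chart_domP r f z : D ((r, f), z) <-> [/\ 0 < r, 0 <= f < 2 * pi & 0 < y r z].
Proof.
rewrite /chart_dom/= /ypot; split=> -[h1 h2 h3]; split=> //; lra.
Qed.

Lemma chart_domE : D = positive_region `&` ((setT `*` J) `*` setT).
Proof.
apply/seteqP; split=> -[[r f] z].
  by move=> /chart_domP[r0 f0 y0]; split=> //; split=> //; split=> //=; rewrite in_itv.
by move=> [[/= r0 y0] [[_ /= f0] _]]; apply/chart_domP; split=> //; rewrite /J/= in_itv/= in f0.
Qed.

Lemma measurable_chart_dom : measurable D.
Proof.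
rewrite chart_domE; apply: measurableI; first exact: open_measurable3 open_positive_region.
apply: measurableX; last exact: measurableT.
by apply: measurableX; [exact: measurableT|exact: measurable_itv].
Qed.

Let mI : measurable I. Proof. exact: measurable_itv. Qed.
Let mJ : measurable J. Proof. exact: measurable_itv. Qed.
Let mK : measurable K. Proof. exact: measurable_itv. Qed.
Let fI : (mu I < +oo)%E. Proof. exact: (mu_itv_lty (a := rm) (b := rM)). Qed.
Let fJ : (mu J < +oo)%E.
Proof.
apply: (mu_itv_lty (a := 0) (b := 2 * pi)) => x /=; rewrite !in_itv/= => /andP[-> /ltW ->//].
Qed.
Let fK : (mu K < +oo)%E. Proof. exact: (mu_itv_lty (a := - zM) (b := zM)). Qed.
Let mbox : measurable box. Proof. by apply: measurableX => //; exact: measurableX. Qed.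
Let fbox : (mu3 box < +oo)%E.
Proof.
exact (@measure_setX_lty _ _ _ _ R (sigma_finite_prod mu mu) mu _ _
  (measurableX mI mJ) mK (@measure_setX_lty _ _ _ _ R mu mu _ _ mI mJ fI fJ) fK).
Qed.

Lemma chart_dom_sub_box : D `<=` box.
Proof.
move=> [[r f] z] /chart_domP[r0 f0 y0].
have [h1 h2 h3] := ypot_gt0_bounds b0 b1 e0 e1 hbe r0 y0.
split; last by rewrite /K/= in_itv/=; move: h3; rewrite ltr_norml => /andP[/ltW -> /ltW ->].
by split; [rewrite /I/= in_itv/= !ltW|rewrite /J/= in_itv/=].
Qed.

Section Integrand.
Variable F : R -> R -> R -> R.
Hypothesis cF : chart_cont F.
Let f (q : R * R * R) := F q.1.1 q.1.2 q.2.

(** The integrands are continuous on all of r > 0, also where [ypot] is negative and the square root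
    takes the value 0, so compactness of the box with the closed angle interval gives the bound. *)
Lemma box_bound : exists M, forall r g z, I r -> Jc g -> K z -> `|F r g z| <= M.
Proof.
have cK : compact ((I `*` Jc) `*` K).
  by apply: compact_setX; [apply: compact_setX|]; exact: segment_compact.
have [M hM] : exists M, forall q, ((I `*` Jc) `*` K) q -> `|f q| <= M.
  apply: (cont_compact_bounded cK) => q [[/= qI _] _]; apply: (chart_cont3 cF).
  by move: qI; rewrite /I/= in_itv/= => /andP[h _]; apply: lt_le_trans h; exact: rmin_gt0.
by exists M => r g z rI gJ zK; exact: (hM ((r, g), z)).
Qed.

Let mf : measurable_fun D f.
Proof.
have m1 : measurable_fun positive_region f.
  apply: cont_measurable3; first exact: open_positive_region.
  by move=> q [r0 _]; exact: (chart_cont3 cF).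
apply: measurable_funS m1; first exact: open_measurable3 open_positive_region.
by rewrite chart_domE; exact: subIsetl.
Qed.

Let JJc g : J g -> Jc g.
Proof. by rewrite /J /Jc/= !in_itv/= => /andP[-> /ltW]. Qed.

Let fbd : exists M, forall q, box q -> `|(f \_ D) q| <= M.
Proof.
have [M hM] := box_bound; exists `|M| => q [[/= qI qJ] qK]; rewrite patchE; case: ifP => _.
  by apply: le_trans (ler_norm _); apply: hM => //; exact: JJc.
by rewrite normr0.
Qed.

Let mfD : measurable_fun box (f \_ D).
Proof.
apply/(measurable_restrict f measurable_chart_dom mbox).
by apply: measurable_funS mf; [exact: measurable_chart_dom|exact: subIsetr].
Qed.

Lemma chart_dom_integrable : mu3.-integrable D (EFin \o f).
Proof.
have [M hM] := fbd.
apply: (@bounded_integrable _ _ _ mu3 D f M) => //.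
- exact: measurable_chart_dom.
- apply: le_lt_trans fbox; apply: le_measure; rewrite ?inE//.
    exact: measurable_chart_dom.
  exact: chart_dom_sub_box.
- move=> q Dq; have := hM q (chart_dom_sub_box Dq).
  by rewrite patchE mem_set.
Qed.

Let int_box : (\int[mu3]_(q in D) (f q)%:E = \int[mu3]_(q in box) ((f \_ D) q)%:E)%E.
Proof.
have E : D = box `&` D by rewrite setIidr//; exact: chart_dom_sub_box.
rewrite {1}E integral_mkcondr; apply: eq_integral => q _.
by rewrite !patchE; case: ifP.
Qed.

Let patchF r g z : I r -> J g -> (f \_ D) ((r, g), z) = if 0 < y r z then F r g z else 0.
Proof.
rewrite /I /J/= !in_itv/= => /andP[rI _] gJ.
have r0 : 0 < r by apply: lt_le_trans rI; exact: rmin_gt0.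
rewrite patchE; have -> : (((r, g), z) \in D) = (0 < y r z); last by [].
apply/idP/idP => [|yp]; first by rewrite inE => /chart_domP[].
by rewrite inE; apply/chart_domP.
Qed.

Lemma chart_dom_integral0_1 :
  (forall g z, J g -> K z -> \int[mu]_(r in I) (if 0 < y r z then F r g z else 0)%:E = 0)%E ->
  (\int[mu3]_(q in D) (F q.1.1 q.1.2 q.2)%:E = 0)%E.
Proof.
move=> h; rewrite -/(f _) int_box; have [M hM] := fbd.
apply: (box_integral0_1 mI mJ mK fI fJ fK mfD hM) => g z gJ zK.
rewrite -(h g z gJ zK); apply: eq_integral => r; rewrite inE => rI.
by rewrite patchF.
Qed.

Lemma chart_dom_integral0_2 :
  (forall r z, I r -> K z -> \int[mu]_(g in J) (if 0 < y r z then F r g z else 0)%:E = 0)%E ->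
  (\int[mu3]_(q in D) (F q.1.1 q.1.2 q.2)%:E = 0)%E.
Proof.
move=> h; rewrite -/(f _) int_box; have [M hM] := fbd.
apply: (box_integral0_2 mI mJ mK fI fJ fK mfD hM) => r z rI zK.
rewrite -(h r z rI zK); apply: eq_integral => g; rewrite inE => gJ.
by rewrite patchF.
Qed.

Lemma chart_dom_integral0_3 :
  (forall r g, I r -> J g -> \int[mu]_(z in K) (if 0 < y r z then F r g z else 0)%:E = 0)%E ->
  (\int[mu3]_(q in D) (F q.1.1 q.1.2 q.2)%:E = 0)%E.
Proof.
move=> h; rewrite -/(f _) int_box; have [M hM] := fbd.
apply: (box_integral0_3 mI mJ mK fI fJ fK mfD hM) => r g rI gJ.
rewrite -(h r g rI gJ); apply: eq_integral => z; rewrite inE => zK.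
by rewrite patchF.
Qed.

End Integrand.
End ChartIntegrals.

(** * The contact volume as the integral of [ypot] *)

Section ContactVolume.
Context {R : realType}.
Variables (beta e : R).
Hypotheses (b0 : 0 < beta) (b1 : beta < 1) (e0 : 0 < e) (e1 : e < 1).
Hypothesis hbe : beta ^+ 2 + e ^+ 2 < 1.
Variable lam : 'rV[R]_4 -> 'rV[R]_4.
Hypothesis hlam : is_contact_form beta e lam.
Notation mu := (@lebesgue_measure R).
Notation mu3 := ((mu \x mu) \x mu)%E.

Local Notation y := (ypot beta e).
Local Notation rm := (rmin beta e).
Local Notation rM := (rmax beta).
Local Notation zM := (zmax beta e).
Local Notation D := (chart_dom beta e).

Let cy : chart_cont (fun r _ z => y r z).
Proof. by move=> T x r f z r0 cr _ cz; exact: cont_ypot. Qed.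
Let cVr : chart_cont (fun r _ z => - 2 * Vr beta e r z).
Proof. by move=> T x r f z r0 cr _ cz; apply: cont_mul; [exact: cont_cst|exact: cont_Vr]. Qed.
Let cVz : chart_cont (fun r _ z => - 2 * Vz beta r z).
Proof. by move=> T x r f z r0 cr _ cz; apply: cont_mul; [exact: cont_cst|exact: cont_Vz]. Qed.
Let cdr : chart_cont (dflux_r beta e lam) := @cont_dflux_r R beta e b0 b1 e0 e1 lam hlam.
Let cdz : chart_cont (dflux_z beta e lam) := @cont_dflux_z R beta e b0 b1 e0 e1 lam hlam.
Let cdphi : chart_cont (dflux_phi beta e lam) := @cont_dflux_phi R beta e b0 b1 e0 e1 lam hlam.

Let rm0 : 0 < rm. Proof. exact: rmin_gt0. Qed.

Let r_gt0 r : rm <= r <= rM -> 0 < r.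
Proof. by move=> /andP[h _]; exact: lt_le_trans h. Qed.

Let JJc g : (`[0, 2 * pi[%classic : set R) g -> (`[0, 2 * pi]%classic : set R) g.
Proof. by rewrite /= !in_itv/= => /andP[-> /ltW]. Qed.

Let ypot_le0 r z : 0 < r -> ~ [/\ rm < r, r < rM & `|z| < zM] -> y r z <= 0.
Proof.
move=> r0 h; rewrite leNgt; apply/negP => yp; apply: h.
exact: (ypot_gt0_bounds b0 b1 e0 e1 hbe r0 yp).
Qed.

Let bound3 (F1 F2 F3 : R -> R -> R -> R) :
  chart_cont F1 -> chart_cont F2 -> chart_cont F3 -> exists M, forall r g z,
  rm <= r <= rM -> (`[0, 2 * pi[%classic : set R) g -> - zM <= z <= zM ->
  [/\ `|F1 r g z| <= M, `|F2 r g z| <= M & `|F3 r g z| <= M].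
Proof.
move=> k1 k2 k3.
have [M1 h1] := box_bound b0 e0 e1 k1; have [M2 h2] := box_bound b0 e0 e1 k2.
have [M3 h3] := box_bound b0 e0 e1 k3.
exists (Num.max M1 (Num.max M2 M3)) => r g z rI /JJc gJ zI.
have rI' : (`[rm, rM]%classic : set R) r by rewrite /= in_itv.
have zI' : (`[- zM, zM]%classic : set R) z by rewrite /= in_itv.
by rewrite !le_max h1// h2// h3// !orbT.
Qed.

(** On a radial line [slice_integral0] applies: the flux is [ypot] times a bounded coefficient, and
    [ypot] is nonpositive at both ends of the box. The axial flux is treated alike. *)
Lemma integral_dflux_r : (\int[mu3]_(q in D) (dflux_r beta e lam q.1.1 q.1.2 q.2)%:E = 0)%E.
Proof.
apply: (chart_dom_integral0_1 b0 b1 e0 e1 hbe cdr) => g z gJ zK.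
have [M hM] := bound3 (@cont_radial_coef R beta e b0 b1 e0 e1 lam hlam) cVr cdr.
have zK' : - zM <= z <= zM by move: zK; rewrite /= in_itv.
apply: (@slice_integral0 R (y ^~ z) (fun r => - 2 * Vr beta e r z) (fun r => flux_r beta e lam r g z)
  (fun r => dflux_r beta e lam r g z) rm rM M).
- exact: rmin_lt_max.
- by move=> r rI'; exact: (der_ypot_r b0 b1 e0 e1 z (r_gt0 rI')).
- move=> r rI'.
  exact: (cVr (r := id) (f := fun=> g) (z := fun=> z) (r_gt0 rI') (@cvg_id _ _) (@cont_cst _ _ _ _) (@cont_cst _ _ _ _)).
- by move=> r rI' yp; exact: (der_flux_r b0 b1 e0 e1 hlam g (r_gt0 rI') yp).
- move=> r rI' _.
  exact: (cdr (r := id) (f := fun=> g) (z := fun=> z) (r_gt0 rI') (@cvg_id _ _) (@cont_cst _ _ _ _) (@cont_cst _ _ _ _)).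
- move=> r rI' yp; rewrite /flux_r normrM mulrC (gtr0_norm yp) ler_pM2r//.
  by have [] := hM r g z rI' gJ zK'.
- by move=> r rI'; have [] := hM r g z rI' gJ zK'.
- by move=> r rI' _; have [] := hM r g z rI' gJ zK'.
- by apply: ypot_le0 => // -[]; rewrite ltxx.
- by apply: ypot_le0 => [|[]]; [rewrite invr_gt0|rewrite ltxx].
Qed.

Lemma integral_dflux_z : (\int[mu3]_(q in D) (dflux_z beta e lam q.1.1 q.1.2 q.2)%:E = 0)%E.
Proof.
apply: (chart_dom_integral0_3 b0 b1 e0 e1 hbe cdz) => r g rI gJ.
have r0 : 0 < r by apply: r_gt0; move: rI; rewrite /= in_itv.
have [M hM] := bound3 (@cont_axial_coef R beta e b0 b1 e0 e1 lam hlam) cVz cdz.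
have rI' : rm <= r <= rM by move: rI; rewrite /= in_itv.
have z0 : 0 < zM by exact: zmax_gt0.
apply: (@slice_integral0 R (y r) (fun z => - 2 * Vz beta r z) (flux_z beta e lam r g)
  (dflux_z beta e lam r g) (- zM) zM M).
- by rewrite gtrN.
- by move=> z _; exact: (der_ypot_z b0 b1 e0 e1 z r0).
- move=> z _.
  exact: (cVz (r := fun=> r) (f := fun=> g) (z := id) r0 (@cont_cst _ _ _ _) (@cont_cst _ _ _ _) (@cvg_id _ _)).
- by move=> z _ yp; exact: (der_flux_z b0 b1 e0 e1 hlam g r0 yp).
- move=> z _ _.
  exact: (cdz (r := fun=> r) (f := fun=> g) (z := id) r0 (@cont_cst _ _ _ _) (@cont_cst _ _ _ _) (@cvg_id _ _)).
- move=> z zI yp; rewrite /flux_z normrM mulrC (gtr0_norm yp) ler_pM2r//.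
  by have [] := hM r g z rI' gJ zI.
- by move=> z zI; have [] := hM r g z rI' gJ zI.
- by move=> z zI _; have [] := hM r g z rI' gJ zI.
- by apply: ypot_le0 => // -[_ _]; rewrite normrN gtr0_norm// ltxx.
- by apply: ypot_le0 => // -[_ _]; rewrite gtr0_norm// ltxx.
Qed.

(** [ypot] is independent of the angle, so each angular slice of the domain is empty or a full
    circle, on which the flux is periodic. *)
Lemma integral_dflux_phi : (\int[mu3]_(q in D) (dflux_phi beta e lam q.1.1 q.1.2 q.2)%:E = 0)%E.
Proof.
apply: (chart_dom_integral0_2 b0 b1 e0 e1 hbe cdphi) => r z rI zK.
have r0 : 0 < r by apply: r_gt0; move: rI; rewrite /= in_itv.
have [yp|yp] := boolP (0 < y r z); last by rewrite integral0_eq.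
have cg g : {for g, continuous (fun g => dflux_phi beta e lam r g z)}.
  exact: (cdphi (r := fun=> r) (f := id) (z := fun=> z) r0 (@cont_cst _ _ _ _) (@cvg_id _ _) (@cont_cst _ _ _ _)).
have pi0 : 0 < 2 * pi :> R by rewrite mulr_gt0// pi_gt0.
rewrite integral_itv_bndo_bndc; last first.
  apply/measurable_EFinP; apply: subspace_continuous_measurable_fun.
    exact: measurable_itv.
  by apply: continuous_in_subspaceT => g _; exact: cg.
have d1 g : 0 <= g <= 2 * pi -> is_derive g 1 (fun g => flux_phi beta e lam r g z) (dflux_phi beta e lam r g z).
  by move=> _; exact: (der_flux_phi hlam).
have d2 (g : R) : 0 <= g <= 2 * pi -> {for g, continuous (fun g => dflux_phi beta e lam r g z)}.
  by move=> _; exact: cg.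
transitivity ((flux_phi beta e lam r (2 * pi) z - flux_phi beta e lam r 0 z)%:E)%E; first exact: (FTC_closed pi0 d1 d2).
have E1 : sin (2 * pi) = sin 0 :> R by rewrite mulr_natl sin2pi sin0.
have E2 : cos (2 * pi) = cos 0 :> R by rewrite mulr_natl cos2pi cos0.
by rewrite /flux_phi /chart E1 E2 subrr.
Qed.

Lemma contact_volumeE : contact_volume beta e lam =
  Rintegral mu3 D (fun q => y q.1.1 q.2).
Proof.
rewrite /contact_volume /surface_integral.
transitivity (Rintegral mu3 D (fun q => y q.1.1 q.2 + (dflux_r beta e lam q.1.1 q.1.2 q.2 +
   (dflux_z beta e lam q.1.1 q.1.2 q.2 + dflux_phi beta e lam q.1.1 q.1.2 q.2)))).
  apply: eq_Rintegral => -[[r f] z]; rewrite inE => /chart_domP[r0 f0 y0].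
  exact: (chart_vol_form b0 b1 e0 e1 hlam).
have mD := measurable_chart_dom b0 b1 e0 e1.
have iy := chart_dom_integrable b0 b1 e0 e1 hbe cy.
have i1 := chart_dom_integrable b0 b1 e0 e1 hbe cdr.
have i2 := chart_dom_integrable b0 b1 e0 e1 hbe cdz.
have i3 := chart_dom_integrable b0 b1 e0 e1 hbe cdphi.
have i23 : mu3.-integrable D (EFin \o (fun q : R * R * R => dflux_z beta e lam q.1.1 q.1.2 q.2 + dflux_phi beta e lam q.1.1 q.1.2 q.2)).
  exact: (@integrableD _ _ _ mu3 _ mD _ _ i2 i3).
have i123 : mu3.-integrable D (EFin \o (fun q : R * R * R => dflux_r beta e lam q.1.1 q.1.2 q.2 +
   (dflux_z beta e lam q.1.1 q.1.2 q.2 + dflux_phi beta e lam q.1.1 q.1.2 q.2))).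
  exact: (@integrableD _ _ _ mu3 _ mD _ _ i1 i23).
have E1 := @RintegralD _ _ _ mu3 D _ _ mD iy i123.
have E2 := @RintegralD _ _ _ mu3 D _ _ mD i1 i23.
have E3 := @RintegralD _ _ _ mu3 D _ _ mD i2 i3.
rewrite [LHS]E1 [X in _ + X]E2 [X in _ + (_ + X)]E3.
by rewrite /Rintegral integral_dflux_r integral_dflux_z integral_dflux_phi /= !addr0.
Qed.

End ContactVolume.

(** * Comparison with a Kepler-type function *)

Section Kepler.
Context {R : realType}.
Variables (beta e : R).
Hypotheses (b0 : 0 < beta) (b1 : beta < 1) (e0 : 0 < e) (e1 : e < 1).
Hypothesis hbe : beta ^+ 2 + e ^+ 2 < 1.
Local Notation w := (wcoef beta e).

Definition kdist (r z : R) : R := Num.sqrt (r ^+ 2 + (1 + 7 * beta) * z ^+ 2).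
(* Twice -1 - V, with the two attracting terms of V replaced by one Kepler term for
   the distance [kdist], which matches them to second order at z = 0. *)
Definition kep (r z : R) : R := 2 / (beta * kdist r z) - 2 - w / r ^+ 2.

Lemma sevenbeta_gt0 : 0 < 1 + 7 * beta. Proof. by have := b0; move=> ?; lra. Qed.

Lemma kdist_arg_gt0 r z : 0 < r -> 0 < r ^+ 2 + (1 + 7 * beta) * z ^+ 2.
Proof.
by move=> r0; rewrite ltr_pwDl ?exprn_gt0// mulr_ge0 ?sqr_ge0// ltW ?sevenbeta_gt0.
Qed.

Lemma kdist_gt0 r z : 0 < r -> 0 < kdist r z.
Proof. by move=> r0; rewrite sqrtr_gt0 kdist_arg_gt0. Qed.

Lemma sqr_kdist r z : 0 < r -> kdist r z ^+ 2 = r ^+ 2 + (1 + 7 * beta) * z ^+ 2.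
Proof. by move=> r0; rewrite sqr_sqrtr// ltW// kdist_arg_gt0. Qed.

(** Both sides being nonnegative, compare squares: times 1 - beta k^2, their difference is beta (1 -
    k)^2 (k^2 + 2 (1 - beta) k - beta), whose last factor is positive for beta < k <= 1. The double
    root k = 1 gives the equality case. *)
Lemma kepler_profile_ge (k x : R) : beta < k -> k <= 1 -> 0 < x ->
  x ^+ 2 * (1 - beta * k ^+ 2) = k ^+ 2 * (1 - beta) -> k - beta <= (1 - beta) * x ?= iff (k == 1).
Proof.
move=> bk k1 x0 E; have [h0 h1] := (b0, b1).
have bk2 : 0 < 1 - beta * k ^+ 2.
  have : beta * k ^+ 2 <= beta * 1 by rewrite ler_pM2l// exprn_ile1// ltW// (lt_trans h0).
  by move=> ?; lra.
have Q : 0 < k ^+ 2 + 2 * (1 - beta) * k - beta.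
  have : beta * k < k * k by rewrite ltr_pM2r// (lt_trans h0).
  have : 0 < (1 - beta) * (k - beta) by rewrite mulr_gt0// subr_gt0.
  have : 0 < (1 - beta) * beta by rewrite mulr_gt0// subr_gt0.
  by rewrite expr2; nra.
have F : (((1 - beta) * x) ^+ 2 - (k - beta) ^+ 2) * (1 - beta * k ^+ 2) =
    beta * (1 - k) ^+ 2 * (k ^+ 2 + 2 * (1 - beta) * k - beta).
  transitivity ((1 - beta) ^+ 2 * (x ^+ 2 * (1 - beta * k ^+ 2)) - (k - beta) ^+ 2 * (1 - beta * k ^+ 2)).
    by ring.
  by rewrite E; ring.
have bx : 0 <= (1 - beta) * x by rewrite mulr_ge0// ?subr_ge0 ltW.
have kb : 0 <= k - beta by rewrite subr_ge0 ltW.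
split.
  rewrite -(@ler_pXn2r _ 2)// -subr_ge0 -(pmulr_lge0 _ bk2) F.
  by rewrite mulr_ge0 ?(ltW Q)// mulr_ge0 ?sqr_ge0// ltW.
apply/idP/idP => /eqP h.
  move: F; rewrite h subrr mul0r => /esym/eqP.
  by rewrite !mulf_eq0 (gt_eqF h0) (gt_eqF Q) !orbF/= orbb subr_eq0 eq_sym.
have k0 : 1 - k = 0 by rewrite h subrr.
move: F; rewrite k0 expr0n/= mulr0 mul0r => /eqP.
rewrite mulf_eq0 (gt_eqF bk2) orbF subr_eq0 eqrXn2// => /eqP.
by rewrite eq_sym => ->.
Qed.

(** In k = r / kdist and x = r / dist the difference is a positive multiple of (1 - beta) x - (k -
    beta), and (1 - beta) dist^2 = kdist^2 - beta r^2 is the relation between k and x. *)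
Lemma kep_le_ypot r z : 0 < r -> 0 <= kep r z ->
  kep r z <= ypot beta e r z ?= iff (z == 0).
Proof.
move=> r0 kp; have n0 := kdist_gt0 z r0; have d0 := dist_gt0 b0 b1 z r0.
have w0 : 0 < w by exact: wcoef_gt0.
pose k := r / kdist r z; pose x := r / dist beta r z.
have k0 : 0 < k by rewrite divr_gt0.
have x0 : 0 < x by rewrite divr_gt0.
have s0 := sevenbeta_gt0; have bN : beta != 0 by rewrite gt_eqF.
have nr : r ^+ 2 <= kdist r z ^+ 2.
  by rewrite sqr_kdist// lerDl mulr_ge0 ?sqr_ge0// ltW.
have k1 : k <= 1.
  rewrite ler_pdivrMr// mul1r -(@ler_pXn2r _ 2)// ?nnegrE ltW//.
have kz : (k == 1) = (z == 0).
  rewrite /k; apply/idP/idP => [/eqP h|/eqP ->].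
    have E : r = kdist r z.
      by rewrite -[RHS]mul1r -h divfK// gt_eqF.
    have := sqr_kdist z r0; rewrite -E => /eqP.
    by rewrite eq_sym -subr_eq0 addrAC subrr add0r mulf_eq0 (gt_eqF s0)/= sqrf_eq0.
  by rewrite /kdist expr0n/= mulr0 addr0 sqrtr_sqr gtr0_norm// divff// gt_eqF.
have kbig : beta * (r + w / (2 * r)) <= k.
  rewrite -subr_ge0 (_ : _ - _ = beta * r / 2 * kep r z).
    by rewrite mulr_ge0// divr_ge0// mulr_ge0// ltW.
  by rewrite /kep /k; field; rewrite !gt_eqF.
(* By the inequality of arithmetic and geometric means, beta^2 (r + w / (2 r))^2 >= 2 beta^2 w = 1 -
   e^2 > beta^2. *)
have bk : beta < k.
  have h0 : 0 <= beta * (r + w / (2 * r)).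
    by rewrite mulr_ge0 ?(ltW b0)// addr_ge0 ?(ltW r0)// divr_ge0 ?(ltW w0)// mulr_ge0// ltW.
  rewrite -(@ltr_pXn2r _ 2)// ?nnegrE ?(ltW b0) ?(ltW k0)//.
  apply: (@lt_le_trans _ _ ((beta * (r + w / (2 * r))) ^+ 2)); last by rewrite ler_pXn2r// ?nnegrE ?(ltW k0).
  apply: (@lt_le_trans _ _ (1 - e ^+ 2)); first by have := hbe; move=> ?; lra.
  rewrite -subr_ge0 (_ : _ - _ = beta ^+ 2 * (r - w / (2 * r)) ^+ 2).
    by rewrite mulr_ge0 ?sqr_ge0.
  by rewrite /wcoef; field; rewrite bN gt_eqF.
have E : x ^+ 2 * (1 - beta * k ^+ 2) = k ^+ 2 * (1 - beta).
  have D : dist beta r z ^+ 2 * (1 - beta) = kdist r z ^+ 2 - beta * r ^+ 2.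
    by rewrite sqr_dist// sqr_kdist// /kcoef; field; rewrite subr_eq0 gt_eqF.
  apply: (@mulIf _ (dist beta r z ^+ 2 * kdist r z ^+ 2)).
    by rewrite mulf_neq0// expf_neq0// gt_eqF.
  transitivity (r ^+ 2 * (kdist r z ^+ 2 - beta * r ^+ 2)).
    by rewrite /x /k; field; rewrite !gt_eqF.
  by rewrite -D /k; field; rewrite gt_eqF.
have [H1 H2] := kepler_profile_ge bk k1 x0 E.
have F : ypot beta e r z - kep r z = 2 / (beta * r) * ((1 - beta) * x - (k - beta)).
  rewrite /ypot PotE// /kep /ccoef /x /k.
  by field; rewrite bN !gt_eqF.
have c0 : 0 < 2 / (beta * r) by rewrite divr_gt0// mulr_gt0.
split; first by rewrite -subr_ge0 F mulr_ge0 ?(ltW c0)// subr_ge0.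
rewrite -kz -H2; apply/idP/idP => /eqP h.
  move: F; rewrite h subrr => /esym/eqP; rewrite mulf_eq0 (gt_eqF c0)/= subr_eq0 eq_sym.
  by [].
by move: F; rewrite h subrr mulr0 => /eqP; rewrite subr_eq0 eq_sym.
Qed.

End Kepler.

(** * Strict positivity of integrals over the chart domain *)

Section Positive.
Context {R : realType}.
Variables (beta e : R).
Hypotheses (b0 : 0 < beta) (b1 : beta < 1) (e0 : 0 < e) (e1 : e < 1).
Hypothesis hbe : beta ^+ 2 + e ^+ 2 < 1.
Notation mu := (@lebesgue_measure R).
Notation mu3 := ((mu \x mu) \x mu)%E.
Local Notation D := (chart_dom beta e).

(** The domain contains its face phi = 0, so the point is taken with a strictly interior angle; a
    small box around it lies in the domain and carries values above half of that at the centre. *)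
Lemma chart_dom_Rintegral_gt0 (F : R -> R -> R -> R) (r0 g0 z0 : R) :
  chart_cont F ->
  (forall r g z, D ((r, g), z) -> 0 <= F r g z) ->
  0 < r0 -> 0 < g0 < 2 * pi -> 0 < ypot beta e r0 z0 -> 0 < F r0 g0 z0 ->
  0 < Rintegral mu3 D (fun q => F q.1.1 q.1.2 q.2).
Proof.
move=> cF F0 r0p /andP[g0p g0pi] yp Fp.
have iF := @chart_dom_integrable R beta e b0 b1 e0 e1 hbe F cF.
pose f (q : R * R * R) := F q.1.1 q.1.2 q.2.
pose p : R * R * R := ((r0, g0), z0).
have mD := measurable_chart_dom b0 b1 e0 e1.
have c2 : {for p, continuous (fun q : R * R * R => q.1.2)}.
  exact: (continuous_comp (@cont_fst _ _ p) (@cont_snd _ _ p.1)).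
have Np : nbhs p (D `&` [set q | F r0 g0 z0 / 2 < f q]).
  have n1 : nbhs p (positive_region beta e).
    by apply: open_nbhs_nbhs; split; [exact: open_positive_region|].
  have n2 : nbhs p [set q : R * R * R | 0 < q.1.2] by move: c2 => /cvgr_gt; apply.
  have n3 : nbhs p [set q : R * R * R | q.1.2 < 2 * pi] by move: c2 => /cvgr_lt; apply.
  have n4 : nbhs p [set q : R * R * R | F r0 g0 z0 / 2 < f q].
    have cf : {for p, continuous f} by exact: (chart_cont3 cF).
    by move: cf => /cvgr_gt; apply; rewrite /f/= ltr_pdivrMr// ltr_pMr// ltr1n.
  apply: filterS (filterI (filterI n1 n2) (filterI n3 n4)) => -[[r g] z] /= [[[k1 k2] k3] [k4 k5]].
  split=> //; apply/chart_domP; split=> //; rewrite k4 andbT; exact: ltW.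
have [ep /= ep0 hB] := (nbhs_ballP p _).1 Np.
pose B : set (R * R * R) := (ball r0 ep `*` ball g0 ep) `*` ball z0 ep.
have BD q : B q -> D q /\ F r0 g0 z0 / 2 < f q by move=> Bq; exact: hB.
have mb (x : R) : measurable (ball x ep) by exact: measurable_ball.
have mB : measurable B by apply: measurableX => //; exact: measurableX.
have EB : mu3 B = ((ep *+ 2) * (ep *+ 2) * (ep *+ 2))%:E.
  have E1 := @product_measure1E _ _ _ _ R (sigma_finite_prod mu mu) mu
    (ball r0 ep `*` ball g0 ep) (ball z0 ep) (measurableX (mb _) (mb _)) (mb _).
  have E2 := @product_measure1E _ _ _ _ R mu mu (ball r0 ep) (ball g0 ep) (mb _) (mb _).
  transitivity ((mu \x mu)%E (ball r0 ep `*` ball g0 ep) * mu (ball z0 ep))%E; first exact: E1.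
  have m2 (x : R) : (mu (ball x ep) = (ep *+ 2)%:E)%E by apply: lebesgue_measure_ball; exact: ltW.
  rewrite !EFinM; congr (_ * _)%E; last exact: m2.
  by apply: (etrans E2); congr (_ * _)%E; exact: m2.
have L : ((F r0 g0 z0 / 2)%:E * mu3 B <= \int[mu3]_(q in D) (f q)%:E)%E.
  rewrite -(@integral_cst _ _ _ mu3 B mB).
  apply: (@le_trans _ _ (\int[mu3]_(q in B) (f q)%:E)%E).
    apply: (@ge0_le_integral _ _ _ mu3 B mB).
    - by move=> q _; rewrite lee_fin divr_ge0// ltW.
    - exact: measurable_cst.
    - by apply: measurable_funS (measurable_int _ iF) => // q /BD[].
    - by move=> q Bq; rewrite lee_fin; have [_ /ltW] := BD q Bq.
  apply: (@ge0_subset_integral _ _ _ mu3 B D mB mD).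
  - exact: (measurable_int _ iF).
  - by move=> -[[r g] z] Dq; rewrite lee_fin; exact: F0.
  - by move=> q /BD[].
have fin := @integrable_fin_num _ _ _ mu3 D mD _ iF.
rewrite -lte_fin /Rintegral (fineK fin); apply: lt_le_trans L.
by rewrite EB -EFinM lte_fin !mulr_gt0// ?invr_gt0// mulr2n addr_gt0.
Qed.

End Positive.

(** * The integral of the Kepler-type function in z *)

Section KeplerZ.
Context {R : realType}.
Variables (beta e : R).
Hypotheses (b0 : 0 < beta) (b1 : beta < 1).
Local Notation w := (wcoef beta e).
Local Notation n := (kdist beta).
Local Notation s7 := (Num.sqrt (1 + 7 * beta)).
Notation mu := (@lebesgue_measure R).

(* [kep r] vanishes where r / kdist = [cosine r], that is at z = [zkep r] and its
   opposite, and [4 / s7 * kepW r] is its integral in between. *)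
Definition cosine (r : R) : R := beta * (r + w / (2 * r)).
Definition sine (r : R) : R := Num.sqrt (1 - cosine r ^+ 2).
Definition zkep (r : R) : R := r * sine r / (cosine r * s7).
Definition kepW (r : R) : R := (ln (1 + sine r) - ln (cosine r) - sine r) / beta.

Lemma kep_integral (r : R) : 0 < r -> 0 < cosine r < 1 ->
  [/\ 0 < zkep r, forall z : R, - zkep r <= z <= zkep r -> 0 <= kep beta e r z &
    (\int[mu]_(z in `[(- zkep r)%R, zkep r]) (kep beta e r z)%:E = (4 / s7 * kepW r)%:E)%E].
Proof.
move=> r0 /andP[a0 a1]; have s0 := sevenbeta_gt0 b0.
have s70 : 0 < s7 by rewrite sqrtr_gt0.
have ss : s7 ^+ 2 = 1 + 7 * beta by rewrite sqr_sqrtr// ltW.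
have aN : 0 < 1 - cosine r ^+ 2 by rewrite subr_gt0 exprn_ilt1// ltW.
have S0 : 0 < sine r by rewrite sqrtr_gt0.
have SS : sine r ^+ 2 = 1 - cosine r ^+ 2 by rewrite sqr_sqrtr// ltW.
have z0 : 0 < zkep r by rewrite divr_gt0 ?(mulr_gt0 r0)// mulr_gt0.
have nz : n r (zkep r) = r / cosine r.
  have h1 := kdist_gt0 b0 (zkep r) r0.
  apply: (@pexpIrn _ 2) => //; rewrite ?nnegrE ?(ltW h1)//; first by rewrite divr_ge0// ltW.
  rewrite sqr_kdist// -ss.
  have -> : zkep r ^+ 2 = r ^+ 2 * (1 - cosine r ^+ 2) / (cosine r ^+ 2 * s7 ^+ 2).
    by rewrite -SS /zkep; field; rewrite !gt_eqF.
  by field; rewrite !gt_eqF.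
have nN (z : R) : n r (- z) = n r z by rewrite /kdist sqrrN.
have kn (z : R) : kep beta e r z = 2 / beta * ((n r z)^-1 - cosine r / r).
  have h1 := kdist_gt0 b0 z r0.
  by rewrite /kep /cosine; field; rewrite !gt_eqF.
have key (z : R) : - zkep r <= z <= zkep r -> 0 <= kep beta e r z.
  move=> /andP[zl zu]; rewrite kn mulr_ge0 ?divr_ge0 ?(ltW b0)// subr_ge0.
  have h1 := kdist_gt0 b0 z r0.
  have -> : cosine r / r = (n r (zkep r))^-1 by rewrite nz invf_div.
  rewrite lef_pV2 ?posrE ?kdist_gt0// -(@ler_pXn2r _ 2)// ?nnegrE ?(ltW (kdist_gt0 _ _ _))//.
  rewrite !sqr_kdist// lerD2l ler_pM2l//.
  rewrite -subr_ge0 (_ : _ - _ = (zkep r - z) * (zkep r + z)); last by ring.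
  by rewrite mulr_ge0//; lra.
split=> //.
have npos (z : R) : 0 < s7 * z + n r z.
  have h1 := kdist_gt0 b0 z r0.
  suff : - (s7 * z) < n r z by lra.
  apply: (le_lt_trans (ler_norm _)).
  rewrite -(@ltr_pXn2r _ 2)// ?nnegrE ?(ltW h1)// normrN real_normK ?num_real//.
  by rewrite exprMn ss sqr_kdist// ltrDr exprn_gt0.
(* The logarithm, divided by s7, is the primitive of 1 / kdist in z, an inverse hyperbolic sine up
   to a constant. *)
pose Z (z : R) : R := 2 / (beta * s7) * ln (s7 * z + n r z) - 2 * (cosine r / (beta * r)) * z.
have dZ (z : R) : - zkep r <= z <= zkep r -> is_derive z 1 Z (kep beta e r z).
  move=> _; have h1 := kdist_gt0 b0 z r0; have h2 := kdist_arg_gt0 b0 z r0.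
  have dn : is_derive z 1 (n r) (s7 ^+ 2 * z / n r z).
    rewrite /kdist; der => //; rewrite -/(kdist beta r z) ss.
    by field; rewrite gt_eqF.
  have dl : is_derive z 1 (fun z => ln (s7 * z + n r z)) (s7 / n r z).
    have d : is_derive z 1 (fun z => s7 * z + n r z) (s7 + s7 ^+ 2 * z / n r z) by der; ring.
    have D := @der_ln R z (fun z => s7 * z + n r z) _ (npos z) d; apply: (is_derive_eq D).
    by field; rewrite !gt_eqF//= addrC.
  rewrite /Z kn; der; field; rewrite !gt_eqF//.
have ck (z : R) : - zkep r <= z <= zkep r -> {for z, continuous (kep beta e r)}.
  move=> _; have h1 := kdist_gt0 b0 z r0.
  have cn : {for z, continuous (n r)} by rewrite /kdist; cont.
  have ci : {for z, continuous (fun z => 2 / (beta * n r z))}.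
    by apply: cont_div; [rewrite mulf_neq0// gt_eqF|exact: cont_cst|exact: cont_mul (@cont_cst _ _ _ _) cn].
  exact (cont_add (cont_add ci (@cont_cst _ _ _ _)) (@cont_cst _ _ _ _)).
rewrite (FTC_closed _ dZ ck); last by rewrite gtrN.
congr (_%:E); rewrite /Z nN nz.
have E1 : s7 * zkep r = r * sine r / cosine r by rewrite /zkep; field; rewrite !gt_eqF.
have S1 : sine r < 1.
  rewrite -(@ltr_pXn2r _ 2)// ?nnegrE ?(ltW S0)// SS expr1n; have := exprn_gt0 2 a0; move=> ?; lra.
have E2 : s7 * zkep r + r / cosine r = r * ((1 + sine r) / cosine r).
  by rewrite E1; field; rewrite gt_eqF.
have E3 : s7 * - zkep r + r / cosine r = r / ((1 + sine r) / cosine r).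
  rewrite mulrN E1; apply/eqP; rewrite -subr_eq0; apply/eqP.
  transitivity (r * (1 - cosine r ^+ 2 - sine r ^+ 2) / (cosine r * (1 + sine r))).
    by field; rewrite !gt_eqF//= addr_gt0.
  by rewrite SS; ring.
have pS : 0 < (1 + sine r) / cosine r by rewrite divr_gt0// addr_gt0.
have L1 : ln (r * ((1 + sine r) / cosine r)) = ln r + ln ((1 + sine r) / cosine r) by rewrite lnM ?posrE.
have L2 : ln (r / ((1 + sine r) / cosine r)) = ln r - ln ((1 + sine r) / cosine r) by rewrite ln_div ?posrE.
have L3 : ln ((1 + sine r) / cosine r) = ln (1 + sine r) - ln (cosine r).
  by rewrite ln_div ?posrE// addr_gt0.
rewrite E2 E3 L1 L2 L3.
rewrite /kepW /zkep; field; rewrite !gt_eqF//.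
Qed.

End KeplerZ.

(** * The remaining integral in r *)

Section KeplerR.
Context {R : realType}.
Notation mu := (@lebesgue_measure R).

Lemma smooth_substitution (F dF G : R -> R) (a b : R) : a < b ->
  (forall x : R, is_derive x 1 F (dF x)) -> continuous dF ->
  {in `[a, b] &, {homo F : x y / x < y}} ->
  (forall x, F a <= x <= F b -> {for x, continuous G}) ->
  (\int[mu]_(x in `[F a, F b]) (G x)%:E = \int[mu]_(x in `[a, b]) (G (F x) * dF x)%:E)%E.
Proof.
move=> ab DF cdF incF cG.
have E : derive1 F = dF by apply/funext => x; exact: der_val (DF x).
rewrite (integration_by_substitution_increasing (ltW ab) incF) ?E//.
- exact: (cvgP _ (cvg_at_right_filter (cdF a))).
- exact: (cvgP _ (cvg_at_left_filter (cdF b))).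
- split.
  + by move=> x _; have [] := DF x.
  + by apply: cvg_at_right_filter; exact: der_cont (DF a).
  + by apply: cvg_at_left_filter; exact: der_cont (DF b).
- by apply: continuous_in_subspaceT => x; rewrite inE/= in_itv/=; exact: cG.
Qed.

Variables (beta e : R).
Hypotheses (b0 : 0 < beta) (b1 : beta < 1) (e0 : 0 < e) (e1 : e < 1).
Local Notation w := (wcoef beta e).
Local Notation q := (Num.sqrt (1 - e ^+ 2)).
Local Notation W := (kepW beta e).

(** [rlo] and [rhi] are the extreme radii of the Euler orbit, and the two solutions of [cosine r] =
    1. *)
Definition rlo : R := (1 - e) / (2 * beta).
Definition rhi : R := (1 + e) / (2 * beta).

Lemma rlo_gt0 : 0 < rlo.
Proof. by rewrite divr_gt0 ?subr_gt0// mulr_gt0. Qed.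

Lemma cosine_gt0 (r : R) : 0 < r -> 0 < cosine beta e r.
Proof.
have w0 := wcoef_gt0 b0 e0 e1; move=> r0.
by rewrite mulr_gt0// addr_gt0// divr_gt0// mulr_gt0.
Qed.

Lemma cosine_bound (r : R) : 0 < r -> rlo < r < rhi -> cosine beta e r < 1.
Proof.
move=> r0 /andP[h1 h2]; rewrite -subr_gt0.
have -> : 1 - cosine beta e r = beta / r * ((r - rlo) * (rhi - r)).
  by rewrite /cosine /wcoef /rlo /rhi; field; rewrite !gt_eqF.
by rewrite mulr_gt0 ?divr_gt0// mulr_gt0// subr_gt0.
Qed.

Lemma cont_kepW (r : R) : 0 < r -> {for r, continuous W}.
Proof.
move=> r0; have a0 := cosine_gt0 r0.
have ca : {for r, continuous (cosine beta e)}.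
  have ci : {for r, continuous (fun r : R => w / (2 * r))}.
    by apply: cont_div; [rewrite mulf_neq0// gt_eqF|exact: cont_cst|cont].
  exact (cont_mul (@cont_cst _ _ _ _) (cont_add (@cvg_id _ _) ci)).
have cs : {for r, continuous (sine beta e)} by rewrite /sine; cont.
have cl : {for r, continuous (fun r => ln (cosine beta e r))}.
  exact: (continuous_comp ca (continuous_ln a0)).
have cm : {for r, continuous (fun r => ln (1 + sine beta e r))}.
  have s0 : 0 < 1 + sine beta e r by rewrite ltr_pwDl// sqrtr_ge0.
  have c1 : {for r, continuous (fun r => 1 + sine beta e r)} by cont.
  exact: (continuous_comp c1 (continuous_ln s0)).
rewrite /kepW; cont.
Qed.

(** The modulus of 1 - e exp (i t); [D] is the real part and [es] minus the imaginary part. At r = m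
    / (2 beta), for t in [0, pi], [cosine] and [sine] become D / m and es / m, so the square root in
    [sine] disappears. *)
Let m (t : R) : R := Num.sqrt (1 + e ^+ 2 - 2 * e * cos t).
Let D (t : R) : R := 1 - e * cos t.
Let es (t : R) : R := e * sin t.

Let D_gt0 (t : R) : 0 < D t.
Proof. exact: (oneBmulcos_gt0 t (ltW e0) e1). Qed.

Let m2E (t : R) : 1 + e ^+ 2 - 2 * e * cos t = D t ^+ 2 + es t ^+ 2.
Proof.
rewrite /D /es exprMn (_ : sin t ^+ 2 = 1 - cos t ^+ 2); first by ring.
by have := cos2Dsin2 t; move=> <-; ring.
Qed.

Let marg_gt0 (t : R) : 0 < 1 + e ^+ 2 - 2 * e * cos t.
Proof. by rewrite m2E ltr_pwDl ?sqr_ge0// exprn_gt0. Qed.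

Let m_gt0 (t : R) : 0 < m t. Proof. by rewrite sqrtr_gt0. Qed.
Let sqr_m (t : R) : m t ^+ 2 = D t ^+ 2 + es t ^+ 2.
Proof. by rewrite sqr_sqrtr ?m2E// -m2E ltW. Qed.

Let der_m (t : R) : is_derive t 1 m (es t / m t).
Proof.
have h := marg_gt0 t; rewrite /m; der => //; rewrite -/(m t) /es.
by field; have := m_gt0 t; move=> k; rewrite gt_eqF.
Qed.

Let rr (t : R) : R := m t / (2 * beta).
Let dr (t : R) : R := es t / (2 * beta * m t).

Let der_rr (t : R) : is_derive t 1 rr (dr t).
Proof.
have d := der_m t; have k := m_gt0 t; rewrite /rr; der.
by rewrite /dr; field; rewrite !gt_eqF.
Qed.

Let cont_m (t : R) : {for t, continuous m}. Proof. exact: der_cont (der_m t). Qed.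

Let cont_dr : continuous dr.
Proof.
move=> t; have k := m_gt0 t; have c := cont_m (t := t).
have c1 : {for t, continuous es} by rewrite /es; cont.
by apply: cont_div; [rewrite !mulf_neq0// gt_eqF|exact: c1|cont].
Qed.

Let rr_homo : {in `[0, pi] &, {homo rr : x y / x < y}}.
Proof.
move=> x y xI yI xy; rewrite /rr ltr_pM2r ?invr_gt0 ?mulr_gt0//.
rewrite /m ltr_sqrt// ltrD2l ltrN2 ltr_pM2l ?mulr_gt0//.
by rewrite ltr_cos.
Qed.

Let Wf (t : R) : R := (ln (m t + es t) - ln (D t) - es t / m t) / beta.

Let cosine_rr (t : R) : cosine beta e (rr t) = D t / m t.
Proof.
have k := m_gt0 t; have s := sqr_m t; have h := m2E t.
apply: (@mulIf _ (2 * m t ^+ 2)); first by rewrite mulf_neq0// expf_neq0// gt_eqF.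
transitivity (m t * (m t ^+ 2 + 1 - e ^+ 2)).
  by rewrite /cosine /wcoef /rr; field; rewrite !gt_eqF.
transitivity (m t * (2 * D t)); first by rewrite s -h /D; ring.
by field; rewrite gt_eqF.
Qed.

Let W_rr (t : R) : 0 <= t <= pi -> W (rr t) = Wf t.
Proof.
move=> tI; have s0 : 0 <= es t by rewrite mulr_ge0 ?(ltW e0)// sin_ge0_pi.
have k := m_gt0 t; have d := D_gt0 t.
have S : sine beta e (rr t) = es t / m t.
  rewrite /sine cosine_rr (_ : 1 - _ = (es t / m t) ^+ 2).
    by rewrite sqrtr_sqr ger0_norm// divr_ge0// ltW.
  apply: (@mulIf _ (m t ^+ 2)); first by rewrite expf_neq0// gt_eqF.
  transitivity (m t ^+ 2 - D t ^+ 2); first by field; rewrite gt_eqF.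
  transitivity (es t ^+ 2); first by rewrite sqr_m; ring.
  by field; rewrite gt_eqF.
have L : 1 + es t / m t = (m t + es t) / m t by field; rewrite gt_eqF.
have p : 0 < m t + es t by rewrite ltr_pwDl.
rewrite /kepW S cosine_rr L !ln_div ?posrE// /Wf.
by congr (_ / _); ring.
Qed.

(** Integration by parts leaves es^2 / D and es^2 / m^2. As m^2 = (1 + e^2) (1 - ecc e cos t), both
    are integrands of [kprim], for the eccentricities e and 2 e / (1 + e^2). *)
Let P (t : R) : R := rr t * Wf t + (2 * kprim ((1 - q) / e) t - (1 + e ^+ 2) / 2 * kprim e t) / (4 * beta ^+ 2).

Let der_P (t : R) : 0 <= t <= pi -> is_derive t 1 P (Wf t * dr t).
Proof.
move=> tI; have s0 : 0 <= es t by rewrite mulr_ge0 ?(ltW e0)// sin_ge0_pi.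
have k := m_gt0 t; have d := D_gt0 t; have dm := der_m t; have drr := der_rr t.
have p : 0 < m t + es t by rewrite ltr_pwDl.
have bN : beta != 0 by rewrite gt_eqF.
have [bb0 bb1 eccE qE] := @ecc_of R e e0 e1.
have k1 := @der_kprim R _ t bb0 bb1; rewrite eccE in k1.
have k2 := @der_kprim R e t (ltW e0) e1.
have des : is_derive t 1 es (e * cos t) by rewrite /es; der; ring.
have dD : is_derive t 1 D (es t) by rewrite /D /es; der; ring.
have dl1 : is_derive t 1 (fun t => ln (m t + es t)) ((m t + es t)^-1 * (es t / m t + e * cos t)).
  have D0 : is_derive t 1 (fun t => m t + es t) (es t / m t + e * cos t) by der.
  exact: (@der_ln R t (fun t => m t + es t) _ p D0).
have dl2 : is_derive t 1 (fun t => ln (D t)) ((D t)^-1 * es t).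
  exact: (@der_ln R t D _ d dD).
have dq : is_derive t 1 (fun t => es t / m t) ((e * cos t - es t ^+ 2 / m t ^+ 2) / m t).
  by der; [rewrite gt_eqF|field; rewrite gt_eqF].
have sm := sqr_m t; have ec : e * cos t = 1 - D t by rewrite /D; ring.
have X : (m t + es t)^-1 * (es t / m t + e * cos t) = (es t * m t + D t - m t ^+ 2) / (m t * D t).
  transitivity ((es t * m t + D t - m t ^+ 2) / (m t * D t)
     + (m t ^+ 2 - es t ^+ 2 - D t ^+ 2) / (D t * (m t + es t))).
    by rewrite ec; field; rewrite !gt_eqF.
  by rewrite {2}sm; field; rewrite !gt_eqF.
rewrite X in dl1.
have dW : is_derive t 1 Wf (- (es t ^+ 2 / (D t) - es t ^+ 2 / m t ^+ 2) / (beta * m t)).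
  rewrite /Wf; der => //.
  transitivity ((- (m t ^+ 2 - D t ^+ 2) / D t + es t ^+ 2 / m t ^+ 2) / (beta * m t)).
    by rewrite ec; field; rewrite bN !gt_eqF.
  by rewrite {1}sm; field; rewrite bN !gt_eqF.
have eN : 1 + e ^+ 2 != 0 by rewrite gt_eqF// ltr_pwDl// sqr_ge0.
have K2 : (1 + e ^+ 2) / 2 * (ecc e ^+ 2 * sin t ^+ 2 / (1 - ecc e * cos t)) = 2 * es t ^+ 2 / m t ^+ 2.
  have mm : m t ^+ 2 = 1 + e ^+ 2 - 2 * e * cos t by rewrite sm m2E.
  have mN : 1 + e ^+ 2 - 2 * e * cos t != 0 by rewrite -mm gt_eqF// exprn_gt0.
  rewrite mm /ecc /es; by field; rewrite eN mN.
have K1 : e ^+ 2 * sin t ^+ 2 / (1 - e * cos t) = es t ^+ 2 / D t by rewrite /es exprMn.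
rewrite K1 in k1.
rewrite /P; der.
transitivity (Wf t * dr t + rr t * (- (es t ^+ 2 / D t - es t ^+ 2 / m t ^+ 2) / (beta * m t))
  + (2 * (es t ^+ 2 / D t) - (1 + e ^+ 2) / 2 * (ecc e ^+ 2 * sin t ^+ 2 / (1 - ecc e * cos t))) / (4 * beta ^+ 2)).
  by ring.
by rewrite K2 /rr; field; rewrite bN !gt_eqF.
Qed.

Lemma kepW_integral : (\int[mu]_(r in `[rlo, rhi]) (W r)%:E = (pi * (1 - q) ^+ 2 / (4 * beta ^+ 2))%:E)%E.
Proof.
have m0 : m 0 = 1 - e.
  rewrite /m cos0 (_ : 1 + _ - _ = (1 - e) ^+ 2); last by ring.
  by rewrite sqrtr_sqr gtr0_norm// subr_gt0.
have mp : m pi = 1 + e.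
  rewrite /m cospi (_ : 1 + _ - _ = (1 + e) ^+ 2); last by ring.
  by rewrite sqrtr_sqr gtr0_norm// addr_gt0.
have r0 : rlo = rr 0 by rewrite /rr m0.
have rp : rhi = rr pi by rewrite /rr mp.
have pi0 : (0 : R) < pi := pi_gt0 R.
rewrite r0 rp (smooth_substitution pi0 der_rr cont_dr rr_homo); last first.
  by move=> x /andP[h _]; apply: cont_kepW; apply: lt_le_trans h; rewrite -r0; exact: rlo_gt0.
transitivity (\int[mu]_(t in `[0%R, pi]) (Wf t * dr t)%:E)%E.
  by apply: eq_integral => t; rewrite inE/= in_itv/= => /W_rr ->.
have cW (t : R) : 0 <= t <= pi -> {for t, continuous (fun t => Wf t * dr t)}.
  move=> tI; have s0 : 0 <= es t by rewrite mulr_ge0 ?(ltW e0)// sin_ge0_pi.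
  have k := m_gt0 t; have d := D_gt0 t; have cm := cont_m (t := t).
  have p : 0 < m t + es t by rewrite ltr_pwDl.
  have ce : {for t, continuous es} by rewrite /es; cont.
  have cD : {for t, continuous D} by rewrite /D; cont.
  have c0 : {for t, continuous (fun t => m t + es t)} by cont.
  have c1 : {for t, continuous (fun t => ln (m t + es t))}.
    exact: (continuous_comp c0 (continuous_ln p)).
  have c2 : {for t, continuous (fun t => ln (D t))}.
    exact: (continuous_comp cD (continuous_ln d)).
  have c3 : {for t, continuous (fun t => es t / m t)}.
    by apply: cont_div; [rewrite gt_eqF|exact: ce|exact: cm].
  exact (cont_mul (cont_mul (cont_add (cont_add c1 (cont_opp c2)) (cont_opp c3)) (@cont_cst _ _ _ _))
    (cont_dr (x := t))).
rewrite (FTC_closed pi0 der_P cW); congr (_%:E).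
have [bb0 bb1 eccE qE] := @ecc_of R e e0 e1.
have W0 : Wf 0 = 0.
  by rewrite /Wf m0 /es /D sin0 cos0 mulr0 mulr1 addr0 subrr mul0r subr0 mul0r.
have Wp : Wf pi = 0.
  by rewrite /Wf mp /es /D sinpi cospi mulr0 mulrN1 opprK addr0 subrr mul0r subr0 mul0r.
have H1 := kprim_half ((1 - q) / e); have H2 := kprim_half e.
rewrite qE in H1.
rewrite /P W0 Wp !mulr0 !add0r -mulrBl.
have eN : 1 + e ^+ 2 != 0 by rewrite gt_eqF// ltr_pwDl// sqr_ge0.
transitivity ((2 * (kprim ((1 - q) / e) pi - kprim ((1 - q) / e) 0)
  - (1 + e ^+ 2) / 2 * (kprim e pi - kprim e 0)) / (4 * beta ^+ 2)); first by ring.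
have q2 : q ^+ 2 = 1 - e ^+ 2.
  by rewrite sqr_sqrtr// subr_ge0 exprn_ile1// ltW.
rewrite H1 H2; congr (_ / _).
transitivity (pi * (2 * (1 - q) - e ^+ 2)); first by field.
by congr (_ * _); rewrite sqrrB q2; ring.
Qed.

End KeplerR.

(** * The lower bound for the contact volume *)

Section Volume.
Context {R : realType}.
Variables (beta e : R).
Hypotheses (b0 : 0 < beta) (b1 : beta < 1) (e0 : 0 < e) (e1 : e < 1).
Hypothesis hbe : beta ^+ 2 + e ^+ 2 < 1.
Notation mu := (@lebesgue_measure R).
Notation mu3 := ((mu \x mu) \x mu)%E.
Local Notation D := (chart_dom beta e).
Local Notation W := (kepW beta e).
Local Notation K := (kep beta e).
Local Notation q := (Num.sqrt (1 - e ^+ 2)).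
Local Notation s7 := (Num.sqrt (1 + 7 * beta)).

Lemma cont_kep (T : topologicalType) (x : T) (r z : T -> R) : 0 < r x ->
  {for x, continuous r} -> {for x, continuous z} ->
  {for x, continuous (fun t => K (r t) (z t))}.
Proof.
move=> r0 cr cz; have h := kdist_gt0 b0 (z x) r0.
have k1 : {for x, continuous (fun t => kdist beta (r t) (z t))} by rewrite /kdist; cont.
have k2 : {for x, continuous (fun t => 2 / (beta * kdist beta (r t) (z t)))}.
  by apply: cont_div; [rewrite mulf_neq0// gt_eqF|exact: cont_cst|exact: cont_mul (@cont_cst _ _ _ _) k1].
have k3 : {for x, continuous (fun t => wcoef beta e / r t ^+ 2)}.
  by apply: cont_div; [rewrite expf_neq0// gt_eqF|exact: cont_cst|exact: cont_exp cr].
exact (cont_add (cont_add k2 (@cont_cst _ _ _ _)) (cont_opp k3)).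
Qed.

Let g (r f z : R) : R := pos_part (K r z).

Let cg : chart_cont g.
Proof.
move=> T x r f z r0 cr _ cz.
exact: (continuous_comp (cont_kep r0 cr cz) (@pos_part_cont _ _)).
Qed.

Let kep_slice (r : R) : 0 < r -> rlo beta e < r < rhi beta e ->
  [/\ 0 < zkep beta e r, forall z : R, - zkep beta e r <= z <= zkep beta e r -> 0 <= K r z &
    (\int[mu]_(z in `[(- zkep beta e r)%R, zkep beta e r]) (K r z)%:E = (4 / s7 * W r)%:E)%E].
Proof.
move=> r0 rI; apply: kep_integral => //.
by rewrite cosine_gt0//= cosine_bound.
Qed.

Let J : set R := `[0, 2 * pi[%classic.
Let I : set R := `]rlo beta e, rhi beta e[%classic.
Let G : R * R * R -> \bar R := (fun p => (g p.1.1 p.1.2 p.2)%:E) \_ D.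

Let mG : measurable_fun setT G.
Proof.
apply/(measurable_restrictT _ (measurable_chart_dom b0 b1 e0 e1)).
exact: (measurable_int _ (chart_dom_integrable b0 b1 e0 e1 hbe cg)).
Qed.

Let G0 p : (0 <= G p)%E.
Proof. by rewrite /G patchE; case: ifP => // _; rewrite lee_fin pos_part_ge0. Qed.

Let I_gt0 (r : R) : I r -> 0 < r.
Proof.
by rewrite /I/= in_itv/= => /andP[h _]; apply: lt_trans h; exact: rlo_gt0.
Qed.

Let slice_ge (r f : R) : I r -> J f -> (0 <= (4 / s7 * W r)%:E <= \int[mu]_z G ((r, f), z))%E.
Proof.
move=> rI fJ; have r0 := I_gt0 rI.
have rlt : rlo beta e < r < rhi beta e by move: rI; rewrite /I/= in_itv.
have [z0 kpos kint] := kep_slice r0 rlt.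
rewrite -kint; apply/andP; split.
  by apply: integral_ge0 => z; rewrite /= in_itv/= => /kpos; rewrite lee_fin.
have mGs : measurable_fun setT (fun z => G ((r, f), z)).
  exact: (measurableT_comp mG (pair1_measurable (r, f))).
apply: (@le_trans _ _ (\int[mu]_(z in `[(- zkep beta e r)%R, zkep beta e r]) G ((r, f), z))%E).
  rewrite le_eqVlt; apply/orP; left; apply/eqP; apply: eq_integral => z.
  rewrite inE/= in_itv/= => /kpos kz; rewrite /G patchE /g/= pos_partE//.
  (* Outside the domain [ypot] is nonpositive; [kep], nonnegative here and below [ypot], must then
     be 0, which is the value of the extension by zero. *)
  case: ifPn => //; rewrite notin_setE => nD; congr (_%:E).
  apply/eqP; rewrite eq_le kz andbT leNgt; apply/negP => kp; apply: nD.
  apply/chart_domP; split; [exact: r0|exact: fJ|].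
  by apply: lt_le_trans kp _; have [] := kep_le_ypot b0 b1 e0 e1 hbe r0 kz.
apply: ge0_subset_integral => //; exact: measurable_itv.
Qed.

Let mIJ : measurable (I `*` J).
Proof. by apply: measurableX; exact: measurable_itv. Qed.

Let H : R * R -> \bar R := (fun p => (4 / s7 * W p.1)%:E) \_ (I `*` J).

Let mH : measurable_fun setT H.
Proof.
apply/(measurable_restrictT _ mIJ); apply/measurable_EFinP.
pose U : set (R * R) := [set p | 0 < p.1].
have oU : open U.
  rewrite openE => p p0; have c : {for p, continuous (fun p : R * R => p.1)} by exact: cont_fst.
  by move: c => /cvgr_gt; apply.
apply: (@measurable_funS _ _ _ _ U).
- exact: open_measurable2.
- by move=> p [/I_gt0].
apply: cont_measurable2 => // p p0.
apply: cont_mul; first exact: cont_cst.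
exact: (continuous_comp (@cont_fst _ _ p) (cont_kepW b0 e0 e1 p0)).
Qed.

Let H_le p : (0 <= H p <= \int[mu]_z G (p, z))%E.
Proof.
rewrite /H patchE; case: ifPn => [|_]; last by rewrite lexx/=; apply: integral_ge0 => z _; exact: G0.
by rewrite inE => -[pI pJ]; case: p pI pJ => r f; exact: slice_ge.
Qed.

Let H_int : (\int[(mu \x mu)%E]_p H p = (2 * pi * (4 / s7) * (pi * (1 - q) ^+ 2 / (4 * beta ^+ 2)))%:E)%E.
Proof.
have H0 p : (0 <= H p)%E by have /andP[] := H_le p.
rewrite (@fubini_tonelli1 _ _ _ _ R mu mu H mH H0) /fubini_F.
have pi0 : 0 < pi :> R := pi_gt0 R.
have s0 : 0 < s7 by rewrite sqrtr_gt0 sevenbeta_gt0.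
have mJ : (mu J = (2 * pi)%:E)%E.
  by rewrite /J lebesgue_measure_itv/= lte_fin mulr_gt0// sube0.
transitivity (\int[mu]_(r in I) ((2 * pi * (4 / s7))%:E * (W r)%:E))%E.
  rewrite [RHS]integral_mkcond; apply: eq_integral => r _.
  rewrite patchE; case: ifPn => [rI|]; last first.
    rewrite notin_setE => rI; apply: integral0_eq => f _.
    by rewrite /H patchE ifF//; apply/negbTE; rewrite notin_setE => -[].
  rewrite inE in rI.
  transitivity (\int[mu]_(f in J) (cst (4 / s7 * W r)%:E f))%E.
    rewrite [RHS]integral_mkcond; apply: eq_integral => f _; rewrite /H !patchE.
    have -> // : ((r, f) \in I `*` J) = (f \in J).
    by apply/idP/idP; rewrite !inE /= => h; [case: h|].
  rewrite integral_cst; last exact: measurable_itv.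
  by rewrite [X in (_ * X)%E]mJ -!EFinM; congr (_%:E); ring.
have Wge (r : R) : I r -> 0 <= W r.
  move=> rI; have J0 : J 0 by rewrite /J/= in_itv/= lexx mulr_gt0.
  have /andP[] := slice_ge rI J0; rewrite lee_fin => h _.
  by rewrite pmulr_rge0 ?divr_gt0// in h.
have mW : measurable_fun I (EFin \o W).
  apply/measurable_EFinP; apply: subspace_continuous_measurable_fun; first exact: measurable_itv.
  by apply: continuous_in_subspaceT => r; rewrite inE => rI; exact: (cont_kepW b0 e0 e1 (I_gt0 rI)).
have W0 (r : R) : I r -> (0 <= (EFin \o W) r)%E by move=> rI; rewrite lee_fin Wge.
have k0 : (0 <= (2 * pi * (4 / s7))%:E)%E.
  by rewrite lee_fin mulr_ge0 ?divr_ge0 ?(ltW s0)// mulr_ge0// ltW.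
have mI : measurable I by exact: measurable_itv.
rewrite (@ge0_integralZl _ _ _ mu I mI (EFin \o W) mW _ W0 k0).
have E := @integral_itv_bndoo R (rlo beta e) (rhi beta e) (EFin \o W) true false mW.
by rewrite -[X in (_ * X)%E]E [X in (_ * X)%E](kepW_integral b0 e0 e1) -EFinM.
Qed.

(** Tonelli's theorem for the extension by zero, keeping only the radii between [rlo] and [rhi] and,
    for each, the heights up to [zkep]; the angle contributes the factor 2 pi. *)
Lemma kepler_volume_ge :
  2 * pi * (4 / s7) * (pi * (1 - q) ^+ 2 / (4 * beta ^+ 2)) <= Rintegral mu3 D (fun p => pos_part (K p.1.1 p.2)).
Proof.
have iG := chart_dom_integrable b0 b1 e0 e1 hbe cg.
have mD := measurable_chart_dom b0 b1 e0 e1.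
have fin := @integrable_fin_num _ _ _ mu3 D mD _ iG.
rewrite -lee_fin /Rintegral (fineK fin) -H_int.
have -> : (\int[mu3]_(p in D) (EFin \o (fun p : R * R * R => g p.1.1 p.1.2 p.2)) p = \int[mu3]_p G p)%E.
  exact: integral_mkcond.
rewrite [leRHS](@fubini_tonelli1 _ _ _ _ R (sigma_finite_prod mu mu) mu G mG G0).
apply: (@ge0_le_integral _ _ _ (mu \x mu)%E setT).
- exact: measurableT.
- by move=> p _; have /andP[] := H_le p.
- exact: mH.
- exact: measurable_fun_fubini_tonelli_F.
- by move=> p _; have /andP[] := H_le p.
Qed.

Lemma volume_gt (lam : 'rV[R]_4 -> 'rV[R]_4) : is_contact_form beta e lam ->
  2 * pi * (4 / s7) * (pi * (1 - q) ^+ 2 / (4 * beta ^+ 2)) < contact_volume beta e lam.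
Proof.
move=> hlam; rewrite (contact_volumeE b0 b1 e0 e1 hbe hlam).
have iG := chart_dom_integrable b0 b1 e0 e1 hbe cg.
have mD := measurable_chart_dom b0 b1 e0 e1.
pose h (r f z : R) : R := ypot beta e r z - g r f z.
have ch : chart_cont h.
  move=> T x r f z r0 cr cf cz.
  exact: (cont_add (cont_ypot b0 b1 e0 e1 r0 cr cz) (cont_opp (cg r0 cr cf cz))).
have ih := chart_dom_integrable b0 b1 e0 e1 hbe ch.
have E : Rintegral mu3 D (fun p => ypot beta e p.1.1 p.2) =
    Rintegral mu3 D (fun p => g p.1.1 p.1.2 p.2 + h p.1.1 p.1.2 p.2).
  by apply: eq_Rintegral => p _; rewrite /h addrC subrK.
have E2 := @RintegralD _ _ _ mu3 D _ _ mD iG ih.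
rewrite E [ltRHS]E2; apply: (le_lt_trans kepler_volume_ge); rewrite ltrDl.
(* Strictness needs one point off z = 0 where [kep] is nonnegative: the midpoint of the radial
   interval with height [zkep] > 0 serves. *)
have rI : rlo beta e < (2 * beta)^-1 < rhi beta e.
  have i0 : 0 < (2 * beta)^-1 by rewrite invr_gt0 mulr_gt0.
  by rewrite /rlo /rhi gtr_pMl// ltr_pMl// ltrDl e0 gtrBl e0.
have r0 : 0 < (2 * beta)^-1 by rewrite invr_gt0 mulr_gt0.
have [z0 kpos _] := kep_slice r0 rI.
set r := (2 * beta)^-1 in rI r0 z0 kpos.
have kz : 0 <= K r (zkep beta e r) by apply: kpos; rewrite lexx andbT; lra.
have [l1 l2] := kep_le_ypot b0 b1 e0 e1 hbe r0 kz.
have lt : K r (zkep beta e r) < ypot beta e r (zkep beta e r).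
  by rewrite lt_neqAle l1 l2 gt_eqF.
have pi0 : 0 < pi :> R := pi_gt0 R.
apply: (@chart_dom_Rintegral_gt0 R beta e b0 b1 e0 e1 hbe h r pi (zkep beta e r)) => //.
- move=> r1 f1 z1 /chart_domP[r1p _ y1]; rewrite /h /g subr_ge0.
  have [k1|k1] := leP 0 (K r1 z1).
    by rewrite pos_partE//; have [] := kep_le_ypot b0 b1 e0 e1 hbe r1p k1.
  by rewrite pos_part0 ltW.
- by rewrite pi0/=; lra.
- exact: le_lt_trans kz lt.
- by rewrite /h /g pos_partE// subr_gt0.
Qed.

End Volume.

Theorem theorem1p2 (R : realType) (beta e : R)
    (beta01 : 0 < beta < 1) (e01 : 0 < e < 1)
    (hbe : 0 < beta ^+ 2 + e ^+ 2 < 1)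
    (lam : 'rV[R]_4 -> 'rV[R]_4) (hlam : is_contact_form beta e lam)
    (c : R -> 'rV[R]_4) (L : R) (hc : parametrizes_euler_orbit beta e c L)
    (rho : R) (hrho : euler_rotation_number beta e rho) :
  let T := line_integral lam c L in
  [/\ T ^+ 2 / Num.sqrt (1 + 7 * beta) < contact_volume beta e lam,
      T ^+ 2 / (rho - 1) < T ^+ 2 / Num.sqrt (1 + 7 * beta) &
      T = 2 * pi * ((1 - Num.sqrt (1 - e ^+ 2)) / (Num.sqrt 2 * beta))].
Proof.
move=> T; have /andP[b0 b1] := beta01; have /andP[e0 e1] := e01; have /andP[_ hbe1] := hbe.
have TE : T = 2 * pi * ((1 - Num.sqrt (1 - e ^+ 2)) / (Num.sqrt 2 * beta)).
  exact: (action_value b0 b1 e0 e1 hlam hc).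
have s0 : 0 < Num.sqrt (1 + 7 * beta) by rewrite sqrtr_gt0; lra.
have q1 : Num.sqrt (1 - e ^+ 2) < 1.
  by rewrite -[ltRHS]sqrtr1 ltr_sqrt// gtrBl exprn_gt0.
have T0 : 0 < T.
  have h1 : 0 < 2 * pi :> R by apply: mulr_gt0 => //; exact: pi_gt0.
  have h2 : 0 < (1 - Num.sqrt (1 - e ^+ 2)) / (Num.sqrt 2 * beta).
    by apply: divr_gt0; [rewrite subr_gt0|apply: mulr_gt0 => //; rewrite sqrtr_gt0].
  by rewrite TE; exact: mulr_gt0.
split=> //.
- have V := volume_gt b0 b1 e0 e1 hbe1 hlam.
  suff -> : T ^+ 2 / Num.sqrt (1 + 7 * beta) = 2 * pi * (4 / Num.sqrt (1 + 7 * beta)) *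
    (pi * (1 - Num.sqrt (1 - e ^+ 2)) ^+ 2 / (4 * beta ^+ 2)) by [].
  have r2 : Num.sqrt 2 ^+ 2 = 2 :> R by rewrite sqr_sqrtr.
  have r2N : Num.sqrt 2 != 0 :> R by rewrite gt_eqF// sqrtr_gt0.
  transitivity (2 * (2 * pi ^+ 2 * (1 - Num.sqrt (1 - e ^+ 2)) ^+ 2 / Num.sqrt 2 ^+ 2 / beta ^+ 2
     / Num.sqrt (1 + 7 * beta))).
    by rewrite TE; field; rewrite r2N !gt_eqF.
  by rewrite r2; field; rewrite !gt_eqF.
- have hr := rotation_number_gt beta01 e01 hrho.
  have r0 : 0 < rho - 1 := lt_trans s0 hr.
  by rewrite ltr_pM2l ?exprn_gt0// ltf_pV2 ?posrE.
Qed.
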